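(* In the setting of critical percolation in high dimensions, there are constants $c,C>0$ such that for all integers $n\ge 1$ and all $\lambda>0$, $$\mathbb{P}_{p_c}\big(S_n\ge \lambda n^2\mid 0\leftrightarrow\partial B(n)\big)\le C\exp(-c\lambda).$$
   Context: $\mathbb{Z}^d$ denotes the hypercubic lattice, with edge set $\{\{x,y\}:\|x-y\|_1=1\}$; $\|\cdot\|$ is the $\ell^\infty$ norm. In Bernoulli bond percolation with parameter $p$ (law $\mathbb{P}_p$) each edge is independently open with probability $p$. $\mathfrak{C}(x)$ is the open cluster of $x$, $\{x\leftrightarrow y\}=\{y\in\mathfrak{C}(x)\}$, and $\{x\leftrightarrow A\}$ means $x\leftrightarrow y$ for some $y\in A$. $p_c=\inf\{p:\mathbb{P}_p(|\mathfrak{C}(0)|=\infty)>0\}$. Standing assumption (''high dimensions''): $d>6$ and there are constants $c,C>0$ with $c\|x-y\|^{2-d}\le \mathbb{P}_{p_c}(x\leftrightarrow y)\le C\|x-y\|^{2-d}$ for all distinct $x,y\in\mathbb{Z}^d$. $B(n)=[-n,n]^d\cap\mathbb{Z}^d$; for $A\subseteq\mathbb{Z}^d$, $\partial A=\{x\in A:\exists y\in\mathbb{Z}^d\setminus A,\ \|x-y\|_1=1\}$. $S_n$ is the chemical distance from $0$ to $\partial B(n)$: the number of edges in the shortest open path from $0$ to a vertex of $\partial B(n)$ ($\infty$ if none exists). Constants may depend on $d$ but not on $n$ or $\lambda$. *)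

(* Defs.v *)
From HB Require Import structures.
From mathcomp Require Import all_boot all_order all_algebra finmap.
From mathcomp Require Import all_classical all_reals all_analysis.
From mathcomp Require Import measurable_realfun.

Set Implicit Arguments.
Unset Strict Implicit.
Unset Printing Implicit Defensive.

Import Order.TTheory GRing.Theory Num.Theory.

Local Open Scope classical_set_scope.
Local Open Scope ring_scope.

Definition vertex (d : nat) := 'rV[int]_d.

Definition norm1 (d : nat) (x : vertex d) : nat := (\sum_(i < d) `|x ord0 i|)%N.

Definition normoo (d : nat) (x : vertex d) : nat := \max_(i < d) `|x ord0 i|%N.

Definition is_edge (d : nat) (e : {fset vertex d}) : bool :=
  `[< exists x y : vertex d, norm1 (x - y) = 1%N /\ e = [fset x; y]%fset >].

Definition edge (d : nat) := {e : {fset vertex d} | is_edge e}.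

(* [w e = true] means that [e] is open.  The sigma-algebra is the product one,
   generated by the coordinate events. *)
Definition config (d : nat) :=
  g_sigma_algebraType
    [set A : set (edge d -> bool) | exists e, A = [set w | w e = true]].

(* These finite-dimensional marginals determine [P]. *)
Definition bernoulli_law (R : realType) (d : nat) (p : R)
    (P : probability (config d) R) :=
  forall (F : {fset edge d}) (b : edge d -> bool),
    P [set w : config d | forall e, e \in F -> w e = b e] =
    (\prod_(e <- F) (if b e then p else 1 - p))%:E.

Lemma pushforward_exists d d' (T : measurableType d) (T' : measurableType d')
    (R : realType) (P : probability T R) (f : T -> T') :
  measurable_fun [set: T] f ->
  exists Q : probability T' R, forall A, Q A = P (f @^-1` A).
Proof. by move=> mf; exists (distribution P (mfun_Sub (mem_set mf))). Qed.

(* Existence: the edges, enumerated by [choice.pickle], read off the successive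
   p-biased digits of a uniform variable on [0, 1]. *)
Section existence.
Context (R : realType) (p : R).
Hypothesis p01 : 0 <= p <= 1.

Let step (x : R) : R := if x < p then x / p else (x - p) / (1 - p).
Let bit (n : nat) (x : R) : bool := iter n step x < p.
Let wt (b : bool) : R := if b then p else 1 - p.
Let mu : probability _ R := uniform_prob (@ltr01 R).

Let p0 : 0 <= p. Proof. by case/andP: p01. Qed.
Let p1 : 0 <= 1 - p. Proof. by rewrite subr_ge0; case/andP: p01. Qed.
Let wt_ge0 b : 0 <= wt b. Proof. by case: b. Qed.

Let measurable_step : measurable_fun [set: R] step.
Proof.
apply: measurable_fun_ifT.
- exact: measurable_fun_ltr.
- exact: measurable_funM.
- by apply: measurable_funM => //; exact: measurable_funB.
Qed.

Let measurable_bit n : measurable_fun [set: R] (bit n).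
Proof.
apply: measurable_fun_ltr => //; elim: n => [|n IH]; first exact: measurable_id.
rewrite (_ : iter _ _ = step \o iter n step) //.
exact: measurableT_comp.
Qed.

Let bit_itv n (f : nat -> bool) :
  exists a, [/\ 0 <= a, a + \prod_(i < n) wt (f i) <= 1 &
    forall x, 0 <= x < 1 ->
      ((forall i, (i < n)%N -> bit i x = f i) <->
       (a <= x < a + \prod_(i < n) wt (f i)))].
Proof.
elim: n f => [|n IH] f.
  by exists 0; rewrite big_ord0 add0r lexx; split.
have [a [a0 a1 aP]] := IH (fun i => f i.+1).
rewrite big_ord_recl /=; set q := \prod_(i < n) _ in a1 aP *.
have q0 : 0 <= q by apply: prodr_ge0.
have splitb (x : R) : (forall i, (i < n.+1)%N -> bit i x = f i) <->
    (bit 0 x = f 0%N /\ forall i, (i < n)%N -> bit i (step x) = f i.+1).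
  split=> [H|[H0 H] [|i] //]; last by move=> /H <-; rewrite /bit iterSr.
  by split=> [|i /= ni]; [exact: H|rewrite -H// /bit iterSr].
have [f0|f0] := boolP (f 0%N).
- exists (p * a); rewrite /wt; split.
  + exact: mulr_ge0.
  + by rewrite -mulrDr (le_trans (ler_wpM2l p0 a1))// mulr1 -subr_ge0.
  + move=> x /andP[x0 x1]; apply: (iff_trans (splitb x)); rewrite f0 /bit/=.
    split=> [[xp]|].
      have pp : 0 < p by exact: le_lt_trans xp.
      move=> /aP; rewrite /step xp => /(_ _)/wrap[].
        by rewrite divr_ge0//= ltr_pdivrMr// mul1r.
      by rewrite ler_pdivlMr// ltr_pdivrMr// -mulrDr !(mulrC p).
    rewrite -mulrDr => /andP[ax xa].
    have pp : 0 < p.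
      rewrite lt_neqAle p0 andbT; apply/eqP => pE.
      by move: xa; rewrite -pE mul0r ltNge x0.
    have xp : x < p.
      by rewrite (lt_le_trans xa)// -[leRHS]mulr1 ler_wpM2l.
    split=> //; apply/aP; rewrite /step xp.
      by rewrite divr_ge0//= ltr_pdivrMr// mul1r.
    by rewrite ler_pdivlMr// ltr_pdivrMr// !(mulrC _ p) ax.
- exists (p + (1 - p) * a); rewrite /wt; split.
  + by rewrite addr_ge0// mulr_ge0.
  + rewrite -addrA -mulrDr -lerBrDl (le_trans (ler_wpM2l p1 a1))//.
    by rewrite mulr1.
  + move=> x /andP[x0 x1]; apply: (iff_trans (splitb x)).
    rewrite (negbTE f0) /bit/=.
    split=> [[xp]|].
      have pp : 0 < 1 - p by rewrite subr_gt0 (le_lt_trans _ x1)// leNgt xp.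
      have px : p <= x by rewrite leNgt xp.
      move=> /aP; rewrite /step xp => /(_ _)/wrap[].
        by rewrite divr_ge0 ?(ltW pp) ?subr_ge0//= ltr_pdivrMr// mul1r ltrD2r.
      rewrite ler_pdivlMr// ltr_pdivrMr// lerBrDl ltrBlDl.
      by rewrite -addrA -mulrDr !(mulrC (1 - p)).
    rewrite -addrA -mulrDr => /andP[ax xa].
    have px : p <= x by rewrite (le_trans _ ax)// lerDl mulr_ge0.
    have pp : 0 < 1 - p by rewrite subr_gt0 (le_lt_trans px).
    have xp : (x < p) = false by rewrite ltNge px.
    split=> //; apply/aP; rewrite /step xp.
      by rewrite divr_ge0 ?(ltW pp) ?subr_ge0//= ltr_pdivrMr// mul1r ltrD2r.
    by rewrite ler_pdivlMr// ltr_pdivrMr// lerBrDl ltrBlDl !(mulrC _ (1 - p)) ax.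
Qed.

Let mu_itv (a b : R) : 0 <= a -> a <= b -> b <= 1 ->
  mu `[a, b[%classic = (b - a)%:E.
Proof.
move=> a0 ab b1; rewrite /mu /= /uniform_prob.
rewrite (eq_integral (cst 1%:E)); last first.
  move=> x; rewrite inE/= in_itv/= => /andP[ax xb].
  by rewrite /uniform_pdf (le_trans a0 ax) (le_trans (ltW xb) b1) subr0 invr1.
rewrite integral_cst//= mul1e lebesgue_measure_itv/= lte_fin.
case: ltP => // ba; rewrite (@le_anti _ _ a b) ?subrr//.
by rewrite ab ba.
Qed.

Let mu_bits n (f : nat -> bool) :
  mu [set x | forall i, (i < n)%N -> bit i x = f i] =
  (\prod_(i < n) wt (f i))%:E.
Proof.
have [a [a0 a1 aP]] := bit_itv n f; set q := \prod_(i < n) _ in a1 aP *.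
have q0 : 0 <= q by apply: prodr_ge0.
set A := [set x | _].
have mA : measurable A.
  rewrite (_ : A = \bigcap_(i in `I_n) (bit i @^-1` [set f i])).
    apply: bigcap_measurableType => i _; rewrite -[X in measurable X]setTI.
    exact: measurable_bit.
  by apply/seteqP; split.
have I1 : mu `[0, 1[%classic = 1%E by rewrite mu_itv// subr0.
have IC : mu (~` `[0, 1[%classic) = 0%E.
  by rewrite probability_setC// I1 subee.
rewrite (@measureDI _ _ _ mu A `[0, 1[%classic)//.
rewrite (@subset_measure0 _ _ _ mu _ (~` `[0, 1[%classic)) ?add0e//; last 2 first.
- exact: measurableD.
- exact: measurableC.
rewrite (_ : A `&` _ = `[a, a + q[%classic).
  apply: (etrans (@mu_itv a (a + q) a0 _ a1)); first by rewrite lerDl.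
  by rewrite addrAC subrr add0r.
apply/seteqP; split=> x /=; rewrite !in_itv/=.
  by move=> [Ax x01]; apply/aP.
move=> /andP[ax xa]; have x01 : 0 <= x < 1.
  by rewrite (le_trans a0 ax) (lt_le_trans xa a1).
by split=> //; apply/aP => //; rewrite ax.
Qed.

Let mu_partial_bits n m (J : pred nat) (f : nat -> bool) :
  (forall i, (m <= i < n)%N -> J i) ->
  mu [set x | forall i, (i < n)%N -> J i -> bit i x = f i] =
  (\prod_(i < n | J i) wt (f i))%:E.
Proof.
elim: m J f => [|m IH] J f HJ.
  rewrite (eq_bigl xpredT) /=; last by move=> i; apply: HJ; rewrite ltn_ord.
  rewrite -mu_bits; congr (mu _); apply/seteqP; split=> x /= H i ni.
    by apply: H => //; exact: HJ.
  by move=> _; exact: H.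
have [Jm|Jm] := boolP ((n <= m)%N || J m).
  apply: IH => i; rewrite leq_eqVlt => /andP[/orP[/eqP<-|mi] ni].
    by move: Jm; rewrite leqNgt ni.
  by apply: HJ; rewrite mi.
move: Jm; rewrite negb_or -ltnNge => /andP[mn Jm].
pose J' i := (i == m) || J i.
pose g b i := if i == m then b else f i.
have HJ' i : (m <= i < n)%N -> J' i.
  rewrite /J' leq_eqVlt eq_sym => /andP[/orP[->//|mi] ni].
  by rewrite HJ ?orbT// mi.
have prodE b : \prod_(i < n | J' i) wt (g b i) =
    wt b * \prod_(i < n | J i) wt (f i).
  rewrite (bigD1 (Ordinal mn)) /=; last by rewrite /J' eqxx.
  rewrite {1}/g eqxx; congr (_ * _); apply: eq_big => [i|i].
    rewrite /J' -val_eqE/=; have [->|//] := eqVneq (i : nat) m.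
      by rewrite (negbTE Jm).
    by rewrite andbT.
  by rewrite -val_eqE/= /g => /andP[_ /negbTE ->].
pose A b := [set x | forall i, (i < n)%N -> J' i -> bit i x = g b i].
have mA b : measurable (A b).
  rewrite (_ : A b =
      \bigcap_(i in [set i | (i < n)%N /\ J' i]) (bit i @^-1` [set g b i])).
    apply: bigcap_measurableType => i _; rewrite -[X in measurable X]setTI.
    exact: measurable_bit.
  by apply/seteqP; split=> x /= H i => [[]|ni Ji]; apply: H.
rewrite (_ : [set x | _] = A true `|` A false).
  have muA b : mu (A b) = (\prod_(i < n | J' i) wt (g b i))%:E by exact: IH.
  transitivity (mu (A true) + mu (A false))%E; last first.
    by rewrite !muA !prodE -EFinD -mulrDl /= addrCA subrr addr0 mul1r.
  apply: measureU; [exact: mA|exact: mA|].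
  apply/seteqP; split=> // x [/= /(_ m mn) + /(_ m mn)].
  by rewrite /J' /g eqxx => -> // /(_ isT).
apply/seteqP; split=> [x /= H|x].
  have: A (bit m x) x.
    move=> i ni; rewrite /J' /g; case: eqP => [->//|_ /= Ji].
    exact: H.
  by case: (bit m x) => ?; [left|right].
by move=> [] /= H i ni Ji; have := H i ni; rewrite /J' /g Ji orbT;
  (case: eqP Ji Jm => [->|_] => [->//|_ _]); apply.
Qed.

Variable d : nat.

Let X (x : R) : config d := fun e => bit (choice.pickle e) x.

Let measurable_X : measurable_fun [set: measurableTypeR R] X.
Proof.
apply: (@measurability _ _ _ (config d) [set: measurableTypeR R] X
  [set A : set (edge d -> bool) | exists e, A = [set w | w e = true]]).
  by [].
move=> _ [_ [e ->] <-]; rewrite setTI.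
rewrite (_ : _ @^-1` _ = bit (choice.pickle e) @^-1` [set true]) //.
by rewrite -[X in measurable X]setTI; exact: measurable_bit.
Qed.

Lemma bernoulli_law_exists :
  exists P : probability (config d) R, bernoulli_law p P.
Proof.
have [P PE] := pushforward_exists mu measurable_X.
exists P => F b; rewrite PE.
pose n := (\max_(e <- F) choice.pickle e).+1.
pose J : pred nat := [pred i | i \in map choice.pickle F].
pose f i := if choice.unpickle i is Some e then b e else true.
have ltF e : e \in F -> (choice.pickle e < n)%N.
  by move=> eF; rewrite ltnS (leq_bigmax_seq _ eF).
transitivity (\prod_(i < n | J i) wt (f i))%:E; last first.
  congr (_%:E); rewrite -(big_mkord J (wt \o f)).
  rewrite -big_filter (perm_big (map choice.pickle F)).
    by rewrite big_map; apply: eq_bigr => e _; rewrite /= /f choice.pickleK.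
  apply: uniq_perm.
  - by rewrite filter_uniq// iota_uniq.
  - by rewrite map_inj_uniq ?fset_uniq//; exact: (pcan_inj choice.pickleK).
  move=> i; rewrite mem_filter mem_index_iota/= /J/=.
  by case: mapP => //= -[e eF ->]; rewrite ltF.
rewrite -(@mu_partial_bits n n) => [|i /andP[ni]]; last by rewrite ltnNge ni.
congr (mu _); apply/seteqP; split=> x /= H.
  move=> i ni /mapP[e eF ->]; rewrite /f choice.pickleK.
  exact: H.
move=> e eF; have := H _ (ltF _ eF); rewrite /J /f choice.pickleK/=; apply.
exact: map_f.
Qed.

End existence.

Lemma percolation_subproof (R : realType) (d : nat) (p : R) :
  exists P : probability (config d) R, 0 <= p <= 1 -> bernoulli_law p P.
Proof.
have [p01|p01] := boolP (0 <= p <= 1); last by exists (dirac point).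
by have [P HP] := bernoulli_law_exists p01 d; exists P.
Qed.

(* The law of percolation with parameter p; unspecified for p outside [0, 1]. *)
Definition percolation (R : realType) (d : nat) (p : R) :
    probability (config d) R :=
  projT1 (cid (percolation_subproof d p)).

Lemma percolationP (R : realType) (d : nat) (p : R) :
  0 <= p <= 1 -> bernoulli_law p (percolation d p).
Proof. exact: (projT2 (cid (percolation_subproof d p))). Qed.

Definition open_adj (d : nat) (w : config d) : rel (vertex d) :=
  fun x y => `[< exists e : edge d, val e = [fset x; y]%fset /\ w e = true >].

(* [s] lists the vertices after the starting point, so the path has [size s]
   edges. *)
Definition open_path (d : nat) (w : config d) (x y : vertex d)
    (s : seq (vertex d)) : Prop :=
  path (open_adj w) x s /\ last x s = y.

Definition cluster (d : nat) (w : config d) (x : vertex d) : set (vertex d) :=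
  [set y | exists s, open_path w x y s].

Definition connected_to (d : nat) (x : vertex d) (A : set (vertex d)) :
    set (config d) :=
  [set w | exists2 y, A y & cluster w x y].

Definition critical_prob (R : realType) (d : nat) : R :=
  inf [set p : R | 0 <= p <= 1 /\
    (0 < percolation d p [set w | infinite_set (cluster w 0%R)])%E].

Definition high_dimensional (R : realType) (d : nat) : Prop :=
  (6 < d)%N /\
  exists c C : R, [/\ 0 < c, 0 < C &
    forall x y : vertex d, x <> y ->
      let P := percolation d (critical_prob R d) in
      let r := (normoo (x - y))%:R ^ (2%:Z - d%:Z) : R in
      ((c * r)%:E <= P [set w | cluster w x y] <= (C * r)%:E)%E].

Definition box (d n : nat) : set (vertex d) := [set x | (normoo x <= n)%N].

Definition boundary (d : nat) (A : set (vertex d)) : set (vertex d) :=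
  [set x | A x /\ exists y, ~ A y /\ norm1 (x - y) = 1%N].

Definition chemical_distance (R : realType) (d n : nat) (w : config d) :
    \bar R :=
  ereal_inf [set ((size s)%:R)%:E | s in
    [set s | exists2 y, boundary (@box d n) y & open_path w 0 y s]].

Definition cond_prob (R : realType) (d : nat) (P : probability (config d) R)
    (A B : set (config d)) : R :=
  fine (P (A `&` B)) / fine (P B).

(* Main.v *)
(* By the volume bound P(|C(0)| >= m) = O(m^{-1/2}), the argument of Kozma and
   Nachmias gives that an intrinsic sphere of radius r is nonempty with
   probability O(1/r), uniformly over subgraphs.  The susceptibility restricted
   to B(n) is O(n^2), so among any O(n^2) consecutive intrinsic spheres of the
   cluster of 0 inside B(n) one has mean size at most 1/2; restarting from it
   halves the survival probability.  Hence the intrinsic sphere of radius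
   lambda n^2 is nonempty with probability O(exp(-c lambda) n^{-2}), and
   P(0 <-> dB(n)) is at least of order n^{-2} by a second moment estimate.

   The volume bound is obtained below p_c, uniformly, from Aizenman and Barsky's
   ghost vertices: with magnetization M and susceptibility X, a tripod of three
   distant points yields M X = O(1) as soon as the open triangle diagram is
   small, which integrates to M(h) = O(sqrt h).

   All estimates take place in finite boxes, under finite product measures. *)
Require Import Defs.
From mathcomp Require Import all_boot all_order all_algebra finmap.
From mathcomp Require Import ring lra zify.

Set Implicit Arguments.
Unset Strict Implicit.
Unset Printing Implicit Defensive.

Import Order.TTheory GRing.Theory Num.Theory.

Local Open Scope ring_scope.

(** * Finite product measures *)

Section ProductMeasure.
Variables (R : realFieldType) (I : finType).
Implicit Types (p q : I -> R) (w X Y S : {set I}) (f g : {set I} -> R).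
Implicit Types (A B D : pred {set I}).

(** The bound on [M] is integrated down to [h = 0], where the tail of the cluster volume must
    vanish: below [p_c] this holds by definition of [p_c], at [p_c] it is not known in advance. The
    constants see [p] only through a lower bound, and in a fixed box probabilities are polynomials
    in [p], so the estimate passes to [p_c]. For [d > 6] the triangle diagram is finite but need not
    be small. It is opened by a straight bridge of [2L] edges whose ends carry the marked arms: the
    diagrams decay with [L], at the price of a factor [p0 ^ (2L)] with [p0 = p_c / 2]. Two marked
    arms give [M^2 X] on one side, against a single [M] for the event that the root becomes marked;
    hence [M X = O(1)]. To be absorbed, the error terms must themselves be multiples of [X]. The
    tree-graph bound therefore has to remember that the root is unmarked, which is why the van den
    Berg-Kesten inequality carries a decreasing event. A box is not translation invariant;
    magnetizations at different vertices are compared through volume tails, which depend on a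
    bounded neighbourhood only. *)

Definition wt p w : R := \prod_i (if i \in w then p i else 1 - p i).

Definition Ex p f : R := \sum_w wt p w * f w.

Definition Pr p A : R := Ex p (fun w => (A w)%:R).

Definition increasing A := forall X Y, X \subset Y -> A X -> A Y.

Definition decreasing D := forall X Y, X \subset Y -> D Y -> D X.

(** Disjoint occurrence in the form suited to increasing events: each witness set satisfies its
    event when taken as a configuration by itself. *)
Definition disj_occ A B : pred {set I} := fun w =>
  [exists X : {set I}, exists Y : {set I},
    [&& X \subset w, Y \subset w, [disjoint X & Y], A X & B Y]].

Lemma disj_occP A B w :
  reflect (exists X Y, [/\ X \subset w, Y \subset w, [disjoint X & Y], A X & B Y])
    (disj_occ A B w).
Proof.
apply: (iffP existsP) => [[X /existsP[Y /and5P[? ? ? ? ?]]]|[X [Y [? ? ? ? ?]]]].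
  by exists X, Y.
by exists X; apply/existsP; exists Y; apply/and5P.
Qed.

Lemma disj_occ_incr A B : increasing (disj_occ A B).
Proof.
move=> w w' ww' /disj_occP[X [Y [Xw Yw ? ? ?]]]; apply/disj_occP; exists X, Y.
by split=> //; exact: subset_trans ww'.
Qed.

Lemma eq_Ex p f g : f =1 g -> Ex p f = Ex p g.
Proof. by move=> fg; apply: eq_bigr => w _; rewrite fg. Qed.

Lemma ExD p f g : Ex p (fun w => f w + g w) = Ex p f + Ex p g.
Proof. by rewrite -big_split; apply: eq_bigr => w _; rewrite mulrDr. Qed.

Lemma ExZ p a f : Ex p (fun w => a * f w) = a * Ex p f.
Proof. by rewrite /Ex big_distrr; apply: eq_bigr => w _; rewrite mulrCA. Qed.

Lemma ExZr p a f : Ex p (fun w => f w * a) = Ex p f * a.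
Proof. by rewrite mulrC -ExZ; apply: eq_Ex => w; rewrite mulrC. Qed.

Lemma Ex_sum p (J : Type) (r : seq J) (P : pred J) (F : J -> {set I} -> R) :
  Ex p (fun w => \sum_(j <- r | P j) F j w) = \sum_(j <- r | P j) Ex p (F j).
Proof.
by rewrite exchange_big; apply: eq_bigr => w _; rewrite big_distrr.
Qed.

Lemma wt_sum1 p : \sum_w wt p w = 1.
Proof.
transitivity (\prod_i (p i + (1 - p i))); first by rewrite bigA_distr.
by rewrite big1 // => i _; rewrite addrCA subrr addr0.
Qed.

Lemma Ex_cst p a : Ex p (fun=> a) = a.
Proof. by rewrite /Ex -big_distrl /= wt_sum1 mul1r. Qed.

Let co p i w : R := \prod_(j | j != i) (if j \in w then p j else 1 - p j).

Let wtE p i w : wt p w = (if i \in w then p i else 1 - p i) * co p i w.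
Proof. by rewrite /wt (bigD1 i). Qed.

Let eq_co p i w w' : w :\ i = w' :\ i -> co p i w = co p i w'.
Proof.
move=> ww'; apply: eq_bigr => j ji; have := congr1 (fun X => j \in X) ww'.
by rewrite /= !inE ji /= => ->.
Qed.

Let Ex_split p (i : I) f : Ex p f =
  \sum_(w : {set I} | i \notin w) co p i w * (p i * f (i |: w) + (1 - p i) * f w).
Proof.
rewrite /Ex (bigID (fun w : {set I} => i \notin w)) /= addrC.
rewrite (reindex_onto (fun w : {set I} => i |: w) (fun w : {set I} => w :\ i)) /=; last first.
  by move=> w; rewrite negbK => iw; rewrite setD1K.
rewrite (eq_bigl (fun w : {set I} => i \notin w)); last first.
  move=> w; rewrite negbK setU11 /=.
  apply/eqP/idP => [<-|iw]; first by rewrite !inE eqxx.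
  by rewrite setU1K.
rewrite -big_split; apply: eq_bigr => w iw /=.
rewrite !(wtE p i) setU11 (negbTE iw) (@eq_co p i (i |: w) w) ?mulrDr.
  by ring.
by rewrite setU1K //; apply/setP => j; rewrite !inE; case: eqP => // ->; rewrite (negbTE iw).
Qed.

Lemma Ex_resample1 p i f :
  Ex p f = Ex p (fun w => p i * f (i |: w) + (1 - p i) * f (w :\ i)).
Proof.
rewrite !(Ex_split p i); apply: eq_bigr => w iw; congr (_ * _).
have -> : i |: (i |: w) = i |: w by rewrite setUA setUid.
have wi : w :\ i = w.
  by apply/setP => j; rewrite !inE; case: eqP => // ->; rewrite (negbTE iw).
by rewrite setU1K // wi; ring.
Qed.

Definition mix S w w' : {set I} := (w :\: S) :|: (w' :&: S).

Lemma Ex_mix p S f : Ex p f = Ex p (fun w => Ex p (fun w' => f (mix S w w'))).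
Proof.
have [n] := ubnP #|S|; elim: n S => // n IH S.
have [->|[i iS]] := set_0Vmem S.
  move=> _; apply: eq_Ex => w; rewrite -[LHS](Ex_cst p); apply: eq_Ex => w'.
  by rewrite /mix setD0 setI0 setU0.
rewrite (cardsD1 i) iS ltnS => /IH ->.
rewrite (Ex_resample1 p i); apply: eq_Ex => w.
rewrite -!ExZ -ExD [RHS](Ex_resample1 p i); apply: eq_Ex => w'.
have -> : mix (S :\ i) (i |: w) w' = mix S w (i |: w').
  apply/setP => j; rewrite !inE; case: (eqVneq j i) => [->|_]; rewrite ?iS //=.
have -> : mix (S :\ i) (w :\ i) w' = mix S w (w' :\ i).
  by apply/setP => j; rewrite !inE; case: (eqVneq j i) => [->|_]; rewrite ?iS /= ?andbF.
by [].
Qed.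

(** Dependence on a set of coordinates is expressed as invariance under intersecting with [S], or
    removing [S]. The explorations below are put in this form. *)
Lemma Ex_indep p S f g :
  (forall w, f (w :&: S) = f w) -> (forall w, g (w :\: S) = g w) ->
  Ex p (fun w => f w * g w) = Ex p f * Ex p g.
Proof.
move=> fS gS; rewrite (Ex_mix p (~: S)) -ExZr; apply: eq_Ex => w.
rewrite -ExZ; apply: eq_Ex => w'; rewrite -fS -gS -(fS w) -(gS w').
congr (f _ * g _); apply/setP => j; rewrite !inE;
  by case: (j \in S); rewrite /= ?andbT ?andbF ?orbF ?orbT.
Qed.

Section Positive.
Variable p : I -> R.
Hypothesis p01 : forall i, 0 <= p i <= 1.

Let p0 i : 0 <= p i. Proof. by case/andP: (p01 i). Qed.
Let p1 i : 0 <= 1 - p i. Proof. by rewrite subr_ge0; case/andP: (p01 i). Qed.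

Lemma wt_ge0 w : 0 <= wt p w.
Proof. by apply: prodr_ge0 => i _; case: ifP. Qed.

Lemma le_Ex f g : (forall w, f w <= g w) -> Ex p f <= Ex p g.
Proof. by move=> fg; apply: ler_sum => w _; rewrite ler_wpM2l ?wt_ge0. Qed.

Lemma Ex_ge0 f : (forall w, 0 <= f w) -> 0 <= Ex p f.
Proof. by move=> f0; apply: sumr_ge0 => w _; rewrite mulr_ge0 ?wt_ge0. Qed.

Lemma Pr_ge0 A : 0 <= Pr p A.
Proof. by apply: Ex_ge0 => w. Qed.

Lemma le_Pr A B : (forall w, A w -> B w) -> Pr p A <= Pr p B.
Proof.
move=> AB; apply: le_Ex => w; rewrite ler_nat.
by case Aw: (A w); rewrite // AB.
Qed.

Lemma Pr_le1 A : Pr p A <= 1.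
Proof. by rewrite -[leRHS](Ex_cst p); apply: le_Ex => w; case: (A w). Qed.

Lemma Pr_union (J : finType) (P : pred J) (A : J -> pred {set I}) B :
  (forall w, B w -> exists2 j, P j & A j w) ->
  Pr p B <= \sum_(j | P j) Pr p (A j).
Proof.
move=> BA; rewrite -Ex_sum; apply: le_Ex => w.
case Bw: (B w); last by apply: sumr_ge0.
have [j Pj Aj] := BA _ Bw.
by rewrite (bigD1 j) //= Aj lerDl sumr_ge0.
Qed.

Lemma Ex_CauchySchwarz f g :
  Ex p (fun w => f w * g w) ^+ 2 <=
  Ex p (fun w => f w ^+ 2) * Ex p (fun w => g w ^+ 2).
Proof.
set a := Ex p (fun w => f w ^+ 2); set b := Ex p _; set c := Ex p _.
have a0 : 0 <= a by apply: Ex_ge0 => w; exact: sqr_ge0.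
have H t : 0 <= a * t ^+ 2 + 2 * t * b + c.
  rewrite /a /b /c -!ExZ -ExZr -!ExD; apply: Ex_ge0 => w.
  by rewrite (_ : _ + _ = (t * f w + g w) ^+ 2) ?sqr_ge0 //; ring.
have [a00|an0] := eqVneq a 0.
  rewrite a00 mul0r; have [->|b0] := eqVneq b 0; first by rewrite expr0n.
  (* For [a = 0] the quadratic degenerates to [2 t b + c]; this [t] gives it the value -1. *)
  have := H (- (c + 1) / (2 * b)); rewrite a00 mul0r add0r.
  have -> : 2 * (- (c + 1) / (2 * b)) * b = - (c + 1) by field.
  by lra.
have := H (- b / a).
have -> : a * (- b / a) ^+ 2 + 2 * (- b / a) * b + c = c - b ^+ 2 / a by field.
rewrite subr_ge0 ler_pdivrMr; last by rewrite lt_def an0 a0.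
by rewrite mulrC.
Qed.

(** Finite energy: forcing the edges of [Y] open costs at most one factor [p0'] per edge. *)
Lemma Ex_open (p0' : R) Y f : 0 <= p0' -> (forall i, i \in Y -> p0' <= p i) ->
  (forall w, 0 <= f w) ->
  p0' ^+ #|Y| * Ex p (fun w => f (w :|: Y)) <= Ex p f.
Proof.
move=> p0'0; have [n] := ubnP #|Y|; elim: n Y f => // n IH Y f.
have [->|[i iY]] := set_0Vmem Y.
  by move=> _ _ _; rewrite cards0 mul1r; apply: le_Ex => w; rewrite setU0.
rewrite (cardsD1 i) iY ltnS => /IH {}IH pY f0.
rewrite add1n exprS -mulrA.
apply: le_trans (_ : Ex p (fun w => p0' * f (i |: w)) <= _); last first.
  rewrite [leRHS](Ex_resample1 p i); apply: le_Ex => w.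
  by rewrite -[leLHS]addr0 lerD ?mulr_ge0 // ler_wpM2r // pY.
rewrite ExZ ler_wpM2l //.
apply: le_trans (IH (fun w => f (i |: w)) _ _).
- apply: ler_wpM2l; first exact: exprn_ge0.
  apply: le_Ex => w; rewrite (_ : w :|: Y = i |: (w :|: Y :\ i)) //.
  by rewrite setUCA setD1K.
- by move=> j; rewrite inE => /andP[_ /pY].
- by move=> w.
Qed.

(* Van den Berg-Kesten, with a decreasing event carried along: the coordinates
   seen by [B] are replaced by independent copies, one at a time. *)
Let dbl A B D S w w' := D w &&
  [exists X : {set I}, exists Y : {set I},
    [&& X \subset w, Y \subset mix S w w', X :&: Y \subset S, A X & B Y]].

Let dblP A B D S w w' :
  reflect (D w /\ exists X Y, [/\ X \subset w, Y \subset mix S w w',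
      X :&: Y \subset S, A X & B Y])
    (dbl A B D S w w').
Proof.
apply: (iffP andP) => -[Dw].
  move=> /existsP[X /existsP[Y /and5P[? ? ? ? ?]]].
  by split=> //; exists X, Y.
move=> [X [Y [? ? ? ? ?]]]; split=> //.
by apply/existsP; exists X; apply/existsP; exists Y; apply/and5P.
Qed.

Let dbl_step A B D S i : decreasing D -> i \notin S ->
  Ex p (fun w => Ex p (fun w' => (dbl A B D S w w')%:R)) <=
  Ex p (fun w => Ex p (fun w' => (dbl A B D (i |: S) w w')%:R)).
Proof.
move=> dD iS.
rewrite (Ex_resample1 p i) [leRHS](Ex_resample1 p i); apply: le_Ex => w.
rewrite -!ExZ -!ExD [leRHS](Ex_resample1 p i); apply: le_Ex => w'.
set a1 := dbl _ _ _ S _ _; set a0 := dbl _ _ _ S _ _.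
set g11 := dbl _ _ _ _ (i |: w) (i |: w').
set g01 := dbl _ _ _ _ (w :\ i) (i |: w').
set g10 := dbl _ _ _ _ (i |: w) (w' :\ i).
set g00 := dbl _ _ _ _ (w :\ i) (w' :\ i).
have mono X Y x : X \subset Y -> x \in X -> x \in Y by move=> /subsetP/(_ x).
have key (v v' u u' : {set I}) X Y : D u ->
    X \subset v -> Y \subset mix S v v' -> X :&: Y \subset S -> A X -> B Y ->
    (forall x, x \in X -> x \in v -> x \in u) ->
    (forall x, x \in Y -> x \in mix S v v' -> x \in mix (i |: S) u u') ->
    dbl A B D (i |: S) u u'.
  move=> Du Xv Yv XY AX BY Xu Yu; apply/dblP; split=> //; exists X, Y.
  split=> //; [| |exact: subset_trans (subsetUr _ _)].
  - by apply/subsetP => x xX; apply: Xu; rewrite ?(mono _ _ _ Xv).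
  - by apply/subsetP => x xX; apply: Yu; rewrite ?(mono _ _ _ Yv).
have wiw : w :\ i \subset i |: w.
  by apply/subsetP => x; rewrite !inE => /andP[_ ->]; rewrite orbT.
have h0 : a0 -> g00 && g01.
  move=> /dblP[Dw [X [Y [? ? ? ? ?]]]].
  by apply/andP; split; apply: (key (w :\ i) w' _ _ X Y) => // x _;
    rewrite !inE; case: (eqVneq x i) => [->|_]; rewrite ?(negbTE iS) //= ?andbT ?andbF ?orbF ?orbT.
have h01 : a0 -> a1 -> g11 && g10.
  move=> /dblP[_ [X [Y [? ? ? ? ?]]]] /dblP[Dw _].
  by apply/andP; split; apply: (key (w :\ i) w' _ _ X Y) => // x _;
    rewrite !inE; case: (eqVneq x i) => [->|_]; rewrite ?(negbTE iS) //= ?andbT ?andbF ?orbF ?orbT.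
(* Since [i] is outside [S], at most one witness uses it. If [X] does, its copy in [w'] may be
   closed; if not, [Y] can take [i] from [w'] while [i] is closed in [w], which [D] tolerates
   because it is decreasing. *)
have h1 : a1 -> g11 && (g10 || g01).
  move=> /dblP[Dw [X [Y [Xw Yw XY AX BY]]]].
  have Dw' : D (w :\ i) by exact: dD Dw.
  apply/andP; split.
    apply: (key (i |: w) w' _ _ X Y) => // x _;
    by rewrite !inE; case: (eqVneq x i) => [->|_]; rewrite ?(negbTE iS) //= ?andbT ?andbF ?orbF ?orbT.
  have [iX|iX] := boolP (i \in X).
    have iY : i \notin Y.
      apply: contra iS => iY; apply: mono XY _; by rewrite inE iX iY.
    apply/orP; left; apply: (key (i |: w) w' _ _ X Y) => // x xY.
    rewrite !inE; case: (eqVneq x i) xY => [->|_] //.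
    by rewrite (negbTE iY).
  apply/orP; right; apply: (key (i |: w) w' _ _ X Y) => // x xX;
    rewrite !inE; case: (eqVneq x i) xX => [->|_] //.
    by rewrite (negbTE iX).
have := p0 i; have := p1 i; move: (p i) => t t1 t0.
have t2 : 0 <= t * (1 - t) by exact: mulr_ge0.
have t3 : 0 <= t * t by exact: mulr_ge0.
have t4 : 0 <= (1 - t) * (1 - t) by exact: mulr_ge0.
move: h0 h01 h1.
by case: a0; case: a1; case: g11; case: g10; case: g01; case: g00 => //=
  h0 h01 h1; do ?[by move: (h0 isT)]; do ?[by move: (h1 isT)];
  do ?[by move: (h01 isT isT)]; rewrite /= ?mulr1 ?mulr0 ?mul0r ?addr0 ?add0r; nra.
Qed.

(** [D] is only ever tested on [w], never on the copy [w'], so it stays with the factor of [A]. For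
    [S] empty, [dbl] contains the disjoint occurrence; for [S] full, the two witnesses live on
    independent configurations. *)
Lemma vanDenBergKesten A B D : increasing A -> increasing B -> decreasing D ->
  Pr p (fun w => disj_occ A B w && D w) <= Pr p (fun w => A w && D w) * Pr p B.
Proof.
move=> iA iB dD.
have H S : Ex p (fun w => Ex p (fun w' => (dbl A B D set0 w w')%:R)) <=
    Ex p (fun w => Ex p (fun w' => (dbl A B D S w w')%:R)).
  have [n] := ubnP #|S|; elim: n S => // n IH S.
  have [->|[i iS]] := set_0Vmem S; first by [].
  rewrite (cardsD1 i) iS ltnS => /IH /le_trans; apply.
  by rewrite -{2}(setD1K iS); apply: dbl_step => //; rewrite !inE eqxx.
apply: le_trans (le_trans (H setT) _).
  apply: le_Ex => w; rewrite -[leLHS](Ex_cst p); apply: le_Ex => w'.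
  rewrite ler_nat; case: andP => // -[/disj_occP[X [Y [Xw Yw XY AX BY]]] Dw].
  rewrite lt0n eqb0 negbK; apply/dblP; split=> //; exists X, Y; split=> //.
    by rewrite /mix setD0 setI0 setU0.
  by rewrite -(setI_eq0 X Y) in XY; rewrite (eqP XY) sub0set.
rewrite -ExZr; apply: le_Ex => w; rewrite -ExZ; apply: le_Ex => w'.
rewrite -natrM ler_nat mulnb; case: dblP => //.
move=> [-> [X [Y [Xw Yw _ /(iA _ _ Xw) -> /iB BY]]]].
rewrite BY //; apply: subset_trans Yw _.
by rewrite /mix setDT set0U setIT.
Qed.

Lemma vanDenBergKesten3 A B C D :
  increasing A -> increasing B -> increasing C -> decreasing D ->
  Pr p (fun w => disj_occ A (disj_occ B C) w && D w) <=
  Pr p (fun w => A w && D w) * (Pr p B * Pr p C).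
Proof.
move=> iA iB iC dD; apply: le_trans (vanDenBergKesten _ _ _) _ => //.
  exact: disj_occ_incr.
apply: ler_wpM2l; first exact: Pr_ge0.
have := @vanDenBergKesten B C xpredT iB iC (fun _ _ _ _ => isT).
rewrite /Pr (eq_Ex _ (g := fun w => (disj_occ B C w)%:R)); last first.
  by move=> w; rewrite andbT.
rewrite (eq_Ex _ (f := fun w => (B w && _)%:R) (g := fun w => (B w)%:R)) //.
by move=> w; rewrite andbT.
Qed.

End Positive.

Lemma Pr_le_param p q A : (forall i, 0 <= p i) -> (forall i, q i <= 1) ->
  (forall i, p i <= q i) -> increasing A -> Pr p A <= Pr q A.
Proof.
move=> p0 q1 pq iA.
pose r S i := if i \in S then q i else p i.
have r01 S i : 0 <= r S i <= 1.
  by rewrite /r; case: ifP => _; rewrite ?q1 ?p0 /= ?(le_trans (p0 i)) ?(le_trans _ (q1 i)).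
have H S : Pr (r set0) A <= Pr (r S) A.
  have [n] := ubnP #|S|; elim: n S => // n IH S.
  have [->|[i iS]] := set_0Vmem S; first by [].
  rewrite (cardsD1 i) iS ltnS => /IH /le_trans; apply.
  rewrite /Pr !(Ex_split _ i); apply: ler_sum => w iw.
  have -> : co (r (S :\ i)) i w = co (r S) i w.
    by apply: eq_bigr => j ji; rewrite /r !inE ji.
  apply: ler_wpM2l.
    by apply: prodr_ge0 => j _; have /andP[r0 r1] := r01 S j; case: ifP; rewrite ?subr_ge0.
  rewrite /r !inE eqxx iS /=.
  have : (A w)%:R <= (A (i |: w))%:R :> R.
    by rewrite ler_nat; case Aw: (A w); rewrite ?(iA _ _ (subsetUr _ _) Aw).
  by have := pq i; nra.
have := H setT; congr (_ <= _); apply: eq_bigr => w _; congr (_ * _);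
  by apply: eq_bigr => i _; rewrite /r inE.
Qed.

(** An open edge gains at most a factor [t], and a closed edge gains nothing since [1 - q <= 1 - p].
    In a fixed box this carries a bound from just below [p_c] to [p_c]. *)
Lemma Pr_ge_param p q A (t : R) : (forall i, 0 <= p i) -> (forall i, q i <= 1) ->
  (forall i, p i <= q i) -> 1 <= t -> (forall i, q i <= t * p i) ->
  Pr q A <= t ^+ #|I| * Pr p A.
Proof.
move=> p0 q1 pq t1 qtp; rewrite /Pr -ExZ; apply: ler_sum => w _.
rewrite mulrCA mulrA ler_wpM2r // mulrC.
have -> : t ^+ #|I| = \prod_(i : I) t by rewrite prodr_const.
rewrite -big_split; apply: ler_prod => i _ /=.
have := p0 i; have := q1 i; have := pq i; have := qtp i; case: ifP => _; first nra.
by move=> ? ? ? ?; rewrite subr_ge0; apply/andP; split=> //; nra.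
Qed.

End ProductMeasure.

Section Marginal.
Variables (R : realFieldType) (I J : finType) (psi : I -> J) (q : J -> R).
Hypothesis psi_inj : injective psi.

Let wt_marginal (w : {set I}) :
  \sum_(w' : {set J} | psi @^-1: w' == w) wt q w' = wt (q \o psi) w.
Proof.
(* [F] and [G] vanish on the values of [psi i] that contradict [w], so the restricted sum becomes a
   product over coordinates. *)
pose F j := if j \in psi @: ~: w then 0 else q j.
pose G j := if j \in psi @: w then 0 else 1 - q j.
have memI (v : {set I}) i : (psi i \in psi @: v) = (i \in v).
  apply/imsetP/idP => [[i' iv /psi_inj ->] //|iv]; by exists i.
transitivity (\sum_(w' : {set J}) \prod_j (if j \in w' then F j else G j)).
  rewrite big_mkcond; apply: eq_bigr => w' _; case: eqP => [ww'|/eqP ww'].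
    apply: eq_bigr => j _; rewrite /F /G; case: ifP => jw'; case: imsetP => //.
      by move=> [i]; rewrite -ww' !inE => /negP + ji; rewrite -ji jw'.
    by move=> [i]; rewrite -ww' !inE => + ji; rewrite -ji jw'.
  have [i iww'] : exists i, (i \in psi @^-1: w') != (i \in w).
    apply/existsP; rewrite -negb_forall; apply: contra ww' => /forallP H.
    by apply/eqP/setP => i; apply/eqP.
  rewrite (bigD1 (psi i)) //= [X in X * _](_ : _ = 0) ?mul0r //.
  move: iww'; rewrite /F /G !memI !inE.
  by case: ifP => _; case: (i \in w).
rewrite -bigA_distr (bigID (fun j => j \in psi @: setT)) /=.
rewrite [X in _ * X]big1 ?mulr1; last first.
  move=> j jT; have -> : F j + G j = q j + (1 - q j); last by rewrite addrCA subrr addr0.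
  by rewrite /F /G !ifF //; apply: contraNF jT => /imsetP[i _ ->]; rewrite imset_f.
rewrite big_imset /=; last by move=> ? ? _ _ /psi_inj.
rewrite /wt; apply: eq_big => i; rewrite ?inE // => _.
by rewrite /F /G !memI !inE; case: (i \in w); rewrite /= ?addr0 ?add0r.
Qed.

Lemma Ex_marginal (f : {set I} -> R) :
  Ex q (fun w' => f (psi @^-1: w')) = Ex (q \o psi) f.
Proof.
rewrite /Ex (partition_big (fun w' : {set J} => psi @^-1: w') xpredT) //=.
apply: eq_bigr => w _; rewrite -wt_marginal big_distrl.
by apply: eq_bigr => w' /= /eqP <-.
Qed.

End Marginal.

(** * Graph distance in finite random graphs *)

Section Graph.
Variables (V I : finType) (inc : I -> V -> V -> bool).
Implicit Types (w X Y H : {set I}) (x y z u v b c k : V) (K S P U : {set V}).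

Hypothesis inc_sym : forall i x y, inc i x y = inc i y x.
Hypothesis inc_uniq : forall i x y x' y', inc i x y -> inc i x' y' ->
  (x' = x /\ y' = y) \/ (x' = y /\ y' = x).

Definition adj w : rel V := fun x y => [exists i, (i \in w) && inc i x y].

Definition conn w x y := connect (adj w) x y.

Definition cl w x := [set y | conn w x y].

Definition touch U := [set i | [exists x, exists y, (x \in U) && inc i x y]].

(** The vertices at graph distance strictly less than [r], so the ball of radius 0 is empty and
    [level w x r] is the sphere at distance exactly [r]. *)
Fixpoint sball w x r := if r is r'.+1 then
  x |: (sball w x r' :|: [set y | [exists z, (z \in sball w x r') && adj w z y]])
  else set0.

Definition level w x r := sball w x r.+1 :\: sball w x r.

Definition alive w x r := level w x r != set0.

Lemma adjP w x y : reflect (exists2 i, i \in w & inc i x y) (adj w x y).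
Proof.
by apply: (iffP existsP) => [[i /andP[? ?]]|[i ? ?]]; exists i => //; apply/andP.
Qed.

Lemma touchP U i : reflect (exists x y, x \in U /\ inc i x y) (i \in touch U).
Proof.
rewrite inE; apply: (iffP existsP) => [[x /existsP[y /andP[? ?]]]|[x [y [? ?]]]].
  by exists x, y.
by exists x; apply/existsP; exists y; apply/andP.
Qed.

Lemma touchU S U : touch (S :|: U) = touch S :|: touch U.
Proof.
apply/setP => i; rewrite [RHS]inE; apply/touchP/orP => [[x [y [+ ixy]]]|].
  by rewrite inE => /orP[xS|xU]; [left|right]; apply/touchP; exists x, y.
by move=> [] /touchP[x [y [xS ixy]]]; exists x, y; rewrite inE xS ?orbT.
Qed.

Lemma adj_mono w w' x y : w \subset w' -> adj w x y -> adj w' x y.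
Proof. by move=> /subsetP ww' /adjP[i /ww' ? ?]; apply/adjP; exists i. Qed.

Lemma conn_mono w w' x y : w \subset w' -> conn w x y -> conn w' x y.
Proof. by move=> ww'; apply: connect_sub => a b /(adj_mono ww') /connect1. Qed.

Lemma conn0 w x : conn w x x. Proof. exact: connect0. Qed.

Lemma conn_trans w x y z : conn w x y -> conn w y z -> conn w x z.
Proof. exact: connect_trans. Qed.

Lemma conn_adj w x y z : conn w x y -> adj w y z -> conn w x z.
Proof. by move=> xy yz; apply: connect_trans xy _; exact: connect1. Qed.

Lemma conn_incr x y : increasing (fun w => conn w x y).
Proof. by move=> w w'; exact: conn_mono. Qed.

Lemma conn_ind w x (Q : V -> Prop) : Q x ->
  (forall y z, conn w x y -> Q y -> adj w y z -> Q z) ->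
  forall y, conn w x y -> Q y.
Proof.
move=> Qx Qs y /connectP[s]; elim/last_ind: s y => [|s t IH] y /=.
  by move=> _ ->.
rewrite rcons_path last_rcons => /andP[sp st] ->.
by apply: (Qs (last x s)) => //; [apply/connectP; exists s|exact: IH].
Qed.

Lemma conn_setD w Y b c :
  (forall z i y, conn w b z -> i \in Y -> ~~ inc i z y) ->
  conn w b c -> conn (w :\: Y) b c.
Proof.
move=> bY; move: c; apply: conn_ind => [|y z by_ bY' /adjP[i iw iyz]].
  exact: conn0.
apply: conn_adj bY' _; apply/adjP; exists i => //; rewrite inE iw andbT.
by apply: contraL iyz; exact: bY.
Qed.

Lemma adj_off w K x y : adj w x y -> x \notin K -> y \notin K ->
  adj (w :\: touch K) x y.
Proof.
move=> /adjP[i iw ixy] xK yK; apply/adjP; exists i => //.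
rewrite in_setD iw andbT; apply/touchP => -[x' [y' [x'K ix']]].
by case: (inc_uniq ixy ix') => -[xE _]; move: x'K; apply/negP; rewrite xE.
Qed.

Lemma conn_off w K b c : (forall z, conn w b z -> z \notin K) ->
  conn w b c -> conn (w :\: touch K) b c.
Proof.
move=> bK; move: c; apply: conn_ind => [|y z by_ bY' yz]; first exact: conn0.
apply: conn_adj bY' _; apply: adj_off => //; apply: bK => //.
exact: conn_adj yz.
Qed.

Lemma adj_sym w x y : adj w x y = adj w y x.
Proof. by apply: eq_existsb => i; rewrite inc_sym. Qed.

Lemma conn_sym w x y : conn w x y = conn w y x.
Proof. by apply: sym_connect_sym => a b; rewrite adj_sym. Qed.

Lemma sball_adj w x r y z : y \in sball w x r -> adj w y z ->
  z \in sball w x r.+1.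
Proof.
move=> yr yz; rewrite /= !inE; apply/orP; right; apply/orP; right.
by apply/existsP; exists y; rewrite yr.
Qed.

Lemma sballSP w x r y : y \in sball w x r.+1 ->
  y = x \/ exists2 z, z \in sball w x r & adj w z y \/ y = z.
Proof.
rewrite /= !inE => /or3P[/eqP|yr|/existsP[z /andP[zr zy]]]; first by left.
  by right; exists y => //; right.
by right; exists z => //; left.
Qed.

Lemma sball_mem w x r : x \in sball w x r.+1.
Proof. by rewrite /= !inE eqxx. Qed.

Lemma sball_sub w x r s : (r <= s)%N -> sball w x r \subset sball w x s.
Proof.
move=> /subnK <-; elim: (s - r)%N => // n IH; apply: subset_trans IH _.
by rewrite addSn /=; apply/subsetP => y yr; rewrite !inE yr orbT.
Qed.

Lemma sball_conn w x r y : y \in sball w x r -> conn w x y.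
Proof.
elim: r y => [|r IH] y; first by rewrite inE.
move=> /sballSP[->|[z zr [zy|->]]]; first exact: conn0; last exact: IH.
exact: conn_adj (IH _ zr) zy.
Qed.

Lemma sball_path w x r y : y \in sball w x r ->
  exists s, [/\ path (adj w) x s, last x s = y & (size s < r)%N].
Proof.
elim: r y => [|r IH] y; first by rewrite inE.
move=> /sballSP[->|[z zr H]]; first by exists [::].
have [s [ps ls ss]] := IH _ zr; case: H => [zy|->].
  exists (rcons s y); rewrite rcons_path last_rcons size_rcons ls.
  by split=> //; rewrite ps.
by exists s; split=> //; exact: leqW.
Qed.

Lemma path_sball w x s : path (adj w) x s ->
  last x s \in sball w x (size s).+1.
Proof.
elim/last_ind: s => [|s y IH]; first by move=> _; exact: sball_mem.
rewrite rcons_path last_rcons size_rcons => /andP[/IH yr ys].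
exact: sball_adj ys.
Qed.

Lemma conn_sball w x y : conn w x y -> exists r, y \in sball w x r.+1.
Proof. by move=> /connectP[s ps ->]; exists (size s); exact: path_sball. Qed.

Lemma sball_mono w w' x r : w \subset w' -> sball w x r \subset sball w' x r.
Proof.
move=> ww'; elim: r => // r IH; apply/subsetP => y /sballSP[->|[z zr H]].
  exact: sball_mem.
have zr' := subsetP IH _ zr.
case: H => [/(adj_mono ww') zy|->]; first exact: sball_adj zy.
exact: subsetP (sball_sub _ _ (leqnSn r)) _ zr'.
Qed.

Lemma sball_stable w x r s : sball w x r = sball w x r.+1 -> (r <= s)%N ->
  sball w x s = sball w x r.
Proof.
move=> rE /subnK <-; elim: (s - r)%N => // n IH.
by rewrite addSn [LHS]/= IH -/(sball w x r.+1) -rE.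
Qed.

Lemma sball_grow w x r : (r <= #|sball w x r|)%N \/ sball w x r = cl w x.
Proof.
elim: r => [|r [IH|IH]]; first by left.
  have [rE|rE] := eqVneq (sball w x r) (sball w x r.+1).
    right; rewrite -rE; apply/eqP; rewrite eqEsubset; apply/andP; split.
      by apply/subsetP => y /sball_conn; rewrite inE.
    apply/subsetP => y; rewrite inE => /conn_sball[s].
    have [rs|/ltnW sr] := leqP r s.+1; first by rewrite (sball_stable rE rs).
    exact: (subsetP (sball_sub _ _ sr)).
  left; apply: leq_ltn_trans IH _; apply: proper_card.
  by rewrite properEneq rE sball_sub.
right; apply/eqP; rewrite eqEsubset; apply/andP; split.
  by apply/subsetP => y /sball_conn; rewrite inE.
by rewrite -IH sball_sub.
Qed.

(** A ball that has not yet filled the cluster gains a vertex at each step. Hence the event that the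
    cluster has [m] vertices is visible in the ball of radius [m], which makes it comparable between
    boxes. *)
Lemma card_sball w x m : (m <= #|cl w x|)%N -> (m <= #|sball w x m|)%N.
Proof. by case: (sball_grow w x m) => [//|->]. Qed.

Lemma sball_full w x m : (#|cl w x| < m)%N -> sball w x m = cl w x.
Proof.
move=> clm; case: (sball_grow w x m) => // msb.
have : (#|sball w x m| <= #|cl w x|)%N.
  by apply: subset_leq_card; apply/subsetP => y /sball_conn; rewrite inE.
by rewrite leqNgt (leq_trans clm msb).
Qed.

Lemma sball_card_cl w x r : (#|sball w x r| <= #|cl w x|)%N.
Proof.
by apply: subset_leq_card; apply/subsetP => y /sball_conn; rewrite inE.
Qed.

Lemma alive_leq w x r s : (r <= s)%N -> alive w x s -> alive w x r.
Proof.
move=> rs; apply: contraNN; rewrite /alive /level => /eqP rE.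
have {}rE : sball w x r = sball w x r.+1.
  apply/eqP; rewrite eqEsubset sball_sub //=.
  by move/eqP: rE; rewrite setD_eq0.
by rewrite (sball_stable rE (leqW rs)) (sball_stable rE rs) setDv.
Qed.

(** The sphere at distance [r] is revealed by the edges touching vertices at distance less than [r];
    the remaining edges stay independent of it. *)
Lemma eq_sball w w' x r : w :&: touch (sball w x r) = w' :&: touch (sball w x r) ->
  forall i, (i <= r.+1)%N -> sball w x i = sball w' x i.
Proof.
move=> ww'; elim=> // i IH; rewrite ltnS => ir.
have iE := IH (leqW ir); rewrite [LHS]/= [RHS]/= -iE; congr (_ |: (_ :|: _)).
apply/setP => y; rewrite !inE; apply: eq_existsb => z.
case zi: (z \in sball w x i) => //=.
have zr := subsetP (sball_sub w x ir) _ zi.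
have E j : inc j z y -> (j \in w) = (j \in w').
  move=> jzy; have jt : j \in touch (sball w x r) by apply/touchP; exists z, y.
  by have := congr1 (fun X => j \in X) ww'; rewrite /= !in_setI jt !andbT.
by apply/adjP/adjP => -[j jw jzy]; exists j => //; move: jw; rewrite (E j).
Qed.

Lemma sball_trans w x y z r s : y \in sball w x r.+1 -> z \in sball w y s ->
  z \in sball w x (r + s).
Proof.
move=> yr; elim: s z => [|s IH] z; first by rewrite inE.
rewrite addnS => /sballSP[->|[z' /IH z's [zz'|->]]].
- exact: subsetP (sball_sub _ _ (leq_addr _ _)) _ yr.
- exact: sball_adj zz'.
- exact: subsetP (sball_sub _ _ (leqnSn _)) _ z's.
Qed.

(* A shortest path leaves a ball at its boundary level and avoids it from then
   on. *)
Lemma alive_markov w x r s : alive w x (r + s) ->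
  exists2 y, y \in level w x r & alive (w :\: touch (sball w x r)) y s.
Proof.
set w' := w :\: _.
have key t z : z \in sball w x (r + t).+1 -> z \notin sball w x r ->
    exists2 y, y \in level w x r & z \in sball w' y t.+1.
  elim: t z => [|t IH] z zr zn.
    by exists z; [rewrite inE zn; rewrite addn0 in zr|exact: sball_mem].
  rewrite addnS in zr; case/sballSP: (zr) => [zx|[z' z'r [zz'|zz']]].
  - have r0 : r = 0%N by move: zn; rewrite zx; case: (r) => // r'; rewrite sball_mem.
    by exists z; [rewrite /level zx r0 setD0 sball_mem|exact: sball_mem].
  - have [z'n|z'n] := boolP (z' \in sball w x r).
      exists z; last exact: sball_mem.
      by rewrite inE zn; exact: sball_adj zz'.
    have [y yl z'y] := IH _ z'r z'n; exists y => //; apply: sball_adj z'y _.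
    exact: adj_off.
  - rewrite zz' in zn *; have [y yl z'y] := IH _ z'r zn; exists y => //.
    exact: subsetP (sball_sub _ _ (leqnSn _)) _ z'y.
move=> /set0Pn[z]; rewrite inE => /andP[zn zr].
have [|y yl zy] := key _ _ zr.
  by apply: contra zn; apply: subsetP; apply: sball_sub; exact: leq_addr.
exists y => //; apply/set0Pn; exists z; rewrite inE zy andbT.
apply: contra zn => zs.
apply: (@sball_trans _ _ y).
  by move: yl; rewrite inE => /andP[].
by apply: subsetP zs; apply: sball_mono; exact: subsetDl.
Qed.

End Graph.

(** * Survival of intrinsic spheres *)

Section IntrinsicDistance.
Variables (R : realFieldType) (V I : finType) (inc : I -> V -> V -> bool).
Hypothesis inc_sym : forall i x y, inc i x y = inc i y x.
Hypothesis inc_uniq : forall i x y x' y', inc i x y -> inc i x' y' ->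
  (x' = x /\ y' = y) \/ (x' = y /\ y' = x).
Variable p : I -> R.
Hypothesis p01 : forall i, 0 <= p i <= 1.
Implicit Types (w H : {set I}) (x y : V) (U : {set V}).

(* The supremum over subgraphs replaces the missing monotonicity of [alive]. *)
Let survival r (g : R) :=
  forall H x, Pr p (fun w => alive inc (w :&: H) x r) <= g.

Lemma card_level_sum w x r :
  (\sum_(j < r) #|level inc w x j| = #|sball inc w x r|)%N.
Proof.
elim: r => [|r IH]; first by rewrite big_ord0 cards0.
rewrite big_ord_recr IH -[RHS](cardsID (sball inc w x r)).
by rewrite (setIidPr (sball_sub inc w x (leqnSn r))).
Qed.

(** The ball and its sphere are read off the edges touching the ball, in the form that [Ex_indep]
    requires. *)
Let sball_touch w x r H U : (sball inc (w :&: touch inc U :&: H) x r == U) =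
  (sball inc (w :&: H) x r == U) /\
  (sball inc (w :&: H) x r = U ->
   level inc (w :&: touch inc U :&: H) x r = level inc (w :&: H) x r).
Proof.
have swap (v : {set I}) : v :&: touch inc U :&: H = v :&: H :&: touch inc U.
  by rewrite -!setIA (setIC H).
have E v v' : v :&: touch inc U = v' :&: touch inc U -> sball inc v x r = U ->
    sball inc v' x r = U /\ level inc v' x r = level inc v x r.
  move=> vv' vU; have := @eq_sball _ _ inc v v' x r; rewrite vU => /(_ vv') vE.
  by split; rewrite /level -!vE.
have idem : w :&: H :&: touch inc U :&: touch inc U = w :&: H :&: touch inc U.
  by rewrite -setIA setIid.
split.
  by rewrite swap; apply/eqP/eqP => [/E-/(_ _ idem)[]|/E-/(_ _ (esym idem))[]].
by move=> /E-/(_ _ (esym idem))[_]; rewrite swap.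
Qed.

(** Condition on the explored ball and sphere [(U, L)]: some vertex of [L] must survive [s] more
    steps through unexplored edges, which are independent of [(U, L)]. [Q] allows a restriction on
    the sphere. *)
Lemma Pr_alive_markov (Q : pred {set V}) r s g H x : survival s g ->
  Pr p (fun w => Q (level inc (w :&: H) x r) && alive inc (w :&: H) x (r + s)) <=
  Ex p (fun w => (Q (level inc (w :&: H) x r))%:R *
                 #|level inc (w :&: H) x r|%:R) * g.
Proof.
move=> sg; pose st w := (sball inc (w :&: H) x r, level inc (w :&: H) x r).
pose F (j : {set V} * {set V}) w : R := (st w == j)%:R.
pose G (j : {set V} * {set V}) y w : R :=
  (alive inc ((w :\: touch inc j.1) :&: H) y s)%:R.
apply: le_trans (_ : Ex p (fun w => \sum_(j : {set V} * {set V}) \sum_(y in j.2)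
    (Q j.2)%:R * (F j w * G j y w)) <= _).
  apply: le_Ex => // w.
  rewrite (bigD1 (st w)) //= [leRHS]addrC -[leLHS]add0r lerD //.
    by apply: sumr_ge0 => j _; apply: sumr_ge0 => y _; rewrite !mulr_ge0.
  case Qw: (Q _); last by apply: sumr_ge0 => y _; rewrite !mulr_ge0.
  case aw: (alive _ _ _ _); last by apply: sumr_ge0 => y _; rewrite !mulr_ge0.
  have [y yl ya] := alive_markov inc_uniq aw.
  rewrite (bigD1 y) //= /F /G /= eqxx setIDAC ya /= !mul1r lerDl.
  by apply: sumr_ge0 => z _; rewrite !mulr_ge0.
rewrite Ex_sum.
apply: le_trans (_ : \sum_(j : {set V} * {set V}) (Q j.2)%:R * (Ex p (F j) * (#|j.2|%:R * g)) <= _).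
  apply: ler_sum => j _; rewrite Ex_sum.
  have -> : (Q j.2)%:R * (Ex p (F j) * (#|j.2|%:R * g)) =
      \sum_(y in j.2) (Q j.2)%:R * (Ex p (F j) * g).
    by rewrite sumr_const -mulr_natl; ring.
  apply: ler_sum => y _; rewrite ExZ ler_wpM2l //.
  rewrite (@Ex_indep _ _ p (touch inc j.1)) /=.
  - rewrite ler_wpM2l ?Ex_ge0 //.
    (* Discarding the explored edges changes the subgraph from [H] to [H :\: touch inc j.1]; the
       uniformity of [survival] over subgraphs covers it. *)
    apply: le_trans (sg (H :\: touch inc j.1) y).
    by apply: le_Pr => // w; rewrite setIDAC setIDA.
  - move=> w; rewrite /F /st; case: j => U L /=; rewrite !xpair_eqE.
    have [-> UE] := sball_touch w x r H U.
    by case: eqP => //= /UE ->.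
  - by move=> w; rewrite /G setDDl setUid.
rewrite mulrC -ExZ.
rewrite [leLHS](_ : _ = Ex p (fun w => \sum_(j : {set V} * {set V})
    F j w * ((Q j.2)%:R * (#|j.2|%:R * g)))); last first.
  rewrite Ex_sum; apply: eq_bigr => j _; rewrite ExZr.
  by ring.
apply: le_Ex => // w; rewrite (bigD1 (st w)) //= /F eqxx mul1r.
rewrite big1 => [|j /negbTE jw]; last by rewrite eq_sym jw mul0r.
by rewrite addr0 mulrA mulrC.
Qed.

Variable C : nat.
Hypothesis volume_tail : forall x m,
  m%:R * Pr p (fun w => m <= #|cl inc w x|)%N ^+ 2 <= C%:R.

(** With [m >= r^2 / (24 A)] the volume tail gives a squared probability of at most [24 A C / r^2],
    which is below [(A / (6 r))^2] once [A >= 36 * 24 * C = 864 C]. This is half of the target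
    [A / (3 r)]; the small spheres take the other half. The successor ensures [A >= 1] for the base
    case. *)
Let A := (864 * C).+1.
Let Ar : R := A%:R.

(* Kozma and Nachmias: if the cluster has at most r^2/(24A) vertices, half of
   the levels between r and 2r have at most r/(12A) vertices, and survival from
   r to 3r through a small level costs a second factor A/r. *)
Lemma survival_pow3 k : survival (3 ^ k) (Ar / (3 ^ k)%:R).
Proof.
have A1 : 1 <= Ar by rewrite ler1n.
elim: k => [|k IH] H x.
  by rewrite expn0 divr1; apply: le_trans A1; exact: Pr_le1.
set r := (3 ^ k)%N in IH *.
have r1 : 1 <= r%:R :> R by rewrite ler1n expn_gt0.
have r0 : 0 < r%:R :> R by exact: lt_le_trans r1.
have A0 : 0 < Ar by exact: lt_le_trans A1.
pose m := (r ^ 2 %/ (24 * A)).+1.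
pose t : R := r%:R / (12 * Ar).
have t0 : 0 <= t by rewrite divr_ge0 ?mulr_ge0 ?ler0n.
pose Q (L : {set V}) := #|L|%:R <= t.
have tE : 24 * Ar * (r%:R * t / 2) = r%:R ^+ 2 by rewrite /t; field; lra.
rewrite expnS -/r.
pose big w := (m <= #|cl inc (w :&: H) x|)%N.
pose ev j w := Q (level inc (w :&: H) x (r + j)) &&
  alive inc (w :&: H) x (r + j + r).
have evP j : Pr p (ev j) <= t * (Ar / r%:R) ^+ 2.
  apply: le_trans (Pr_alive_markov _ _ _ _ IH) _.
  rewrite expr2 [leRHS]mulrA ler_wpM2r ?divr_ge0 ?ler0n //.
  apply: le_trans (_ : Ex p (fun w => t * (alive inc (w :&: H) x r)%:R) <= _).
    apply: le_Ex => // w; case Qt: (Q _); last first.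
      by rewrite mul0r mulr_ge0.
    have [L0|L0] := eqVneq (level inc (w :&: H) x (r + j)) set0.
      by rewrite L0 cards0 mulr0 mulr_ge0.
    by rewrite (alive_leq (leq_addr j r) L0) mulr1 mul1r.
  by rewrite ExZ ler_wpM2l //; exact: IH.
have main : Pr p (fun w => alive inc (w :&: H) x (3 * r)) <=
    Pr p big + 2 / r%:R * \sum_(j < r) Pr p (ev j).
  rewrite /Pr -Ex_sum -ExZ -ExD; apply: le_Ex => // w.
  have S0 : 0 <= 2 / r%:R * \sum_(j < r) (ev j w)%:R :> R.
    by rewrite mulr_ge0 ?divr_ge0 ?ler0n // sumr_ge0.
  case a3: (alive _ _ _ _); last by rewrite addr_ge0.
  case: (boolP (big w)) => [_|]; first by rewrite lerDl.
  rewrite /big -ltnNge ltnS => clm; rewrite add0r.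
  have evw (j : 'I_r) : ev j w = Q (level inc (w :&: H) x (r + j)).
    rewrite /ev; apply/andb_idr => _; apply: alive_leq a3.
    by have := ltn_ord j; lia.
  have sumL : \sum_(j < r) #|level inc (w :&: H) x (r + j)|%:R <=
      r%:R * t / 2 :> R.
    rewrite -(ler_pM2l (_ : 0 < 24 * Ar)) ?mulr_gt0 // tE.
    apply: le_trans (_ : (24 * A * #|cl inc (w :&: H) x|)%:R <= _); last first.
      rewrite -natrX ler_nat mulnC; apply: leq_trans (leq_divM _ (24 * A)).
      by rewrite leq_mul2r clm orbT.
    rewrite -natr_sum /Ar -!natrM ler_nat leq_mul2l; apply/orP; right.
    apply: leq_trans (sball_card_cl inc _ _ (r + r)).
    by rewrite -card_level_sum big_split_ord /= leq_addl.
  rewrite -(ler_pM2l (_ : 0 < r%:R / 2)) ?divr_gt0 // mulr1.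
  have -> : r%:R / 2 * (2 / r%:R * \sum_(j < r) (ev j w)%:R) =
      \sum_(j < r) (ev j w)%:R :> R by field; lra.
  have t00 : 0 < t by rewrite divr_gt0 ?mulr_gt0.
  rewrite -(ler_pM2l t00).
  (* Markov's inequality by counting: [t - #|level|] is at most [t] on a small sphere and negative
     on a large one. *)
  have : \sum_(j < r) (t - #|level inc (w :&: H) x (r + j)|%:R) <=
      \sum_(j < r) t * (ev j w)%:R.
    apply: ler_sum => j _; rewrite evw /Q; case h: (_ <= t).
      by rewrite /= mulr1 gerBl.
    by rewrite /= mulr0; move/negbT: h; rewrite -ltNge; lra.
  rewrite sumrB sumr_const card_ord -mulr_natl -big_distrr /=.
  by move: sumL; lra.
have bigP : Pr p big <= Ar / (6 * r%:R).
  have b0 : 0 <= Ar / (6 * r%:R) by rewrite divr_ge0 ?mulr_ge0 ?ler0n.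
  have m0 : 0 < m%:R :> R by rewrite ltr0n.
  rewrite -(ler_pXn2r (_ : 0 < 2)%N) ?nnegrE ?Pr_ge0 //.
  rewrite -(ler_pM2l m0).
  apply: le_trans (_ : C%:R <= _).
    apply: le_trans (volume_tail x m); rewrite ler_pM2l //.
    rewrite ler_pXn2r ?nnegrE ?Pr_ge0 //; apply: le_Pr => // w.
    rewrite /big => /leq_trans; apply; apply: subset_leq_card.
    apply/subsetP => y; rewrite !inE; apply: conn_mono; exact: subsetIl.
  have mr : r%:R ^+ 2 <= 24 * Ar * m%:R.
    rewrite /Ar -natrX -!natrM ler_nat mulnC; apply: ltnW.
    by rewrite /m; apply: ltn_ceil.
  have AC : 864 * C%:R <= Ar by rewrite /Ar -natrM ler_nat.
  rewrite expr_div_n mulrA ler_pdivlMr ?exprn_gt0 ?mulr_gt0 //.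
  rewrite exprMn; have C0 : 0 <= C%:R :> R by rewrite ler0n.
  apply: le_trans (_ : C%:R * (6 ^+ 2 * (24 * Ar * m%:R)) <= _).
    by rewrite !ler_wpM2l // exprn_ge0.
  have := ler_wpM2r (mulr_ge0 (ltW A0) (ltW m0)) AC.
  by rewrite expr2; lra.
apply: le_trans main _.
apply: le_trans (_ : Ar / (6 * r%:R) + 2 / r%:R *
    \sum_(j < r) (t * (Ar / r%:R) ^+ 2) <= _).
  apply: lerD => //; apply: ler_wpM2l; first by rewrite divr_ge0 ?ler0n.
  by apply: ler_sum => j _; exact: evP.
rewrite sumr_const card_ord -mulr_natl natrM /t.
rewrite le_eqVlt; apply/orP; left; apply/eqP; field.
by lra.
Qed.

Lemma survival_inv s : (0 < s)%N -> survival s (3 * Ar / s%:R).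
Proof.
move=> s0 H x; have /andP[ks sk] := trunc_log_bounds (isT : 1 < 3)%N s0.
set k := trunc_log 3 s in ks sk.
apply: le_trans (le_trans (survival_pow3 k H x) _).
  by apply: le_Pr => // w; exact: alive_leq.
rewrite ler_pdivlMr ?ltr0n // mulrAC ler_pdivrMr ?ltr0n ?expn_gt0 //.
have sk' : s%:R <= (3 * 3 ^ k)%:R :> R by rewrite ler_nat -expnS ltnW.
rewrite natrM in sk'.
have A0 : 0 <= Ar by rewrite ler0n.
by nra.
Qed.

Variable X : nat.
Hypothesis susceptibility : forall x,
  \sum_y Pr p (fun w => conn inc w x y) <= X%:R.

Lemma survival_exp k s : (0 < X)%N -> (0 < s)%N ->
  survival (k * (2 * X) + s) (2^-1 ^+ k * (3 * Ar / s%:R)).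
Proof.
move=> X0 s0; elim: k => [|k IH] H x; first by rewrite mul1r; exact: survival_inv.
have [r rX Er] : exists2 r, (r < 2 * X)%N &
    Ex p (fun w => #|level inc (w :&: H) x r|%:R) <= 2^-1.
  have [/existsP[r rE]|] := boolP [exists r : 'I_(2 * X),
      Ex p (fun w => #|level inc (w :&: H) x r|%:R) <= 2^-1].
    by exists r.
  rewrite negb_exists => /forallP r2.
  suff : \sum_(r < 2 * X) 2^-1 < X%:R :> R.
    by rewrite sumr_const card_ord -[2^-1 *+ _]mulr_natl natrM; lra.
  apply: lt_le_trans (_ : \sum_(r < 2 * X)
      Ex p (fun w => #|level inc (w :&: H) x r|%:R) <= _).
    apply: ltr_sum; last by move=> r _; rewrite ltNge r2.
    by apply/hasP; exists (Ordinal (ltn_Pmull (isT : 1 < 2)%N X0 : X < 2 * X)%N);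
      rewrite ?mem_index_enum.
  apply: le_trans (susceptibility x); rewrite -!Ex_sum; apply: le_Ex => // w.
  rewrite -!natr_sum ler_nat card_level_sum.
  have -> : (\sum_y conn inc w x y = #|cl inc w x|)%N.
    by rewrite -sum1_card [RHS]big_mkcond; apply: eq_bigr => y _; rewrite inE; case: conn.
  apply: subset_leq_card; apply/subsetP => y /sball_conn.
  by rewrite inE; apply: conn_mono; exact: subsetIl.
apply: le_trans (_ : Pr p (fun w => xpredT (level inc (w :&: H) x r) &&
    alive inc (w :&: H) x (r + (k * (2 * X) + s))) <= _).
  (* The good radius [r] depends on [x] and [H] but is below [2 X]; survival to the larger distance
     implies survival to the smaller one. *)
  apply: le_Pr => // w; apply: alive_leq; rewrite mulSn -addnA leq_add2r.
  exact: ltnW.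
apply: le_trans (Pr_alive_markov xpredT r H x IH) _.
rewrite exprS -[leRHS]mulrA ler_wpM2r //.
  by rewrite !mulr_ge0 ?exprn_ge0 ?invr_ge0 ?ler0n.
by apply: le_trans Er; apply: le_Ex => // w; rewrite mul1r.
Qed.

End IntrinsicDistance.

(** * Trees of disjoint connections and ghost vertices *)

Section Tree.
Variables (V I : finType) (inc : I -> V -> V -> bool).
Hypothesis inc_sym : forall i x y, inc i x y = inc i y x.
Hypothesis inc_uniq : forall i x y x' y', inc i x y -> inc i x' y' ->
  (x' = x /\ y' = y) \/ (x' = y /\ y' = x).
Implicit Types (w : {set I}) (x y z u v b c k : V) (K S : {set V}) (P : seq V).

(** A path is represented by all open non-loop edges between its vertices. Two vertex lists sharing
    at most one vertex then have disjoint pieces, because such an edge has two distinct ends. *)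
Let piece w P := [set i in w |
  [exists x, exists y, [&& x \in P, y \in P, x != y & inc i x y]]].

Let pieceP w P i : reflect (i \in w /\ exists x y,
    [/\ x \in P, y \in P, x != y & inc i x y]) (i \in piece w P).
Proof.
rewrite inE; apply: (iffP andP) => -[-> H]; split=> //.
  by move/existsP: H => [x /existsP[y /and4P[? ? ? ?]]]; exists x, y.
by move: H => [x [y [? ? ? ?]]]; apply/existsP; exists x; apply/existsP;
  exists y; apply/and4P.
Qed.

Let piece_sub w P : piece w P \subset w.
Proof. by apply/subsetP => i /pieceP[]. Qed.

Let piece_disj w P P' v : (forall y, y \in P -> y \in P' -> y = v) ->
  [disjoint piece w P & piece w P'].
Proof.
move=> PP'; rewrite disjoints_subset; apply/subsetP => i.
move=> /pieceP[_ [x [y [xP yP + ixy]]]]; rewrite inE; apply: contraNN.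
move=> /pieceP[_ [x' [y' [xP' yP' _ ixy']]]].
by case: (inc_uniq ixy ixy') => -[xE yE]; subst x' y'; apply/eqP;
  have -> := PP' x xP; rewrite // (PP' y yP).
Qed.

Let piece_conn w x s P : path (adj inc w) x s -> uniq (x :: s) ->
  {subset x :: s <= P} -> conn inc (piece w P) x (last x s).
Proof.
elim: s x => [|y s IH] x; first by move=> *; exact: conn0.
move=> /= /andP[xy ys] /andP[xs us] sP.
apply: conn_trans (IH y ys us _); last first.
  by move=> z zs; apply: sP; rewrite inE zs orbT.
apply: (conn_adj (conn0 _ _ _)); move/adjP: xy => [i iw ixy].
apply/adjP; exists i => //; apply/pieceP; split=> //; exists x, y; split=> //.
- by apply: sP; rewrite inE eqxx.
- by apply: sP; rewrite !inE eqxx orbT.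
- by apply: contraNneq xs => ->; rewrite inE eqxx.
Qed.

Let first_hit w (Q : {pred V}) z t :
  path (adj inc w) z t -> uniq (z :: t) -> last z t \in Q ->
  exists t', [/\ path (adj inc w) z t', uniq (z :: t'), last z t' \in Q,
    forall y, y \in z :: t' -> y \in Q -> y = last z t' & {subset t' <= t}].
Proof.
elim: t z => [|y t IH] z.
  by move=> _ _ zQ; exists [::]; split=> // y; rewrite inE => /eqP.
have [zQ _ _ _|zQ] := boolP (z \in Q).
  by exists [::]; split=> // y'; rewrite inE => /eqP.
move=> /= /andP[zy yt] /andP[zt ut] lQ; have [t' [yt' ut' lt' Qt' tt']] := IH y yt ut lQ.
exists (y :: t'); split=> //; first by rewrite /= zy.
- apply/andP; split=> //; apply: contra zt; rewrite !inE => /orP[->//|/tt' ->].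
  by rewrite orbT.
- by move=> y'; rewrite inE => /orP[/eqP ->|]; [rewrite (negbTE zQ)|exact: Qt'].
- by move=> y'; rewrite !inE => /orP[->//|/tt' ->]; rewrite orbT.
Qed.

Let uniq_path w x y : conn inc w x y ->
  exists s, [/\ path (adj inc w) x s, uniq (x :: s) & last x s = y].
Proof. by move=> /connectP[s + ->] => /shortenP[s' ? ? _]; exists s'. Qed.

(** Take a simple path from [x] to [u] and stop a path from [z] at its first vertex [v] on it: the
    three pieces meet only at [v]. The last clause records that they contain no loops, hence no
    marks. *)
Lemma conn_tree w x u z : conn inc w x u -> conn inc w x z ->
  exists v (P1 P2 P3 : {set I}), [/\ [/\ P1 \subset w, P2 \subset w & P3 \subset w],
    [/\ [disjoint P1 & P2], [disjoint P1 & P3] & [disjoint P2 & P3]],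
    [/\ conn inc P1 x v, conn inc P2 v u & conn inc P3 v z] &
    forall i, i \in P1 :|: P2 :|: P3 -> exists a b, a != b /\ inc i a b].
Proof.
move=> /uniq_path[s [ps us su]] xz.
have /uniq_path[t [pt ut tx]] : conn inc w z x by rewrite conn_sym.
have [|t' [pt' ut' lt' Qt' _]] := first_hit (Q := [pred y in x :: s]) pt ut.
  by rewrite tx inE eqxx.
set v := last z t' in lt' Qt'; rewrite unfold_in in lt'.
have [s1 [s2 [sE s1v]]] : exists s1 s2, s = s1 ++ s2 /\ last x s1 = v.
  by case/splitPl: lt' => s1 s2 <-; exists s1, s2.
exists v, (piece w (x :: s1)), (piece w (v :: s2)), (piece w (z :: t')).
rewrite sE -cat_cons cat_uniq in us; case/and3P: us => us1 us12 us2.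
rewrite sE cat_path s1v in ps; case/andP: ps => ps1 ps2.
have vs1 : v \in x :: s1 by rewrite -s1v mem_last.
have vs2 : v \notin s2.
  by apply: contra us12 => vs2; apply/hasP; exists v.
have memP y : y \in z :: t' -> (y \in x :: s1) || (y \in v :: s2) -> y = v.
  move=> yt' ys; apply: Qt' => //.
  rewrite -[_ \in _]/(y \in x :: s) sE -cat_cons mem_cat.
  by case/orP: ys => [->//|]; rewrite inE => /orP[/eqP ->|->]; rewrite ?vs1 ?orbT.
split.
- by split; exact: piece_sub.
- split; apply: (@piece_disj _ _ _ v) => y.
  + move=> ys1; rewrite inE => /orP[/eqP //|ys2].
    by case/negP: us12; apply/hasP; exists y.
  + by move=> ys1 yt'; apply: memP => //; rewrite ys1.
  + by move=> ys1 yt'; apply: memP => //; rewrite ys1 orbT.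
- split.
  + by rewrite -s1v; exact: piece_conn.
  + rewrite -su sE last_cat s1v; apply: piece_conn => //.
    by rewrite cons_uniq vs2.
  + by rewrite conn_sym //; exact: piece_conn.
- move=> i; rewrite in_setU in_setU => /orP[/orP[]|] /pieceP[_ [a [b [_ _ ab iab]]]];
  by exists a, b.
Qed.

Lemma disj_occ3 (A B C : pred {set I}) w (P1 P2 P3 : {set I}) :
  [/\ P1 \subset w, P2 \subset w & P3 \subset w] ->
  [/\ [disjoint P1 & P2], [disjoint P1 & P3] & [disjoint P2 & P3]] ->
  A P1 -> B P2 -> C P3 -> disj_occ A (disj_occ B C) w.
Proof.
move=> [P1w P2w P3w] [d12 d13 d23] AP BP CP.
apply/disj_occP; exists P1, (P2 :|: P3); split=> //.
- by rewrite subUset P2w.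
- by rewrite -setI_eq0 setIUr !disjoint_setI0 ?setU0.
- apply/disj_occP; exists P2, P3; split=> //; [exact: subsetUl|exact: subsetUr].
Qed.

Lemma conn_disj_occ w x u z : conn inc w x u -> conn inc w x z -> exists v,
  disj_occ (fun w => conn inc w x v)
    (disj_occ (fun w => conn inc w v u) (fun w => conn inc w v z)) w.
Proof.
move=> xu xz; have [v [P1 [P2 [P3 [? ? [? ? ?] _]]]]] := conn_tree xu xz.
by exists v; apply: (disj_occ3 (P1 := P1) (P2 := P2) (P3 := P3)).
Qed.

(** Exploring a cluster reveals exactly the edges touching it. *)
Lemma cl_touch w x K : (cl inc (w :&: touch inc K) x == K) = (cl inc w x == K).
Proof.
have sub w0 y : conn inc (w0 :&: touch inc K) x y -> conn inc w0 x y.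
  by apply: conn_mono; exact: subsetIl.
apply/eqP/eqP => wK.
  apply/setP => y; apply/idP/idP; rewrite inE; last first.
    by rewrite -{1}wK inE => /sub.
  move: y; apply: conn_ind => [|y z _ yK /adjP[i iw iyz]].
    by rewrite -wK inE conn0.
  rewrite -wK inE; apply: (conn_adj (y := y)).
    by move: yK; rewrite -{1}wK inE.
  by apply/adjP; exists i => //; rewrite in_setI iw; apply/touchP; exists y, z.
apply/setP => y; apply/idP/idP; rewrite inE; first by move=> /sub; rewrite -wK inE.
rewrite -{1}wK inE; move: y; apply: conn_ind => [|y z xy xy' /adjP[i iw iyz]].
  exact: conn0.
apply: (conn_adj xy'); apply/adjP; exists i => //; rewrite in_setI iw.
by apply/touchP; exists y, z; split=> //; rewrite -wK inE.
Qed.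

Section Marks.
Variable mk : V -> I.
Hypothesis inc_mk : forall v x y, inc (mk v) x y = (x == v) && (y == v).

(** The ghost edge at [v] is encoded as the loop [mk v]. Edges and marks thus share one product
    measure, and [touch inc K] contains the marks of [K], so that exploring a cluster reveals its
    marks too. *)
Definition marked w x := [exists y, conn inc w x y && (mk y \in w)].

Lemma markedP w x : reflect (exists2 y, conn inc w x y & mk y \in w) (marked w x).
Proof.
by apply: (iffP existsP) => [[y /andP[? ?]]|[y ? ?]]; exists y => //; apply/andP.
Qed.

Lemma marked_mono w w' x : w \subset w' -> marked w x -> marked w' x.
Proof.
move=> ww' /markedP[y xy yw]; apply/markedP; exists y.
  exact: conn_mono xy.
exact: subsetP ww' _ yw.
Qed.

Lemma marked_incr x : increasing (marked^~ x).
Proof. by move=> w w'; exact: marked_mono. Qed.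

Lemma marked_conn w x y : conn inc w x y -> marked w y -> marked w x.
Proof.
by move=> xy /markedP[z yz zw]; apply/markedP; exists z => //; exact: conn_trans yz.
Qed.

Lemma mk_touch S y : (mk y \in touch inc S) = (y \in S).
Proof.
apply/touchP/idP => [[x [z [xS]]]|yS].
  by rewrite inc_mk => /andP[/eqP <-].
by exists y, y; rewrite inc_mk eqxx.
Qed.

(** The loop at [z] is added to the third piece; this keeps the pieces disjoint because none of them
    contains a loop. *)
Lemma marked_disj_occ w x u : conn inc w x u -> marked w x -> exists v,
  disj_occ (fun w => conn inc w x v)
    (disj_occ (fun w => conn inc w v u) (marked^~ v)) w.
Proof.
move=> xu /markedP[z xz zw].
have [v [P1 [P2 [P3 [[? ? ?] [? d1 d2] [? ? vz] H]]]]] := conn_tree xu xz.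
have mkP : mk z \notin P1 :|: P2 :|: P3.
  apply/negP => /H[a [b [ab]]]; rewrite inc_mk => /andP[/eqP az /eqP bz].
  by rewrite az bz eqxx in ab.
rewrite !in_setU !negb_or in mkP; case/andP: mkP => /andP[m1 m2] m3.
have dj (P : {set I}) : [disjoint P & P3] -> mk z \notin P -> [disjoint P & mk z |: P3].
  move=> PP3 mP; rewrite disjoints_subset; apply/subsetP => i iP.
  rewrite inE in_setU1 negb_or (disjointFr PP3) // andbT.
  by apply: contraNneq mP => <-.
exists v; apply: (disj_occ3 (P1 := P1) (P2 := P2) (P3 := mk z |: P3)) => //.
- by split=> //; rewrite subUset sub1set zw.
- by split=> //; apply: dj.
- apply/markedP; exists z; last exact: setU11.
  by apply: conn_mono vz; exact: subsetUr.
Qed.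

(** A simple path from [c] to its mark must visit [S]; cutting it at such a vertex [k] gives two
    disjoint pieces, the second one completed by the mark. *)
Lemma marked_off w c S : marked w c -> ~~ marked (w :\: touch inc S) c ->
  exists2 k, k \in S & disj_occ (fun w => conn inc w c k) (marked^~ k) w.
Proof.
move=> /markedP[y cy yw] mS.
have [s [ps us sy]] := uniq_path cy.
have [/hasP[k ks kS]|/hasPn sS] := boolP (has (mem S) (c :: s)); last first.
  case/negP: mS; apply/markedP; exists y.
    rewrite -sy; elim: s c ps sS {cy us sy} => [|z s IH] c; first by move=> *; exact: conn0.
    move=> /= /andP[cz zs] sS.
    have zs' y' : y' \in z :: s -> y' \notin mem S.
      by move=> y's; apply: sS; rewrite inE y's orbT.
    apply: conn_trans (IH z zs zs'); apply: (conn_adj (conn0 _ _ _)).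
    apply: adj_off => //; first by apply: sS; rewrite mem_head.
    by apply: zs'; rewrite mem_head.
  rewrite in_setD yw andbT mk_touch; apply: sS; by rewrite -sy mem_last.
exists k => //.
have [s1 [s2 [sE s1k]]] : exists s1 s2, s = s1 ++ s2 /\ last c s1 = k.
  by case/splitPl: ks => s1 s2 <-; exists s1, s2.
rewrite sE -cat_cons cat_uniq in us; case/and3P: us => us1 us12 us2.
rewrite sE cat_path s1k in ps; case/andP: ps => ps1 ps2.
have ks1 : k \in c :: s1 by rewrite -s1k mem_last.
have ks2 : k \notin s2.
  by apply: contra us12 => ?; apply/hasP; exists k.
have mP P : mk y \notin piece w P.
  apply/negP => /pieceP[_ [a [b [_ _ ab]]]]; rewrite inc_mk => /andP[/eqP ay /eqP by_].
  by rewrite ay by_ eqxx in ab.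
apply/disj_occP; exists (piece w (c :: s1)), (mk y |: piece w (k :: s2)); split.
- exact: piece_sub.
- by rewrite subUset sub1set yw piece_sub.
- have dj : [disjoint piece w (c :: s1) & piece w (k :: s2)].
    apply: (@piece_disj _ _ _ k) => z zs1; rewrite inE => /orP[/eqP //|zs2].
    by case/negP: us12; apply/hasP; exists z.
  rewrite disjoints_subset; apply/subsetP => i iP.
  rewrite inE in_setU1 negb_or (disjointFr dj) // andbT.
  by apply: contraTneq iP => ->; exact: mP.
- by rewrite -s1k; exact: piece_conn.
- apply/markedP; exists y; last exact: setU11.
  apply: conn_mono (subsetUr _ _) _.
  rewrite -sy sE last_cat s1k; apply: piece_conn => //.
  by rewrite cons_uniq ks2.
Qed.

Lemma conn_isolated w S c y : c \in S -> conn inc (w :\: touch inc S) c y -> y = c.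
Proof.
move=> cS; move: y; apply: conn_ind => // y z _ -> /adjP[i].
by rewrite in_setD => /andP[/negP iS _] icz; case: iS; apply/touchP; exists c, z.
Qed.

Lemma marked_isolated w S c : c \in S -> ~~ marked (w :\: touch inc S) c.
Proof.
move=> cS; apply/negP => /markedP[y /(conn_isolated cS) ->].
by rewrite in_setD mk_touch cS.
Qed.

Lemma cl_marked_touch w x K :
  ((cl inc (w :&: touch inc K) x == K) && marked (w :&: touch inc K) x) =
  ((cl inc w x == K) && marked w x).
Proof.
rewrite cl_touch; case: eqP => //= wK.
have := cl_touch w x K; rewrite wK eqxx => /eqP wK'.
apply/idP/idP; first by apply: marked_mono; exact: subsetIl.
move=> /markedP[y xy yw]; have yK : y \in K by rewrite -wK inE.
apply/markedP; exists y; last by rewrite in_setI yw mk_touch.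
by move: yK; rewrite -{1}wK' inE.
Qed.

End Marks.

End Tree.

(** * Diagrammatic bounds and the magnetization inequality *)

Section Diagrams.
Variables (R : realFieldType) (V I : finType) (inc : I -> V -> V -> bool).
Hypothesis inc_sym : forall i x y, inc i x y = inc i y x.
Hypothesis inc_uniq : forall i x y x' y', inc i x y -> inc i x' y' ->
  (x' = x /\ y' = y) \/ (x' = y /\ y' = x).
Variable p : I -> R.
Hypothesis p01 : forall i, 0 <= p i <= 1.
Implicit Types (w : {set I}) (x y z u v b c k : V) (K S W : {set V}).

Definition tau x y := Pr p (fun w => conn inc w x y).

Lemma tau_ge0 x y : 0 <= tau x y. Proof. exact: Pr_ge0. Qed.

(** [D] remains attached to the arm at the root. With [D] saying that [x] is unmarked, the bound is
    again in terms of [unmarked_conn x]. *)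
Lemma tree_graph x u z (D : pred {set I}) : decreasing D ->
  Pr p (fun w => [&& conn inc w x u, conn inc w x z & D w]) <=
  \sum_v Pr p (fun w => conn inc w x v && D w) * (tau v u * tau v z).
Proof.
move=> dD.
apply: le_trans (_ : \sum_v Pr p (fun w => disj_occ (fun w => conn inc w x v)
    (disj_occ (fun w => conn inc w v u) (fun w => conn inc w v z)) w && D w) <= _).
  apply: (Pr_union p01) => w /and3P[xu xz Dw].
  by have [v dv] := conn_disj_occ inc_sym inc_uniq xu xz; exists v; rewrite ?dv.
by apply: ler_sum => v _; apply: (vanDenBergKesten3 p01) => //; exact: conn_incr.
Qed.

Variable mk : V -> I.
Hypothesis inc_mk : forall v x y, inc (mk v) x y = (x == v) && (y == v).

Definition Mag x := Pr p (fun w => marked inc mk w x).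

Lemma Mag_ge0 x : 0 <= Mag x. Proof. exact: Pr_ge0. Qed.

Let marked_tree x k : Pr p (fun w => conn inc w x k && marked inc mk w x) <=
  \sum_v tau x v * (tau v k * Mag v).
Proof.
apply: le_trans (_ : \sum_v Pr p (fun w => disj_occ (fun w => conn inc w x v)
    (disj_occ (fun w => conn inc w v k) (marked inc mk ^~ v)) w && true) <= _).
  apply: (Pr_union p01) => w /andP[xk xm].
  have [v dv] := marked_disj_occ inc_sym inc_uniq inc_mk xk xm.
  by exists v; rewrite ?dv.
apply: ler_sum => v _.
rewrite [X in _ <= X * _](_ : _ = Pr p (fun w => conn inc w x v && true)).
  by apply: (vanDenBergKesten3 p01) => //; (exact: conn_incr || exact: marked_incr).
by apply: eq_Ex => w; rewrite andbT.
Qed.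

Lemma Mag_off c S : Mag c <=
  Pr p (fun w => marked inc mk (w :\: touch inc S) c) +
  \sum_(k in S) tau c k * Mag k.
Proof.
apply: le_trans (_ : Pr p (fun w => marked inc mk (w :\: touch inc S) c) +
  \sum_(k in S) Pr p (fun w => disj_occ (fun w => conn inc w c k)
     (marked inc mk ^~ k) w && true) <= _).
  rewrite /Mag /Pr -Ex_sum -ExD; apply: le_Ex => // w.
  case mc: (marked _ _ w c); last by rewrite addr_ge0 ?sumr_ge0.
  case: (boolP (marked _ _ (_ :\: _) c)) => [_|mcS]; first by rewrite lerDl sumr_ge0.
  have [k kS dk] := marked_off inc_uniq inc_mk mc mcS.
  by rewrite add0r (bigD1 k) //= dk lerDl sumr_ge0.
rewrite lerD2l; apply: ler_sum => k _.
rewrite [X in _ <= X * _](_ : _ = Pr p (fun w => conn inc w c k && true)).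
  by apply: (vanDenBergKesten p01) => //; (exact: conn_incr || exact: marked_incr).
by apply: eq_Ex => w; rewrite andbT.
Qed.

Variables (M M1 eps : R).
Hypothesis MagM : forall k, Mag k <= M.
Hypothesis M10 : 0 <= M1.

Let M0 x : 0 <= M. Proof. exact: le_trans (Mag_ge0 x) (MagM x). Qed.

Let two_arms w b c := [&& marked inc mk w b, marked inc mk w c & ~~ conn inc w b c].

Let offK w K := w :\: touch inc K.

Let sum_tauM c S : \sum_(k in S) tau c k * Mag k <= M * \sum_(k in S) tau c k.
Proof.
rewrite big_distrr; apply: ler_sum => k _ /=.
by rewrite mulrC ler_wpM2r ?tau_ge0.
Qed.

(* Explore the cluster of [b] outside [K], then look for the second arm outside
   both; what is lost is bounded by connections to the explored clusters. *)
Let two_arms_lb K b c : M1 <= Mag b -> M1 <= Mag c ->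
  \sum_k \sum_v tau b v * tau v k * tau c k <= eps ->
  M1 ^+ 2 - M ^+ 2 * eps - M ^+ 2 * \sum_(k in K) (tau b k + tau c k) <=
  Pr p (fun w => two_arms (offK w K) b c).
Proof.
move=> M1b M1c Teps.
pose mb w := marked inc mk (offK w K) b.
pose F K' w : R := ((cl inc (offK w K) b == K') && mb w)%:R.
pose G K' w : R := (marked inc mk (offK w (K :|: K')) c)%:R.
have step1 : \sum_K' Ex p (F K') * Ex p (G K') <=
    Pr p (fun w => two_arms (offK w K) b c).
  apply: le_trans (_ : Ex p (fun w => \sum_K' F K' w * G K' w) <= _).
    rewrite Ex_sum; apply: ler_sum => K' _; rewrite le_eqVlt; apply/orP; left.
    apply/eqP; rewrite -(@Ex_indep _ _ p (touch inc K')) //.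
      move=> w; rewrite /F /mb; congr (_%:R).
      have -> : offK (w :&: touch inc K') K = offK w K :&: touch inc K'.
        by rewrite /offK setIDAC.
      by rewrite (cl_marked_touch inc_mk).
    move=> w; congr ((marked _ _ _ _)%:R).
    by rewrite /offK touchU setDDl setUC -setUA setUid setUC.
  apply: le_Ex => // w.
  rewrite (bigD1 (cl inc (offK w K) b)) //= [X in _ + X <= _]big1 ?addr0 => [|K' /negbTE KK']; last first.
    by rewrite /F eq_sym KK' mul0r.
  rewrite /F eqxx /= -natrM ler_nat mulnb; case: andP => // -[mbw mcw].
  rewrite -[(_ <= _)%N]/(0 < _)%N lt0b.
  rewrite /two_arms -/(mb w) mbw /=.
  have -> : marked inc mk (offK w K) c.
    apply: marked_mono mcw; apply: setDS; rewrite touchU; exact: subsetUl.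
  (* Were [c] joined to [b] off [K], it would lie in the explored cluster and could not be marked
     off it. *)
  case bc: (conn _ _ b c) => //.
  have cK : c \in K :|: cl inc (offK w K) b by rewrite !inE bc orbT.
  by move: mcw; rewrite (negbTE (marked_isolated inc_mk w cK)).
apply: le_trans step1.
have step2 K' : Mag c - M * \sum_(k in K) tau c k - M * \sum_(k in K') tau c k
    <= Ex p (G K').
  have := Mag_off c (K :|: K'); have := sum_tauM c (K :|: K').
  have : \sum_(k in K :|: K') tau c k <= \sum_(k in K) tau c k + \sum_(k in K') tau c k.
    rewrite [leLHS]big_mkcond [X in _ <= X + _]big_mkcond [X in _ <= _ + X]big_mkcond.
    rewrite -big_split; apply: ler_sum => k _ /=; rewrite in_setU.
    by case: (k \in K); case: (k \in K'); rewrite /= ?addr0 ?add0r // lerDl tau_ge0.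
  move=> /(ler_wpM2l (M0 c)); rewrite mulrDr /Mag /Pr /G /offK; lra.
have F0 K' : 0 <= Ex p (F K') by apply: Ex_ge0.
apply: le_trans (_ : \sum_K' Ex p (F K') *
    (M1 - M * \sum_(k in K) tau c k - M * \sum_(k in K') tau c k) <= _); last first.
  apply: ler_sum => K' _; rewrite ler_wpM2l //.
  by apply: le_trans (step2 K'); rewrite !lerD2r.
have sumF : \sum_K' Ex p (F K') = Pr p mb.
  rewrite -Ex_sum; apply: eq_Ex => w.
  rewrite (bigD1 (cl inc (offK w K) b)) //= [X in _ + X]big1 ?addr0.
    by rewrite /F eqxx.
  by move=> K' /negbTE KK'; rewrite /F eq_sym KK'.
have sumFk : \sum_K' Ex p (F K') * \sum_(k in K') tau c k <= M * eps.
  apply: le_trans (_ : \sum_k Pr p (fun w => conn inc w b k && marked inc mk w b) * tau c k <= _).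
    apply: le_trans (_ : Ex p (fun w => \sum_K' F K' w * \sum_(k in K') tau c k) <= _).
      by rewrite Ex_sum; apply: ler_sum => K' _; rewrite ExZr.
    apply: le_trans (_ : Ex p (fun w => \sum_k (conn inc w b k && marked inc mk w b)%:R * tau c k) <= _).
      apply: le_Ex => // w.
      rewrite (bigD1 (cl inc (offK w K) b)) //= [X in _ + X <= _]big1 ?addr0 => [|K' /negbTE KK']; last first.
        by rewrite /F eq_sym KK' mul0r.
      rewrite /F eqxx /=; case mbw: (mb w); last first.
        by rewrite mul0r; apply: sumr_ge0 => k _; rewrite mulr_ge0 ?tau_ge0.
      rewrite mul1r big_mkcond; apply: ler_sum => k _; rewrite inE.
      case bk: (conn _ _ _ _); last by rewrite mulr_ge0 ?tau_ge0.
      rewrite (conn_mono _ bk) ?subsetDl // (marked_mono _ mbw) ?subsetDl //.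
      by rewrite mul1r.
    by rewrite Ex_sum; apply: ler_sum => k _; rewrite ExZr.
  (* The paths from [b] to [k] and from [b] to a mark separate at some [v]; together with [tau c k]
     they form the open triangle from [b] to [c], with a factor [Mag v <= M]. *)
  apply: le_trans (ler_wpM2l (M0 b) Teps); rewrite big_distrr.
  apply: ler_sum => k _ /=.
  apply: le_trans (ler_wpM2r (tau_ge0 c k) (marked_tree b k)) _.
  rewrite big_distrl big_distrr; apply: ler_sum => v _ /=.
  have T0 := mulr_ge0 (mulr_ge0 (tau_ge0 b v) (tau_ge0 v k)) (tau_ge0 c k).
  by have := ler_wpM2l T0 (MagM v); lra.
have -> : \sum_K' Ex p (F K') *
    (M1 - M * \sum_(k in K) tau c k - M * \sum_(k in K') tau c k) =
  Pr p mb * M1 - M * (Pr p mb * \sum_(k in K) tau c k) -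
  M * \sum_K' Ex p (F K') * \sum_(k in K') tau c k.
  rewrite (eq_bigr (fun K' => Ex p (F K') * (M1 - M * \sum_(k in K) tau c k) -
    M * (Ex p (F K') * \sum_(k in K') tau c k))); last by move=> K' _; ring.
  by rewrite sumrB -big_distrl -big_distrr /= sumF; ring.
have mbM : Pr p mb <= M.
  apply: le_trans (MagM b); apply: le_Pr => // w; apply: marked_mono.
  exact: subsetDl.
have mb_lb : M1 - M * \sum_(k in K) tau b k <= Pr p mb.
  by have := Mag_off b K; have := sum_tauM b K; rewrite -/(offK _ _) => ? ?; lra.
have sc0 : 0 <= \sum_(k in K) tau c k by apply: sumr_ge0 => k _; exact: tau_ge0.
have sb0 : 0 <= \sum_(k in K) tau b k by apply: sumr_ge0 => k _; exact: tau_ge0.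
have M1M : M1 <= M by exact: le_trans (MagM b).
have m0 := M0 b; rewrite big_split /=.
move: sumFk mbM mb_lb sc0 sb0; move: (Pr p mb) (\sum_(k in K) tau c k)
  (\sum_(k in K) tau b k) (\sum_K' _) => m sc sb T.
move=> h1 h2 h3 h4 h5.
have a1 := ler_wpM2l m0 h1.
have a2 := ler_wpM2r M10 h3.
have a3 := ler_wpM2l m0 (ler_wpM2r h4 h2).
have a4 := ler_wpM2l (mulr_ge0 m0 h5) M1M.
by rewrite !expr2; lra.
Qed.

(** The tripod before its centre is opened: the clusters of [x], [b] and [c] are distinct, since
    that of [x] is unmarked while the other two are marked and different. Joining [u] to [b] and [c]
    makes [x] marked. *)
Definition branch w x u b c := [&& conn inc w x u, ~~ marked inc mk w x,
  marked inc mk w b, marked inc mk w c & ~~ conn inc w b c].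

Definition unmarked_conn x u :=
  Pr p (fun w => conn inc w x u && ~~ marked inc mk w x).

(** Explore the unmarked cluster [K] of [x], then apply [two_arms_lb] off [K]. The loss is a sum
    over [k] in [K], and [tree_graph] with the decreasing event of being unmarked turns it into a
    sum of [unmarked_conn x v], which can later be absorbed. *)
Let branch_lb x u b c : M1 <= Mag b -> M1 <= Mag c ->
  \sum_k \sum_v tau b v * tau v k * tau c k <= eps ->
  (M1 ^+ 2 - M ^+ 2 * eps) * unmarked_conn x u -
  M ^+ 2 * \sum_v unmarked_conn x v *
    \sum_k tau v u * tau v k * (tau b k + tau c k) <=
  Pr p (fun w => branch w x u b c).
Proof.
move=> M1b M1c Teps; set a := _ - _ * eps.
pose s k := tau b k + tau c k.
have s0 k : 0 <= s k by rewrite addr_ge0 ?tau_ge0.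
pose um w := ~~ marked inc mk w x.
pose F K w : R := [&& cl inc w x == K, um w & u \in K]%:R.
have F0 K : 0 <= Ex p (F K) by apply: Ex_ge0.
apply: le_trans (_ : \sum_K Ex p (F K) * Pr p (fun w => two_arms (offK w K) b c) <= _);
    last first.
  apply: le_trans (_ : Ex p (fun w => \sum_K F K w * (two_arms (offK w K) b c)%:R) <= _).
    rewrite Ex_sum; apply: ler_sum => K _; rewrite le_eqVlt; apply/orP; left.
    apply/eqP; rewrite -(@Ex_indep _ _ p (touch inc K)) //.
      move=> w; rewrite /F /um; congr (_%:R).
      have := cl_marked_touch inc_mk w x K; rewrite cl_touch.
      by case: (cl inc w x == K) => //= ->.
    by move=> w; rewrite /offK setDDl setUid.
  apply: le_Ex => // w.
  rewrite (bigD1 (cl inc w x)) //= big1 ?addr0 => [|K /negbTE KK]; last first.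
    by rewrite /F eq_sym KK mul0r.
  rewrite /F eqxx /= -natrM ler_nat mulnb; case: andP => // -[/andP[umw ux]].
  move=> /and3P[mb mc nbc]; rewrite -[(_ <= _)%N]/(0 < _)%N lt0b.
  rewrite inE in ux; rewrite /branch ux -/(um w) umw /=.
  rewrite (marked_mono _ mb) ?subsetDl // (marked_mono _ mc) ?subsetDl //=.
  (* [b] is marked off the cluster of [x], so it lies outside that cluster, and with it the whole
     cluster of [b]. A connection from [b] to [c] would therefore survive removal of the explored
     edges. *)
  apply: contra nbc; apply: conn_off => // z bz; rewrite inE; apply/negP => xz.
  have bK : b \in cl inc w x.
    by rewrite inE; apply: conn_trans xz _; rewrite conn_sym.
  by move: mb; rewrite /offK (negbTE (marked_isolated inc_mk w bK)).
apply: le_trans (_ : \sum_K Ex p (F K) * (a - M ^+ 2 * \sum_(k in K) s k) <= _); last first.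
  by apply: ler_sum => K _; apply: ler_wpM2l => //; exact: two_arms_lb.
rewrite (eq_bigr (fun K => Ex p (F K) * a -
  M ^+ 2 * (Ex p (F K) * \sum_(k in K) s k))); last by move=> K _; ring.
rewrite sumrB -big_distrl -big_distrr /=.
have -> : \sum_K Ex p (F K) = unmarked_conn x u.
  rewrite -Ex_sum; apply: eq_Ex => w.
  rewrite (bigD1 (cl inc w x)) //= [X in _ + X]big1 ?addr0.
    by rewrite /F eqxx inE /= andbC.
  by move=> K /negbTE KK; rewrite /F eq_sym KK.
rewrite mulrC lerD2l lerN2; apply: ler_wpM2l; first exact: sqr_ge0.
apply: le_trans (_ : \sum_k Pr p (fun w => [&& conn inc w x u, conn inc w x k & um w]) * s k <= _).
  apply: le_trans (_ : Ex p (fun w => \sum_k [&& conn inc w x u, conn inc w x k & um w]%:R * s k) <= _).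
    apply: le_trans (_ : Ex p (fun w => \sum_K F K w * \sum_(k in K) s k) <= _).
      by rewrite Ex_sum; apply: ler_sum => K _; rewrite ExZr.
    apply: le_Ex => // w.
    rewrite (bigD1 (cl inc w x)) //= [X in _ + X <= _]big1 ?addr0 => [|K /negbTE KK]; last first.
      by rewrite /F eq_sym KK mul0r.
    rewrite /F eqxx /= inE big_mkcond big_distrr; apply: ler_sum => k _ /=.
    rewrite inE; case: (conn _ _ _ u); case: (conn _ _ _ k); case: (um w);
      by rewrite /= ?mul0r ?mulr0 ?mul1r.
  by rewrite Ex_sum; apply: ler_sum => k _; rewrite ExZr.
apply: le_trans (_ : \sum_k \sum_v unmarked_conn x v * (tau v u * tau v k) * s k <= _).
  apply: ler_sum => k _; rewrite -big_distrl ler_wpM2r //=.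
  apply: tree_graph => w w' ww'; apply: contra; exact: marked_mono.
rewrite exchange_big; apply: ler_sum => v _; rewrite big_distrr.
by apply: ler_sum => k _; rewrite -!mulrA.
Qed.

Variables (W : {set V}) (beta gamma : V -> V) (eps2 : R).
Hypothesis M1beta : forall u, u \in W -> M1 <= Mag (beta u).
Hypothesis M1gamma : forall u, u \in W -> M1 <= Mag (gamma u).
Hypothesis triangle1 : forall u, u \in W ->
  \sum_k \sum_v tau (beta u) v * tau v k * tau (gamma u) k <= eps.
Hypothesis triangle2 : forall v, \sum_(u in W) \sum_k
  tau v u * tau v k * (tau (beta u) k + tau (gamma u) k) <= eps2.

Let branch_sum_lb x :
  (M1 ^+ 2 - M ^+ 2 * eps) * (\sum_(u in W) unmarked_conn x u) -
  M ^+ 2 * eps2 * \sum_v unmarked_conn x v <=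
  \sum_(u in W) Pr p (fun w => branch w x u (beta u) (gamma u)).
Proof.
apply: le_trans (_ : \sum_(u in W) ((M1 ^+ 2 - M ^+ 2 * eps) * unmarked_conn x u -
  M ^+ 2 * \sum_v unmarked_conn x v *
    \sum_k tau v u * tau v k * (tau (beta u) k + tau (gamma u) k)) <= _); last first.
  apply: ler_sum => u uW.
  by apply: branch_lb; [exact: M1beta|exact: M1gamma|exact: triangle1].
rewrite sumrB -!big_distrr /= lerD2l lerN2 -mulrA.
apply: ler_wpM2l; first exact: sqr_ge0.
rewrite exchange_big big_distrr; apply: ler_sum => v _ /=.
by rewrite -big_distrr /= mulrC ler_wpM2r //; exact: Pr_ge0.
Qed.

Variables (bridge : V -> {set I}) (p0 : R) (l D : nat).
Hypothesis p0_ge0 : 0 <= p0.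
Hypothesis p0_le1 : p0 <= 1.
Hypothesis bridge_p0 : forall u i, u \in W -> i \in bridge u -> p0 <= p i.
Hypothesis bridge_beta : forall u, u \in W -> conn inc (bridge u) u (beta u).
Hypothesis bridge_gamma : forall u, u \in W -> conn inc (bridge u) u (gamma u).
Hypothesis bridge_conn : forall u i y z, u \in W -> i \in bridge u -> inc i y z ->
  conn inc (bridge u) u y.
Hypothesis bridge_mk : forall u v, u \in W -> mk v \notin bridge u.
Hypothesis bridge_card : forall u, u \in W -> (#|bridge u| <= l)%N.
Hypothesis bridge_meet : forall u, u \in W ->
  (#|[set u' in W | ~~ [disjoint bridge u & bridge u']]| <= D)%N.

Let joined x u w' := [exists w, (w :|: bridge u == w') && branch w x u (beta u) (gamma u)].

Let conn_keep w z y u (Y : {set I}) : u \in W -> bridge u \subset w -> Y \subset bridge u ->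
  ~~ conn inc w z u -> conn inc w z y -> conn inc (w :\: Y) z y.
Proof.
move=> uW uw Yu zu; apply: conn_setD => z' i y' zz' iY.
apply: contra zu => iz'; apply: conn_trans zz' _; rewrite conn_sym //.
by apply: (conn_mono uw); apply: bridge_conn iz' => //; exact: subsetP Yu _ iY.
Qed.

(* Were the bridges at [u1] and [u2] disjoint, closing the one at [u2] would
   leave [x] joined to one of the marked arms at [u1]. *)
Let joined_meet x u1 u2 w' : u1 \in W -> u2 \in W ->
  joined x u1 w' -> joined x u2 w' -> ~~ [disjoint bridge u1 & bridge u2].
Proof.
move=> W1 W2 /existsP[w1 /andP[/eqP e1 b1]] /existsP[w2 /andP[/eqP e2 b2]].
apply/negP => dis.
have key w3 w4 v1 v2 : v1 \in W -> v2 \in W -> [disjoint bridge v1 & bridge v2] ->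
    w3 :|: bridge v1 = w' -> w4 :|: bridge v2 = w' ->
    branch w3 x v1 (beta v1) (gamma v1) -> branch w4 x v2 (beta v2) (gamma v2) ->
    [/\ bridge v2 \subset w3, bridge v1 \subset w4 & w3 :\: bridge v2 \subset w4].
  move=> T1 T2 d12 f1 f2 _ _; split; apply/subsetP => i.
  - move=> it2; have : i \in w3 :|: bridge v1 by rewrite f1 -f2 inE it2 orbT.
    by rewrite inE (disjointFl d12) // orbF.
  - move=> it1; have : i \in w4 :|: bridge v2 by rewrite f2 -f1 inE it1 orbT.
    by rewrite inE (disjointFr d12) // orbF.
  - rewrite inE => /andP[it2 iw3].
    have : i \in w4 :|: bridge v2 by rewrite f2 -f1 inE iw3.
    by rewrite inE (negbTE it2) orbF.
have caseA w3 w4 v1 v2 : v1 \in W -> v2 \in W -> [disjoint bridge v1 & bridge v2] ->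
    w3 :|: bridge v1 = w' -> w4 :|: bridge v2 = w' ->
    branch w3 x v1 (beta v1) (gamma v1) -> branch w4 x v2 (beta v2) (gamma v2) ->
    conn inc w3 x v2.
  move=> T1 T2 d12 f1 f2 g1 g2; have [s21 s12 s1] := key _ _ _ _ T1 T2 d12 f1 f2 g1 g2.
  case/and5P: g1 => xt1 _ mb mc bc; case/and5P: g2 => _ xm2 _ _ _.
  apply: contraNT xm2 => xt2.
  have keep z y : ~~ conn inc w3 z v2 -> conn inc w3 z y -> conn inc w4 z y.
    by move=> zt zy; apply: conn_mono s1 _; exact: (@conn_keep _ _ _ v2).
  have keepm z : ~~ conn inc w3 z v2 -> marked inc mk w3 z -> marked inc mk w4 z.
    move=> zt /markedP[y zy yv1]; apply/markedP; exists y; first exact: keep.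
    by apply: subsetP s1 _ _; rewrite inE yv1 bridge_mk.
  have xt1' := keep _ _ xt2 xt1.
  (* The two arms are in different clusters of [w3], so at most one of them reaches [v2]; the mark
     of the other one survives in [w4]. *)
  have [bt|bt] := boolP (conn inc w3 (beta v1) v2).
    have ct : ~~ conn inc w3 (gamma v1) v2.
      apply: contra bc => ct; apply: conn_trans bt _; by rewrite conn_sym.
    apply: marked_conn (keepm _ ct mc); apply: conn_trans xt1' _.
    exact: conn_mono s12 (bridge_gamma T1).
  apply: marked_conn (keepm _ bt mb); apply: conn_trans xt1' _.
  exact: conn_mono s12 (bridge_beta T1).
have dis' : [disjoint bridge u2 & bridge u1] by rewrite disjoint_sym.
have xu2 := caseA _ _ _ _ W1 W2 dis e1 e2 b1 b2.
have xu1 := caseA _ _ _ _ W2 W1 dis' e2 e1 b2 b1.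
have [s21 s12 s1] := key _ _ _ _ W1 W2 dis e1 e2 b1 b2.
case/and5P: b1 => _ xm1 mb _ _; case/and5P: b2 => _ /negP xm2 _ _ _; apply: xm2.
(* In [w1] the unmarked [x] reaches [u2], so the marked arm at [u1] does not. Its mark persists in
   [w2], where [x] reaches [u1]: a contradiction. *)
have bt : ~~ conn inc w1 (beta u1) u2.
  apply: contra xm1 => bu2; apply: marked_conn mb.
  by apply: conn_trans xu2 _; rewrite conn_sym.
apply: marked_conn (conn_trans xu1 (conn_mono s12 (bridge_beta W1))) _.
case/markedP: mb => y by_ yw1; apply/markedP; exists y.
  by apply: conn_mono s1 _; exact: (@conn_keep _ _ _ u2).
by apply: subsetP s1 _ _; rewrite inE yw1 bridge_mk.
Qed.

(** Opening the bridge costs [p0 ^+ l] and marks [x]. All bridges that could have produced the same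
    configuration meet a given one, so there are at most [D] of them. *)
Let branch_sum_ub x :
  p0 ^+ l * \sum_(u in W) Pr p (fun w => branch w x u (beta u) (gamma u)) <=
  D%:R * Mag x.
Proof.
apply: le_trans (_ : \sum_(u in W) Pr p (joined x u) <= _).
  rewrite big_distrr; apply: ler_sum => u uW /=.
  apply: le_trans (_ : p0 ^+ #|bridge u| * Ex p (fun w => (joined x u (w :|: bridge u))%:R) <= _).
    apply: ler_pM; rewrite ?exprn_ge0 ?Pr_ge0 //.
      by apply: ler_wiXn2l => //; exact: bridge_card.
    apply: le_Pr => // w bw; apply/existsP; exists w; by rewrite eqxx.
  by apply: (Ex_open p01 (f := fun w => (joined x u w)%:R)) => // i; exact: bridge_p0.
rewrite -Ex_sum -ExZ; apply: le_Ex => // w.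
have [/existsP[u1 /andP[uW j1]]|] := boolP [exists u, (u \in W) && joined x u w];
    last first.
  rewrite negb_exists => /forallP H; rewrite big1 ?mulr_ge0 // => u uW.
  by have := H u; rewrite uW /= => /negbTE ->.
have -> : marked inc mk w x.
  case/existsP: j1 => w1 /andP[/eqP <- /and5P[xu _ mb _ _]].
  apply: (marked_conn (y := beta u1)); last by apply: marked_mono mb; exact: subsetUl.
  apply: (conn_trans (y := u1)); first by apply: conn_mono xu; exact: subsetUl.
  by apply: conn_mono (bridge_beta uW); exact: subsetUr.
rewrite mulr1; apply: le_trans (_ : #|[set u' in W | ~~ [disjoint bridge u1 & bridge u']]|%:R <= _);
  last by rewrite ler_nat bridge_meet.
rewrite -natr_sum ler_nat -sum1_card big_mkcond [leqRHS]big_mkcond.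
apply: leq_sum => u _; rewrite inE; case: ifP => //= uW'.
by case j2: (joined x u w); rewrite // (joined_meet uW uW' j1 j2).
Qed.

(** Read with [M1] close to [M] and [eps], [eps2] small: the square of the magnetization times the
    susceptibility is at most a constant times the magnetization at [x]. Separate bounds [M1] and
    [M] are kept because magnetizations vary over a finite box. *)
Lemma magnetization_inequality x :
  p0 ^+ l * ((M1 ^+ 2 - M ^+ 2 * eps) * (\sum_(u in W) unmarked_conn x u) -
  M ^+ 2 * eps2 * \sum_v unmarked_conn x v) <= D%:R * Mag x.
Proof.
apply: le_trans (branch_sum_ub x); apply: ler_wpM2l; first exact: exprn_ge0.
exact: branch_sum_lb.
Qed.

End Diagrams.

(** * Boxes and dyadic kernels *)

Section Norm.
Variable d : nat.
Implicit Types (a b x y z : vertex d) (N r : nat).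

Lemma normooP x N : reflect (forall i, `|x ord0 i| <= N)%N (normoo x <= N)%N.
Proof. by rewrite /normoo; apply: (iffP (@bigop.bigmax_leqP _ _ _ _)) => H i *; apply: H. Qed.

Let vD x y i : (x + y) ord0 i = x ord0 i + y ord0 i. Proof. by rewrite mxE. Qed.

Lemma normooD x y : (normoo (x + y)%R <= normoo x + normoo y)%N.
Proof.
apply/normooP => i; rewrite vD.
have /normooP/(_ i) := leqnn (normoo x); have /normooP/(_ i) := leqnn (normoo y).
by lia.
Qed.

Lemma normooN x : normoo (- x) = normoo x.
Proof. by apply: eq_bigr => i _; rewrite mxE abszN. Qed.

Lemma normoo0 : normoo (0 : vertex d) = 0%N.
Proof. by apply/eqP; rewrite -leqn0; apply/normooP => i; rewrite mxE. Qed.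

Lemma normoo_eq0 x : (normoo x == 0%N) = (x == 0).
Proof.
apply/eqP/eqP => [x0|->]; last exact: normoo0.
apply/rowP => i; rewrite mxE; apply/eqP; rewrite -absz_eq0 -leqn0.
by move: i; apply/normooP; rewrite x0.
Qed.

Lemma normoo_delta (i : 'I_d) : normoo (delta_mx ord0 i : vertex d) = 1%N.
Proof.
apply/eqP; rewrite eqn_leq; apply/andP; split.
  by apply/normooP => j; rewrite mxE eqxx /=; case: eqP.
rewrite -[1%N]/(`|1%:Z|%N); have := leqnn (normoo (delta_mx ord0 i : vertex d)).
by move/normooP => /(_ i); rewrite mxE !eqxx.
Qed.

Lemma norm1_adj x y : norm1 (x - y) = 1%N <->
  exists i : 'I_d, x = y + delta_mx ord0 i \/ y = x + delta_mx ord0 i.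
Proof.
split=> [H|[i [->|->]]]; last 2 first.
- rewrite addrC addKr /norm1 (bigD1 i) //= mxE !eqxx big1 // => j ji.
  by rewrite mxE (negbTE ji) andbF.
- rewrite opprD addNKr /norm1 (bigD1 i) //= !mxE !eqxx big1 // => j ji.
  by rewrite !mxE (negbTE ji) andbF.
have [z zE] : exists z : vertex d, z = x - y by exists (x - y).
rewrite -zE in H.
have [i i1] : exists i, z ord0 i != 0.
  apply/existsP; rewrite -negb_forall; apply/negP => /forallP H0.
  by move: H; rewrite /norm1 big1 // => i _; rewrite (eqP (H0 i)).
have {}i1 : (0 < `|z ord0 i|)%N by rewrite lt0n absz_eq0.
move: H; rewrite /norm1 (bigD1 i) //= => H.
have xi : `|z ord0 i|%N = 1%N.
  by move: H i1; lia.
have xj j : j != i -> z ord0 j = 0.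
  move=> ji; apply/eqP; rewrite -absz_eq0 -leqn0.
  move: H; rewrite xi (bigD1 j) //=; lia.
have dE (c : int) : z ord0 i = c -> z = c *: delta_mx ord0 i.
  move=> ci; apply/rowP => j; rewrite [RHS]mxE [in RHS]mxE eqxx /=.
  by have [->|ji] := eqVneq j i; rewrite ?mulr1 ?mulr0 // xj.
exists i; have [xi1|xi1] : z ord0 i = 1 \/ z ord0 i = -1 by lia.
  by left; apply/eqP; rewrite addrC -subr_eq -zE (dE _ xi1) scale1r.
right; apply/eqP; rewrite addrC -subr_eq -opprB -zE (dE _ xi1) scaleN1r.
by rewrite opprK.
Qed.

Lemma norm1_normoo x y : norm1 (x - y) = 1%N -> (normoo y <= (normoo x).+1)%N.
Proof.
move=> /norm1_adj[i [->|->]]; last first.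
  by apply: leq_trans (normooD _ _) _; rewrite normoo_delta addn1.
rewrite -[y in normoo y](addrK (delta_mx ord0 i)).
by apply: leq_trans (normooD _ _) _; rewrite normooN normoo_delta addn1.
Qed.

End Norm.

Section Box.
Variables (d N : nat).

Definition bvertex := {ffun 'I_d -> 'I_(N.*2.+1)}.

(** An edge is given by its lower end and its direction; an index pointing out of the box is
    incident to no pair. *)
Definition bedge := (bvertex * 'I_d)%type.

Definition pos (x : bvertex) : vertex d := \row_i ((x i)%:Z - N%:Z).

(** Inverse of [pos] on the box; outside the box its value is meaningless. *)
Definition pt (x : vertex d) : bvertex := [ffun i => inord `|x ord0 i + N%:Z|].

Definition binc (e : bedge) (x y : bvertex) :=
  ((x == e.1) && (pos y == pos e.1 + delta_mx ord0 e.2)) ||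
  ((y == e.1) && (pos x == pos e.1 + delta_mx ord0 e.2)).

Lemma ptK x : (normoo x <= N)%N -> pos (pt x) = x.
Proof.
move=> /normooP xN; apply/rowP => i; rewrite mxE ffunE inordK.
  have -> : x 0 i = x ord0 i by congr (x _ i); exact: val_inj.
  by have := xN i; lia.
by have := xN i; lia.
Qed.

Lemma normoo_pos x : (normoo (pos x) <= N)%N.
Proof. by apply/normooP => i; rewrite mxE; have := ltn_ord (x i); lia. Qed.

Lemma pos_inj : injective pos.
Proof.
move=> x y xy; apply/ffunP => i; apply/val_inj/eqP; rewrite -eqz_nat.
by move/rowP/(_ i): xy; rewrite !mxE => /addIr ->.
Qed.

Lemma posK : cancel pos pt.
Proof. by move=> x; apply: pos_inj; rewrite ptK ?normoo_pos. Qed.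

Lemma binc_sym e x y : binc e x y = binc e y x.
Proof. by rewrite /binc orbC. Qed.

Lemma binc_uniq e x y x' y' : binc e x y -> binc e x' y' ->
  (x' = x /\ y' = y) \/ (x' = y /\ y' = x).
Proof.
rewrite /binc; move=> /orP[]/andP[/eqP -> /eqP yE] /orP[]/andP[/eqP -> /eqP yE'];
  have := etrans yE (esym yE') => /pos_inj ->; by [left|right].
Qed.

Lemma binc_norm1 e x y : binc e x y -> norm1 (pos x - pos y) = 1%N.
Proof.
rewrite /binc => /orP[]/andP[/eqP -> /eqP ->]; apply/norm1_adj; exists e.2.
  by right.
by left.
Qed.

Lemma card_bvertex : #|bvertex| = (N.*2.+1 ^ d)%N.
Proof. by rewrite card_ffun !card_ord. Qed.

End Box.

Lemma card_ball d N (a : vertex d) r :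
  (#|[set y : bvertex d N | (normoo (a - pos y)%R <= r)%N]| <= r.*2.+1 ^ d)%N.
Proof.
rewrite -card_bvertex -(card_in_imset (f := fun y => pt r (a - pos y))).
  exact: max_card.
move=> x y; rewrite !inE => xr yr /(congr1 (@pos _ _)).
by rewrite !ptK // => /addrI/oppr_inj/pos_inj.
Qed.

(** * Ghost marks added to a finite random graph *)

Section Ghost.
Variables (R : realFieldType) (V I : finType) (inc : I -> V -> V -> bool).
Variables (p : I -> R) (h : R).

Definition ginc (i : I + V) x y :=
  match i with inl e => inc e x y | inr v => (x == v) && (y == v) end.

Definition gprob (i : I + V) : R := match i with inl e => p e | inr _ => h end.

Lemma ginc_sym : (forall i x y, inc i x y = inc i y x) ->
  forall i x y, ginc i x y = ginc i y x.
Proof. by move=> isym [e|v] x y //=; rewrite andbC. Qed.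

Lemma ginc_uniq : (forall i x y x' y', inc i x y -> inc i x' y' ->
    (x' = x /\ y' = y) \/ (x' = y /\ y' = x)) ->
  forall i x y x' y', ginc i x y -> ginc i x' y' ->
    (x' = x /\ y' = y) \/ (x' = y /\ y' = x).
Proof.
move=> iuniq [e|v] x y x' y' /=; first exact: iuniq.
by move=> /andP[/eqP -> /eqP ->] /andP[/eqP -> /eqP ->]; left.
Qed.

Lemma gconn (w : {set I + V}) x y : conn ginc w x y = conn inc (inl @^-1: w) x y.
Proof.
apply/idP/idP; move: y; apply: conn_ind => [|y z _ xy /adjP[]]; try exact: conn0.
  move=> [e|v] iw /=; last by move=> /andP[/eqP yv /eqP ->]; rewrite -yv.
  by move=> eyz; apply: (conn_adj xy); apply/adjP; exists e => //; rewrite inE.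
move=> e; rewrite inE => ew eyz; apply: (conn_adj xy).
by apply/adjP; exists (inl e).
Qed.

Lemma Ex_edges (f : {set I} -> R) :
  Ex gprob (fun w => f (inl @^-1: w)) = Ex p f.
Proof. by rewrite Ex_marginal //; exact: inl_inj. Qed.

Let no_mark (K : {set V}) :
  Ex gprob (fun w => [forall v in K, inr v \notin w]%:R) = (1 - h) ^+ #|K|.
Proof.
pose f (w : {set V}) : R := [forall v in K, v \notin w]%:R.
transitivity (Ex (gprob \o inr) f).
  rewrite -(@Ex_marginal _ _ _ inr gprob (@inr_inj _ _) f); apply: eq_Ex => w.
  congr (_%:R); congr nat_of_bool; apply: eq_forallb => v; by rewrite !inE.
transitivity (\prod_v ((if v \in K then 0 else h) + (1 - h))).
  rewrite bigA_distr; apply: eq_bigr => w _.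
  rewrite /f; case: (boolP [forall v in K, v \notin w]) => [/forallP H|]; last first.
    rewrite mulr0 negb_forall => /existsP[v].
    rewrite negb_imply negbK => /andP[vK vw].
    by rewrite (bigD1 v) //= vw vK mul0r.
  rewrite mulr1; apply: eq_bigr => v _; case: ifP => // vw.
  by have /implyP := H v; rewrite vw; case: (v \in K) => // /(_ isT).
rewrite (bigID (mem K)) /= [X in _ * X]big1 ?mulr1 => [|v /negbTE ->]; last first.
  by rewrite addrC subrK.
rewrite (eq_bigr (fun=> 1 - h)) ?prodr_const // => v ->; by rewrite add0r.
Qed.

(** Given the edges, [x] is unmarked when none of the independent marks on its cluster is present.
    This turns statements on marks into moments of the cluster size. *)
Lemma Ex_unmarked (f : {set I} -> R) x :
  Ex gprob (fun w => f (inl @^-1: w) * (~~ marked ginc inr w x)%:R) =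
  Ex p (fun w => f w * (1 - h) ^+ #|cl inc w x|).
Proof.
pose F K (w : {set I}) := f w * (cl inc w x == K)%:R.
transitivity (Ex gprob (fun w => \sum_(K : {set V})
    F K (inl @^-1: w) * [forall v in K, inr v \notin w]%:R)).
  apply: eq_Ex => w; rewrite (bigD1 (cl inc (inl @^-1: w) x)) //= big1 ?addr0.
    rewrite /F eqxx mulr1; congr (_ * _%:R); congr nat_of_bool.
    rewrite negb_exists; apply: eq_forallb => v.
    by rewrite negb_and gconn inE implybE.
  by move=> K /negbTE KK; rewrite /F eq_sym KK mulr0 mul0r.
transitivity (Ex p (fun w => \sum_(K : {set V}) F K w * (1 - h) ^+ #|K|)).
  rewrite !Ex_sum; apply: eq_bigr => K _.
  rewrite (@Ex_indep _ _ gprob [set i | if i is inl _ then true else false]) /=.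
  - by rewrite Ex_edges no_mark ExZr.
  - by move=> w; congr (F K _); apply/setP => e; rewrite !inE andbT.
  - move=> w; congr (_%:R); congr nat_of_bool; apply: eq_forallb => v.
    by rewrite !inE.
apply: eq_Ex => w; rewrite (bigD1 (cl inc w x)) //= big1 ?addr0.
  by rewrite /F eqxx mulr1.
by move=> K /negbTE KK; rewrite /F eq_sym KK mulr0 mul0r.
Qed.

End Ghost.

Lemma sum_bool (T : finType) (P : pred T) : (\sum_u P u = #|[set u | P u]|)%N.
Proof.
by rewrite cardsE -sum1_card [RHS]big_mkcond; apply: eq_bigr.
Qed.

(* The power law |z|^(-s) is replaced by a sum over dyadic scales of indicators
   of balls: convolutions then reduce to counting points and to geometric sums. *)
Section DyadicKernel.
Variables (R : realFieldType) (J : nat).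

Definition kap s j : R := 2^-1 ^+ (s * j).

(** Of order [|z|^(-s)] up to distance about [2^J]. The shift [m] enlarges all balls by the factor
    [2^m]; it absorbs the triangle inequality in convolutions. *)
Definition ker d s m (z : vertex d) : R :=
  \sum_(j < J) kap s j * (normoo z <= 2 ^ (j + m))%N%:R.

Lemma kap_ge0 s j : 0 <= kap s j.
Proof. by rewrite /kap exprn_ge0 ?invr_ge0 ?ler0n. Qed.

Lemma kapK s j : kap s j * 2 ^+ (s * j) = 1.
Proof. by rewrite /kap -exprMn mulVf ?expr1n // pnatr_eq0. Qed.

Lemma kapD s t j : kap (s + t) j = kap s j * kap t j.
Proof. by rewrite /kap mulnDl exprD. Qed.

Lemma ker_ge0 d s m (z : vertex d) : 0 <= ker s m z.
Proof. by apply: sumr_ge0 => j _; rewrite mulr_ge0 ?kap_ge0. Qed.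

Lemma kerN d s m (z : vertex d) : ker s m (- z) = ker s m z.
Proof. by apply: eq_bigr => j _; rewrite normooN. Qed.

(** The terms grow like [2^(a i)] up to [i = n] and decay geometrically beyond, so the term at [n]
    dominates; the two ranges contribute 1 and 2 to the factor 3. *)
Lemma kap_sum n s a d K : (s + a)%N = d -> (0 < s)%N -> (0 < a)%N ->
  \sum_(i < K) kap s i * 2 ^+ (d * minn i n) <= 3 * 2 ^+ (a * n).
Proof.
move=> sad s0 a0.
have e2 k : 0 < 2 ^+ k :> R by rewrite exprn_gt0.
have below k : (k <= n)%N ->
    \sum_(i < k) kap s i * 2 ^+ (d * minn i n) <= 2 ^+ (a * k) :> R.
  elim: k => [|k IH] kn; first by rewrite big_ord0 ltW.
  rewrite big_ord_recr /=; have {}IH := IH (ltnW kn).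
  have -> : minn k n = k by lia.
  rewrite -sad mulnDl exprD mulrA kapK mul1r.
  have : 2 * 2 ^+ (a * k) <= 2 ^+ (a * k.+1) :> R.
    by rewrite -exprS ler_weXn2l ?ler1n // mulnS; lia.
  by rewrite -sad in IH; lra.
have above k : \sum_(i < n + k) kap s i * 2 ^+ (d * minn i n) <=
    2 ^+ (a * n) * (3 - 2 * 2^-1 ^+ k) :> R.
  elim: k => [|k IH].
    by rewrite addn0 (le_trans (below n (leqnn n))) // expr0; have := e2 (a * n)%N; lra.
  rewrite addnS big_ord_recr /=.
  have -> : minn (n + k) n = n by lia.
  have kE : kap s (n + k) * 2 ^+ (d * n) = 2 ^+ (a * n) * 2^-1 ^+ (s * k).
    by rewrite /kap mulnDr exprD -sad mulnDl exprD mulrACA kapK mul1r mulrC.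
  have : 2^-1 ^+ (s * k) <= 2^-1 ^+ k :> R.
    apply: ler_wiXn2l; [by lra|by lra|by rewrite leq_pmull].
  move=> /(ler_wpM2l (ltW (e2 (a * n)%N))).
  rewrite kE exprS; move: IH; set S := \sum_(_ < _) _; move=> IH H.
  have -> : 2 * (2^-1 * 2^-1 ^+ k) = 2^-1 ^+ k :> R by rewrite mulrA divff ?mul1r ?pnatr_eq0.
  by move: IH H; rewrite !mulrBr; lra.
have [Kn|nK] := leqP K n.
  apply: le_trans (below K Kn) _.
  have : 2 ^+ (a * K) <= 2 ^+ (a * n) :> R by rewrite ler_weXn2l ?ler1n // leq_mul2l Kn orbT.
  by have := e2 (a * n)%N; lra.
have := above (K - n)%N; rewrite subnKC ?(ltnW nK) // => /le_trans; apply.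
rewrite [leRHS]mulrC; apply: ler_wpM2l; first exact: ltW.
by rewrite gerBl mulr_ge0 ?exprn_ge0 ?invr_ge0 ?ler0n.
Qed.

Definition cball d m : R := ((3 * 2 ^ m) ^ d)%N%:R.

Let count2 d N (x y : vertex d) i j m :
  \sum_(u : bvertex d N) ((normoo (x - pos u)%R <= 2 ^ (i + m))%N &&
      (normoo (y - pos u)%R <= 2 ^ (j + m))%N)%:R
  <= cball d m * 2 ^+ (d * minn i j) :> R.
Proof.
rewrite -natr_sum /cball -[2]/(2%:R) -natrX -natrM ler_nat mulnC.
have -> : (2 ^ (d * minn i j) * (3 * 2 ^ m) ^ d = (3 * 2 ^ (minn i j + m)) ^ d)%N.
  by rewrite (mulnC d) expnM -expnMn expnD mulnCA.
have H (z : vertex d) r k : (r <= k)%N ->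
    (#|[set u : bvertex d N | (normoo (z - pos u)%R <= 2 ^ r)%N]| <= (3 * 2 ^ k) ^ d)%N.
  move=> rk; apply: leq_trans (card_ball _ _ _) _.
  case: (d) => [|d']; first by rewrite !expn0.
  rewrite leq_exp2r //; have : (2 ^ r <= 2 ^ k)%N by rewrite leq_exp2l.
  by have : (0 < 2 ^ r)%N; [rewrite expn_gt0|lia].
have [ij|ij] := leqP i j.
  apply: leq_trans (H x (i + m)%N _ (leqnn _)); rewrite sum_bool.
  by apply: subset_leq_card; apply/subsetP => u; rewrite !inE => /andP[].
apply: leq_trans (H y (j + m)%N _ (leqnn _)); rewrite sum_bool.
by apply: subset_leq_card; apply/subsetP => u; rewrite !inE => /andP[].
Qed.

Let cball_ge0 d m : 0 <= cball d m. Proof. exact: ler0n. Qed.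

(** The convolution of the powers [-s] and [-t] has power [-(s + t - d)]; the equations state
    [r = s + t - d] without subtraction. The factor 6 collects twice the 3 of [kap_sum], according
    to which of the two scales carries the distance between [x] and [y]. *)
Lemma ker_conv d N s a t b r m (x y : vertex d) :
  (s + a = d)%N -> (t + b = d)%N -> (r + a = t)%N ->
  (0 < s)%N -> (0 < a)%N -> (0 < t)%N -> (0 < b)%N ->
  \sum_(u : bvertex d N) ker s m (x - pos u) * ker t m (y - pos u) <=
  6 * cball d m * ker r m.+1 (x - y).
Proof.
move=> sad tbd rat s0 a0 t0 b0.
have rbs : (r + b = s)%N by lia.
pose X j : R := (normoo (x - y)%R <= 2 ^ (j + m.+1))%N%:R.
have X0 j : 0 <= X j by [].
have k0 := kap_ge0.
(* If balls of scales [i] and [j] share a point, [x - y] is within twice the larger radius;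
   [X i + X j] bounds this indicator and splits the double sum. *)
apply: le_trans (_ : \sum_(i < J) \sum_(j < J) kap s i * kap t j *
    ((X i + X j) * (cball d m * 2 ^+ (d * minn i j))) <= _).
  rewrite (eq_bigr (fun u : bvertex d N => \sum_(i < J) \sum_(j < J) kap s i * kap t j *
      ((normoo (x - pos u)%R <= 2 ^ (i + m))%N &&
      (normoo (y - pos u)%R <= 2 ^ (j + m))%N)%:R)); last first.
    move=> u _; rewrite big_distrl; apply: eq_bigr => i _ /=; rewrite big_distrr.
    by apply: eq_bigr => j _; rewrite -mulnb natrM /=; ring.
  rewrite exchange_big; apply: ler_sum => i _ /=.
  rewrite exchange_big; apply: ler_sum => j _ /=.
  rewrite -big_distrr /=; apply: ler_wpM2l; first by rewrite mulr_ge0.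
  apply: le_trans (ler_wpM2l (addr_ge0 (X0 i) (X0 j)) (count2 N x y i j m)).
  rewrite big_distrr; apply: ler_sum => u _ /=.
  case: andP => [[xu yu]|_]; last by rewrite mulr0.
  rewrite mulr1 /X.
  have : (normoo (x - y)%R <= 2 ^ (i + m) + 2 ^ (j + m))%N.
    have -> : x - y = (x - pos u) - (y - pos u) by rewrite opprB addrA subrK.
    by apply: leq_trans (normooD _ _) _; rewrite normooN leq_add.
  have [ij|ij] := leqP i j => H.
    rewrite -[leLHS]add0r lerD // ler1n lt0b (leq_trans H) //.
    by rewrite addnS expnS mul2n -addnn leq_add2r leq_exp2l // leq_add2r.
  rewrite -[leLHS]addr0 lerD // ler1n lt0b (leq_trans H) //.
  by rewrite addnS expnS mul2n -addnn leq_add2l leq_exp2l // leq_add2r ltnW.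
have half s' t' a' r' b' : (s' + a' = d)%N -> (t' + b' = d)%N -> (r' + a' = t')%N ->
    (0 < s')%N -> (0 < a')%N ->
    \sum_(j < J) \sum_(i < J) kap s' i * kap t' j * (X j * (cball d m * 2 ^+ (d * minn i j)))
    <= 3 * cball d m * ker r' m.+1 (x - y).
  move=> sad' tbd' rat' s0' a0'; rewrite /ker big_distrr; apply: ler_sum => j _ /=.
  rewrite (eq_bigr (fun i : 'I_J => kap t' j * X j * cball d m *
    (kap s' i * 2 ^+ (d * minn i j)))); last by move=> i _; ring.
  rewrite -big_distrr /=.
  have c0 : 0 <= kap t' j * X j * cball d m by rewrite !mulr_ge0.
  apply: le_trans (ler_wpM2l c0 (kap_sum j J sad' s0' a0')) _.
  rewrite -rat' kapD le_eqVlt; apply/orP; left; apply/eqP; rewrite -/(X j).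
  transitivity (3 * cball d m * (kap r' j * X j) * (kap a' j * 2 ^+ (a' * j))).
    by ring.
  by rewrite kapK mulr1.
have -> : \sum_(i < J) \sum_(j < J) kap s i * kap t j *
    ((X i + X j) * (cball d m * 2 ^+ (d * minn i j))) =
  \sum_(j < J) \sum_(i < J) kap s i * kap t j * (X j * (cball d m * 2 ^+ (d * minn i j))) +
  \sum_(j < J) \sum_(i < J) kap t i * kap s j * (X j * (cball d m * 2 ^+ (d * minn i j))).
  rewrite [X in _ = X + _]exchange_big -big_split; apply: eq_bigr => i _ /=.
  rewrite -big_split; apply: eq_bigr => j _ /=; rewrite [minn j i]minnC; ring.
have h1 := half s t a r b sad tbd rat s0 a0.
have h2 := half t s b r a tbd sad rbs t0 b0.
by lra.
Qed.

Lemma ker_ball d N s a m n (x c : vertex d) :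
  (s + a = d)%N -> (0 < s)%N -> (0 < a)%N ->
  \sum_(u : bvertex d N | (normoo (c - pos u)%R <= 2 ^ n)%N) ker s m (x - pos u) <=
  3 * cball d m * 2 ^+ (a * n).
Proof.
move=> sad s0 a0; rewrite exchange_big /=.
apply: le_trans (_ : \sum_(j < J) cball d m * (kap s j * 2 ^+ (d * minn j n)) <= _).
  apply: ler_sum => j _; rewrite -big_distrr /= mulrCA.
  apply: ler_wpM2l; first exact: kap_ge0.
  apply: le_trans (count2 N x c j n m); rewrite big_mkcond; apply: ler_sum => u _.
  case: ifP => [cu|_]; last exact: ler0n.
  rewrite [X in _ <= X](_ : _ = ((normoo (x - pos u)%R <= 2 ^ (j + m))%N)%:R) //.
  have -> : (normoo (c - pos u)%R <= 2 ^ (n + m))%N.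
    by apply: leq_trans cu _; rewrite leq_exp2l // leq_addr.
  by rewrite andbT.
rewrite -big_distrr /= [3 * _]mulrC -mulrA; apply: ler_wpM2l => //.
exact: kap_sum.
Qed.

(** A decay of order [2^-n], whatever the exponent [r >= 1]. Applied with [r = d - 6], it makes the
    open triangle small. *)
Lemma ker_far d r m n (z : vertex d) : (0 < r)%N -> (2 ^ n <= normoo z)%N ->
  ker r m z <= 2 * 2 ^+ m * 2^-1 ^+ n.
Proof.
move=> r0 nz; rewrite /ker.
have e2 k : 0 < 2^-1 ^+ k :> R by rewrite exprn_gt0 // invr_gt0 ltr0n.
have H K : \sum_(j < K) kap r j * (normoo z <= 2 ^ (j + m))%N%:R +
    (n <= K + m)%N%:R * (2 * 2^-1 ^+ K) <= 2 * 2 ^+ m * 2^-1 ^+ n.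
  elim: K => [|K IH].
    rewrite big_ord0 add0r add0n expr0 mulr1.
    case: (leqP n m) => nm; rewrite /= ?mul1r ?mul0r.
      rewrite -mulrA -[leLHS]mulr1 ler_wpM2l // -(subnK nm) exprD -mulrA.
      by rewrite -exprMn divff ?pnatr_eq0 // ?expr1n ?mulr1 // exprn_ege1 // ler1n.
    by rewrite !mulr_ge0 ?exprn_ge0 ?invr_ge0 ?ler0n.
  rewrite big_ord_recr /=; case: (leqP n (K + m)) IH => nK IH.
    rewrite (leq_trans nK) ?addSn // mul1r exprS mulrA divff ?mul1r ?pnatr_eq0 //.
    move: IH; rewrite mul1r.
    have : kap r K * (normoo z <= 2 ^ (K + m))%N%:R <= 2^-1 ^+ K.
      apply: le_trans (_ : kap r K <= _).
        by rewrite -[leRHS]mulr1 ler_wpM2l ?kap_ge0 // lern1 leq_b1.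
      by apply: ler_wiXn2l; [lra|lra|rewrite leq_pmull].
    by set S := \sum_(_ < _) _; lra.
  have -> : (normoo z <= 2 ^ (K + m))%N = false.
    apply/negbTE; rewrite -ltnNge; apply: leq_trans nz.
    by rewrite ltn_exp2l.
  move: IH; rewrite mulr0 mul0r !addr0 => IH.
  case: (leqP n (K.+1 + m)) => nK'; rewrite /= ?mul0r ?addr0 // mul1r.
  have nE : n = (K.+1 + m)%N by move: nK nK'; lia.
  have S0 : \sum_(j < K) kap r j * (normoo z <= 2 ^ (j + m))%N%:R = 0.
    apply: big1 => j _; have -> : (normoo z <= 2 ^ (j + m))%N = false.
      apply/negbTE; rewrite -ltnNge; apply: leq_trans nz.
      by rewrite ltn_exp2l // nE; have := ltn_ord j; lia.
    by rewrite mulr0.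
  rewrite S0 add0r nE addnC exprD -mulrA [2 ^+ m * _]mulrA -exprMn divff ?pnatr_eq0 // ?expr1n ?mul1r //.
have := H J; have : 0 <= (n <= J + m)%N%:R * (2 * 2^-1 ^+ J) :> R.
  by rewrite !mulr_ge0 // ltW.
by set S := \sum_(_ < _) _; lra.
Qed.

Lemma ker_center d s m : (0 < J)%N -> 1 <= ker s m (0 : vertex d).
Proof.
move=> J0; rewrite /ker; case: J J0 => // J' _; rewrite big_ord_recl /=.
rewrite normoo0 /kap muln0 expr0 mulr1 lerDl.
by apply: sumr_ge0 => j _; rewrite mulr_ge0 ?exprn_ge0 ?invr_ge0 ?ler0n.
Qed.

Lemma ker_lb d s (z : vertex d) : (0 < normoo z)%N -> (normoo z <= 2 ^ J.-1)%N ->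
  (0 < J)%N -> ((normoo z)%:R ^+ s)^-1 <= 2 ^+ s * ker s 0 z.
Proof.
move=> z0 zJ J0; pose j := up_log 2 (normoo z).
have jJ : (j < J)%N.
  by have := up_log_min (isT : 1 < 2)%N zJ; rewrite -/j; move: J0; lia.
have zj : (normoo z <= 2 ^ j)%N by apply: up_logP.
have jz : (2 ^ j <= 2 * normoo z)%N.
  have [z1|z1] := leqP (normoo z) 1.
    have zE : normoo z = 1%N by apply/eqP; rewrite eqn_leq z1.
    by rewrite /j zE up_log1.
  have j0 : (0 < j)%N by rewrite up_log_gt0.
  have := up_log_gtn (isT : 1 < 2)%N z1; rewrite -/j.
  by rewrite -[X in (_ -> 2 ^ X <= _)%N](prednK j0) expnS leq_pmul2l // => /ltnW.
apply: le_trans (_ : 2 ^+ s * kap s j <= _); last first.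
  rewrite ler_wpM2l ?exprn_ge0 // /ker (bigD1 (Ordinal jJ)) //= addn0 zj mulr1 lerDl.
  by apply: sumr_ge0 => i _; rewrite mulr_ge0 ?kap_ge0.
have n0 : 0 < (normoo z)%:R ^+ s :> R by rewrite exprn_gt0 // ltr0n.
rewrite -[leLHS]mul1r ler_pdivrMr //.
have : 2 ^+ (s * j) <= 2 ^+ s * (normoo z)%:R ^+ s :> R.
  rewrite mulnC exprM -exprMn lerXn2r ?nnegrE ?mulr_ge0 ?exprn_ge0 ?ler0n //.
  by rewrite -natrX -natrM ler_nat.
move=> /(ler_wpM2l (kap_ge0 s j)); rewrite kapK.
by rewrite [2 ^+ s * kap _ _]mulrC -mulrA.
Qed.

End DyadicKernel.

(** * Volume tail below the critical point *)

Section Powers.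
Variable R : realFieldType.
Implicit Types (x h : R) (s n m : nat).

(** Layer-cake formula: the magnetization becomes a combination of volume tails, and cutting at [n]
    keeps only tails that a bounded neighbourhood decides. *)
Lemma one_sub_expn_layers h n s : 0 <= h <= 1 ->
  \sum_(i < n) h * (1 - h) ^+ i * (i < s)%N%:R = 1 - (1 - h) ^+ minn n s.
Proof.
move=> _; elim: n => [|n IH]; first by rewrite big_ord0 min0n expr0 subrr.
rewrite big_ord_recr /= IH; have [ns|sn] : (n < s \/ s <= n)%N by lia.
  by rewrite (minn_idPl (ltnW ns)) (minn_idPl ns) exprS ns mulr1; ring.
by rewrite (minn_idPr sn) (minn_idPr (leqW sn)) [(n < s)%N]ltnNge sn mulr0 addr0.
Qed.

Lemma bernoulli_ineq x n : 0 <= x -> 1 + n%:R * x <= (1 + x) ^+ n.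
Proof.
move=> x0; elim: n => [|n IH]; first by rewrite mul0r addr0 expr0.
rewrite exprS mulrDl mul1r -[n.+1%:R]natr1 mulrDl mul1r.
have : x <= x * (1 + x) ^+ n.
  by rewrite ler_peMr // exprn_ege1 // lerDl.
by lra.
Qed.

Lemma expr_one_sub_le h n : 0 <= h <= 1 -> (1 - h) ^+ n * (1 + n%:R * h) <= 1.
Proof.
move=> /andP[h0 h1]; apply: le_trans (_ : (1 - h) ^+ n * (1 + h) ^+ n <= _).
  by rewrite ler_wpM2l ?bernoulli_ineq // exprn_ge0 // subr_ge0.
rewrite -exprMn exprn_ile1 //; first by rewrite mulr_ge0 ?subr_ge0 ?addr_ge0.
by have := sqr_ge0 h; rewrite expr2; lra.
Qed.

(** Clusters with more than [2k] vertices add at most 1 to the susceptibility in the field. With [t]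
    the half of [s], [(1 - h)^t] is at most [1 / (1 + t h)], and [s <= (1 + t h)^2]. *)
Lemma natr_expr_bounded h k s : 0 < h <= 1 -> 2 <= k%:R * h ^+ 2 -> (k.*2 < s)%N ->
  s%:R * (1 - h) ^+ s <= 1.
Proof.
move=> /andP[h0 h1] kh ks; have h01 : 0 <= h <= 1 by rewrite ltW.
set t := s./2; have kt : (k <= t)%N by rewrite /t; lia.
have b0 : 0 <= 1 - h by rewrite subr_ge0.
have st : s%:R <= 1 + 2 * t%:R :> R by rewrite -natrM nat1r ler_nat /t; lia.
have th : 2 <= t%:R * h ^+ 2.
  by apply: le_trans kh _; rewrite ler_wpM2r ?sqr_ge0 // ler_nat.
set x := t%:R * h; have x0 : 0 <= x by rewrite mulr_ge0 ?ler0n // ltW.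
have sx : s%:R <= (1 + x) ^+ 2.
  have : 2 * t%:R <= x * x.
    have := ler_wpM2l (ler0n R t) th; rewrite /x expr2; lra.
  by rewrite expr2; lra.
have ax := expr_one_sub_le t h01; rewrite -/x in ax.
have a0 : 0 <= (1 - h) ^+ t by exact: exprn_ge0.
apply: le_trans (_ : (1 + x) ^+ 2 * ((1 - h) ^+ t) ^+ 2 <= _).
  apply: ler_pM; rewrite ?ler0n ?exprn_ge0 //.
  rewrite -exprM; apply: ler_wiXn2l => //; first by rewrite gerBl ltW.
  by rewrite /t; lia.
rewrite -exprMn mulrC exprn_ile1 // mulr_ge0 //.
by rewrite addr_ge0.
Qed.

(** Convexity of [(1 - x)^s] at the midpoint of 0 and [h]. *)
Lemma half_convex h s : 0 <= h <= 1 ->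
  1 - (1 - h) ^+ s <= 2 * (1 - (1 - h / 2) ^+ s).
Proof.
move=> /andP[h0 h1].
suff : 2 * (1 - h / 2) ^+ s <= 1 + (1 - h) ^+ s by lra.
elim: s => [|s IH]; first by rewrite !expr0; lra.
have b0 : 0 <= (1 - h) ^+ s by rewrite exprn_ge0 // subr_ge0.
have b1 : (1 - h) ^+ s <= 1 by rewrite exprn_ile1 // ?subr_ge0 // gerBl.
have a0 : 0 <= 1 - h / 2 by lra.
rewrite !exprS; have := ler_wpM2l a0 IH.
have := mulr_ge0 h0 (_ : 0 <= 1 - (1 - h) ^+ s); rewrite subr_ge0 => /(_ b1).
by lra.
Qed.

(** The mean value theorem gives [(h/2) s (1 - h/2)^(s-1)], and [1 - h/2 >= 1/2]. The derivative is
    taken at the lower field [h/2], where the susceptibility is the larger one. *)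
Lemma half_increment h s : 0 <= h <= 1 ->
  (1 - h / 2) ^+ s - (1 - h) ^+ s <= h * (s%:R * (1 - h / 2) ^+ s).
Proof.
move=> /andP[h0 h1]; elim: s => [|s IH]; first by rewrite !expr0 subrr !mul0r mulr0.
have a0 : 0 <= 1 - h / 2 by lra.
have ab : (1 - h) ^+ s <= (1 - h / 2) ^+ s by apply: lerXn2r; rewrite ?nnegrE; lra.
have as0 : 0 <= (1 - h / 2) ^+ s by rewrite exprn_ge0.
rewrite !exprS -[s.+1%:R]natr1.
have h2 := mulr_ge0 h0 as0.
have b0 : 0 <= 1 - h by lra.
have := ler_wpM2l a0 IH; have := ler_wpM2l h0 ab.
have := mulr_ge0 (mulr_ge0 h0 h0) as0; have := ler_wpM2r h2 h1.
by set A := (1 - h / 2) ^+ s; set B := (1 - h) ^+ s; move=> ? ? ? ?; lra.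
Qed.

End Powers.

Section Line.
Variable d : nat.

Lemma normoo_scale_delta (c : int) (i : 'I_d) :
  normoo (c *: delta_mx ord0 i : vertex d) = `|c|%N.
Proof.
apply/eqP; rewrite eqn_leq; apply/andP; split.
  by apply/normooP => j; rewrite !mxE eqxx /=; case: eqP; rewrite ?mulr1 ?mulr0.
have /normooP/(_ i) := leqnn (normoo (c *: delta_mx ord0 i : vertex d)).
by rewrite !mxE !eqxx mulr1.
Qed.

Lemma sball_norm N (w : {set bedge d N}) (x y : bvertex d N) r :
  y \in sball (@binc d N) w x r -> (normoo (pos y) < normoo (pos x) + r)%N.
Proof.
elim: r y => [|r IH] y; first by rewrite inE.
move=> /sballSP[->|[z /IH zr [/adjP[e _ /binc_norm1/norm1_normoo yz]|->]]].
- by rewrite addnS ltnS leq_addr.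
- by rewrite addnS ltnS (leq_trans yz).
- by rewrite addnS ltnS ltnW.
Qed.

Lemma cl_norm N (w : {set bedge d N}) (x y : bvertex d N) :
  y \in cl (@binc d N) w x -> (normoo (pos y) <= normoo (pos x) + #|cl (@binc d N) w x|)%N.
Proof.
have := sball_full (leqnn #|cl (@binc d N) w x|.+1) => {1}<- /sball_norm.
by rewrite addnS ltnS.
Qed.

End Line.

(** * Bubble and open triangle diagrams of the kernels *)

Section Triangle.
Variables (R : realFieldType) (J d : nat).
Hypothesis d6 : (6 < d)%N.
Local Notation ker2 := (ker R J (d - 2) 0).

Lemma ker_mono s m m' (z : vertex d) : (m <= m')%N -> ker R J s m z <= ker R J s m' z.
Proof.
move=> mm'; apply: ler_sum => j _; apply: ler_wpM2l; first exact: kap_ge0.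
rewrite ler_nat; case: (leqP (normoo z)) => // zj.
by rewrite lt0b (leq_trans zj) // leq_exp2l // leq_add2l.
Qed.

(** Two convolutions, with exponents going from [d - 2] to [d - 4] to [d - 6], each at the price of
    a factor 6 and a ball count. *)
Definition triangle_cst : R := 36 * cball R d 0 * cball R d 1.

Lemma triangle_cst_ge0 : 0 <= triangle_cst.
Proof. by rewrite !mulr_ge0 ?ler0n. Qed.

Lemma bubble_ker N (x y : vertex d) :
  \sum_(u : bvertex d N) ker2 (x - pos u) * ker2 (y - pos u) <=
  6 * cball R d 0 * ker R J (d - 4) 1 (x - y).
Proof. by apply: (@ker_conv R J d N (d - 2) 2 (d - 2) 2 (d - 4) 0); lia. Qed.

Lemma ker_conv42 N (x y : vertex d) :
  \sum_(u : bvertex d N) ker R J (d - 4) 1 (x - pos u) * ker2 (y - pos u) <=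
  6 * cball R d 1 * ker R J (d - 6) 2 (x - y).
Proof.
apply: le_trans (_ : \sum_(u : bvertex d N)
    ker R J (d - 4) 1 (x - pos u) * ker R J (d - 2) 1 (y - pos u) <= _).
  by apply: ler_sum => u _; rewrite ler_wpM2l ?ker_ge0 // ker_mono.
by apply: (@ker_conv R J d N (d - 4) 4 (d - 2) 2 (d - 6) 1); lia.
Qed.

Lemma triangle_ker N (x y : vertex d) :
  \sum_(k : bvertex d N) \sum_(v : bvertex d N)
    ker2 (x - pos v) * ker2 (pos v - pos k) * ker2 (y - pos k) <=
  triangle_cst * ker R J (d - 6) 2 (x - y).
Proof.
apply: le_trans (_ : \sum_(k : bvertex d N)
    6 * cball R d 0 * (ker R J (d - 4) 1 (x - pos k) * ker2 (y - pos k)) <= _).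
  apply: ler_sum => k _; rewrite -big_distrl /= mulrA ler_wpM2r ?ker_ge0 //.
  apply: le_trans (bubble_ker N x (pos k)); apply: ler_sum => v _.
  by rewrite -[pos v - pos k]opprB kerN.
rewrite -big_distrr /=.
have c0 : 0 <= 6 * cball R d 0 by rewrite mulr_ge0 ?ler0n.
by have := ler_wpM2l c0 (ker_conv42 N x y); rewrite /triangle_cst; lra.
Qed.

(** The branch point [u] is summed while its arm is displaced by a fixed [b]: the triangle is open
    by [b], uniformly in [z]. *)
Lemma triangle_ker_shift N (z b : vertex d) :
  \sum_(u : bvertex d N) \sum_(k : bvertex d N)
    ker2 (z - pos u) * ker2 (z - pos k) * ker2 (pos u + b - pos k) <=
  triangle_cst * ker R J (d - 6) 2 b.
Proof.
apply: le_trans (_ : \sum_(u : bvertex d N)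
    6 * cball R d 0 * (ker R J (d - 4) 1 (z - b - pos u) * ker2 (z - pos u)) <= _).
  apply: ler_sum => u _.
  rewrite (eq_bigr (fun k : bvertex d N => ker2 (z - pos u) *
    (ker2 (z - pos k) * ker2 (pos u + b - pos k)))); last first.
    by move=> k _; rewrite mulrA.
  rewrite -big_distrr /= [leRHS]mulrA mulrC ler_wpM2r ?ker_ge0 //.
  apply: le_trans (bubble_ker N z (pos u + b)) _.
  by rewrite opprD addrA addrAC.
rewrite -big_distrr /=.
have c0 : 0 <= 6 * cball R d 0 by rewrite mulr_ge0 ?ler0n.
have := ler_wpM2l c0 (ker_conv42 N (z - b) z).
by rewrite addrAC subrr add0r kerN /triangle_cst; lra.
Qed.

End Triangle.

Lemma Ex_compl (R : realFieldType) (I : finType) (p : I -> R) f :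
  Ex p (fun w => 1 - f w) = 1 - Ex p f.
Proof.
rewrite -(Ex_cst p 1) -mulN1r -ExZ -ExD; apply: eq_Ex => w; by rewrite Ex_cst mulN1r.
Qed.

Section GhostQuantities.
Variables (R : realFieldType) (V I : finType) (inc : I -> V -> V -> bool).
Variables (p : I -> R) (h : R).

Lemma tau_ghost x y : tau (ginc inc) (gprob p h) x y = tau inc p x y.
Proof.
rewrite /tau /Pr -(@Ex_edges R V I p h (fun w => (conn inc w x y)%:R)).
by apply: eq_Ex => w; rewrite gconn.
Qed.

Lemma Mag_ghost x : Mag (ginc inc) (gprob p h) inr x =
  Ex p (fun w => 1 - (1 - h) ^+ #|cl inc w x|).
Proof.
have := @Ex_unmarked R V I inc p h (fun w => 1) x.
rewrite [RHS](@eq_Ex _ _ p _ (fun w => (1 - h) ^+ #|cl inc w x|)); last first.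
  by move=> w; rewrite mul1r.
have -> : Ex p (fun w => 1 - (1 - h) ^+ #|cl inc w x|) =
    1 - Ex p (fun w => (1 - h) ^+ #|cl inc w x|).
  exact: Ex_compl.
move=> <-; rewrite -Ex_compl; apply: eq_Ex => w; rewrite mul1r.
by case: (marked _ _ _ _); rewrite /= ?subr0 ?subrr.
Qed.

Lemma unmarked_ghost x v : unmarked_conn (ginc inc) (gprob p h) inr x v =
  Ex p (fun w => (conn inc w x v)%:R * (1 - h) ^+ #|cl inc w x|).
Proof.
rewrite -Ex_unmarked; apply: eq_Ex => w.
by rewrite -mulnb natrM gconn.
Qed.

End GhostQuantities.

(** * Straight bridges *)

Section Bridge.
Variables (d N L : nat) (i0 : 'I_d).
Implicit Types (u : bvertex d N).

Definition line u (c : int) : bvertex d N := pt N (pos u + c *: delta_mx ord0 i0).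

(** The [2L] edges of the segment centred at [u]; its ends, at distance [L] from [u], carry the two
    marked arms. *)
Definition bridge u : {set bedge d N + bvertex d N} :=
  [set inl (line u (k%:Z - L%:Z), i0) | k : 'I_L.*2].

Hypothesis L0 : (0 < L)%N.

Lemma pos_line u (c : int) : (normoo (pos u) + L <= N)%N -> (`|c| <= L)%N ->
  pos (line u c) = pos u + c *: delta_mx ord0 i0.
Proof.
move=> uN cL; rewrite ptK //; apply: leq_trans (normooD _ _) _.
by rewrite normoo_scale_delta; apply: leq_trans uN; rewrite leq_add2l.
Qed.

Lemma normoo_line u (c : int) : (normoo (pos u) + L <= N)%N -> (`|c| <= L)%N ->
  (normoo (pos (line u c)) <= normoo (pos u) + L)%N.
Proof.
move=> uN cL; rewrite pos_line //; apply: leq_trans (normooD _ _) _.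
by rewrite normoo_scale_delta leq_add2l.
Qed.

Lemma line0 u : line u 0 = u.
Proof. by rewrite /line scale0r addr0 posK. Qed.

Let bridge_step u (k : nat) : (normoo (pos u) + L <= N)%N -> (k < L.*2)%N ->
  adj (ginc (@binc d N)) (bridge u) (line u (k%:Z - L%:Z)) (line u (k.+1%:Z - L%:Z)).
Proof.
move=> uN kL; apply/adjP; exists (inl (line u (k%:Z - L%:Z), i0)).
  by apply/imsetP; exists (Ordinal kL).
rewrite /= /binc /= eqxx /= !pos_line //; try lia.
apply/orP; left; apply/eqP; rewrite -addrA; congr (_ + _).
by rewrite -[delta_mx _ _ in X in _ = _ + X]scale1r -scalerDl; congr (_ *: _); lia.
Qed.

Let bridge_line u (k l : nat) : (normoo (pos u) + L <= N)%N -> (k + l <= L.*2)%N ->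
  conn (ginc (@binc d N)) (bridge u) (line u (k%:Z - L%:Z)) (line u ((k + l)%:Z - L%:Z)).
Proof.
move=> uN; elim: l => [|l IH] kl; first by rewrite addn0; exact: conn0.
apply: (conn_adj (IH _)); first by lia.
by rewrite addnS; apply: bridge_step => //; lia.
Qed.

Let gsym : forall i x y, ginc (@binc d N) i x y = ginc (@binc d N) i y x.
Proof. by apply: ginc_sym; exact: binc_sym. Qed.

Lemma bridge_conn_line u (c : int) : (normoo (pos u) + L <= N)%N -> (`|c| <= L)%N ->
  conn (ginc (@binc d N)) (bridge u) u (line u c).
Proof.
move=> uN cL; pose k := absz (c + L%:Z).
have cE : c = k%:Z - L%:Z by rewrite /k; lia.
have kL : (k <= L.*2)%N by rewrite /k; lia.
apply: (@conn_trans _ _ _ _ _ (line u (0%:Z - L%:Z))).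
  rewrite conn_sym //; have := @bridge_line u 0 L uN; rewrite add0n subrr line0; apply.
  by lia.
by rewrite cE; have := @bridge_line u 0 k uN kL; rewrite add0n.
Qed.

Lemma bridge_conn_end u i y z : (normoo (pos u) + L <= N)%N ->
  i \in bridge u -> ginc (@binc d N) i y z -> conn (ginc (@binc d N)) (bridge u) u y.
Proof.
move=> uN /imsetP[k _ ->] /= /orP[]/andP[/eqP yE /eqP E] /=.
  by rewrite yE; apply: bridge_conn_line => //; have := ltn_ord k; lia.
have -> : y = line u (k.+1%:Z - L%:Z).
  apply: pos_inj; rewrite E /= !pos_line //; try by have := ltn_ord k; lia.
  rewrite -addrA; congr (_ + _).
  by rewrite -[delta_mx _ _ in X in _ + X = _]scale1r -scalerDl; congr (_ *: _); lia.
by apply: bridge_conn_line => //; have := ltn_ord k; lia.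
Qed.

Lemma bridge_no_mark u (v : bvertex d N) : inr v \notin bridge u.
Proof. by apply/imsetP => -[]. Qed.

Lemma bridge_card_le u : (#|bridge u| <= L.*2)%N.
Proof. by apply: leq_trans (leq_imset_card _ _) _; rewrite card_ord. Qed.

Lemma bridge_meet_card u (W : {set bvertex d N}) : u \in W ->
  (forall v, v \in W -> (normoo (pos v) + L <= N)%N) ->
  (#|[set v in W | ~~ [disjoint bridge u & bridge v]]| <= L.*2.*2.+1 ^ d)%N.
Proof.
move=> uW WN; apply: leq_trans (card_ball _ (pos u) _).
apply: subset_leq_card; apply/subsetP => v; rewrite !inE => /andP[vW].
rewrite -setI_eq0 => /set0Pn[i]; rewrite inE => /andP[/imsetP[k _ ->]].
move=> /imsetP[l _ [E]]; have := congr1 (@pos _ _) E.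
have := ltn_ord k; have := ltn_ord l => lL kL.
rewrite !pos_line ?WN //; try lia.
move=> /eqP; rewrite -subr_eq0 opprD addrACA addr_eq0 -scalerBl => /eqP ->.
by rewrite normooN normoo_scale_delta; lia.
Qed.

End Bridge.

(** * Magnetization in boxes and its square-root bound *)

Section Magnetization.
Variables (R : archiRealFieldType) (d : nat).
Hypothesis d6 : (6 < d)%N.
Let i0 : 'I_d := Ordinal (ltn_trans (isT : 0 < 6)%N d6).
Let origin N : bvertex d N := pt N 0.

Variables (Ct p0 : R) (n : nat).
Hypothesis Ct_ge0 : 0 <= Ct.
Hypothesis p0_gt0 : 0 < p0.
Let L := (2 ^ n)%N.
(** Three factors [Ct] for the three two-point functions; [8 = 2 * 2^2] comes from [ker_far] with
    shift 2 at distance [L = 2^n]. *)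
Let eps : R := Ct ^+ 3 * (triangle_cst R d * (8 * 2^-1 ^+ n)).
Hypothesis eps_small : 16 * eps <= 1.

Variable p : R.
Hypothesis p0p : p0 <= p.
Hypothesis p1 : p <= 1.
Hypothesis tau_ker : forall N J (x y : bvertex d N), (0 < J)%N ->
  (N.*2 <= 2 ^ J.-1)%N ->
  tau (@binc d N) (fun=> p) x y <= Ct * ker R J (d - 2) 0 (pos x - pos y).
Hypothesis vol_embed : forall N N' m (x : bvertex d N) (x' : bvertex d N'),
  (normoo (pos x') + m <= N'.+1)%N ->
  Pr (fun=> p) (fun w => m <= #|cl (@binc d N) w x|)%N <=
  Pr (fun=> p) (fun w => m <= #|cl (@binc d N') w x'|)%N.

Definition mag N h : R :=
  Ex (fun=> p) (fun w => 1 - (1 - h) ^+ #|cl (@binc d N) w (pt N 0)|).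

(** The expected size of an unmarked cluster, which is [1 - h] times the derivative of [mag N] in
    [h]. *)
Definition chi N h : R := Ex (fun=> p)
  (fun w => #|cl (@binc d N) w (pt N 0)|%:R * (1 - h) ^+ #|cl (@binc d N) w (pt N 0)|).

(** Number of bridges meeting a given one, divided by the price of opening a bridge. *)
Definition mag_cst : R := (L.*2.*2.+1 ^ d)%N%:R / p0 ^+ L.*2.

Let pp N (i : bedge d N) : 0 <= p <= 1.
Proof. by rewrite p1 andbT (le_trans (ltW p0_gt0)). Qed.

Let p01 : 0 <= p <= 1.
Proof. by rewrite p1 andbT (le_trans (ltW p0_gt0)). Qed.

Let L_gt0 : (0 < L)%N. Proof. by rewrite expn_gt0. Qed.

Let eps_ge0 : 0 <= eps.
Proof.
by rewrite !mulr_ge0 ?exprn_ge0 ?triangle_cst_ge0 ?ler0n ?invr_ge0.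
Qed.

Let origin0 N : pos (origin N) = 0.
Proof. by rewrite ptK ?normoo0. Qed.

Let ker_eps J m (z : vertex d) : (L <= normoo z)%N -> (m <= 2)%N ->
  Ct ^+ 3 * (triangle_cst R d * ker R J (d - 6) m z) <= eps.
Proof.
move=> zL m2; rewrite ler_wpM2l ?exprn_ge0 // ler_wpM2l ?triangle_cst_ge0 //.
apply: le_trans (@ker_mono R J d (d - 6) m 2 z m2) _.
have r0 : (0 < d - 6)%N by rewrite subn_gt0.
by apply: le_trans (ker_far R J 2 r0 zL) _; rewrite -natrX -natrM.
Qed.

Section Field.
Variable h : R.
Hypothesis h0 : 0 < h.
Hypothesis h1 : h <= 1.
Let h01 : 0 <= h <= 1. Proof. by rewrite ltW. Qed.
Let b0 : 0 <= 1 - h. Proof. by rewrite subr_ge0. Qed.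

Variables (S m N : nat).
Hypothesis hS : 10 * (1 - h) ^+ S <= h.
Hypothesis S0 : (0 < S)%N.
Hypothesis hm : forall s, (m < s)%N -> s%:R * (1 - h) ^+ s <= 1.
Hypothesis mN : (m + L + S <= N)%N.

Let W : {set bvertex d N} := [set u | (normoo (pos u) <= m)%N].
Let beta (u : bvertex d N) := line i0 u L%:Z.
Let gamma (u : bvertex d N) := line i0 u (- L%:Z).
Let gp := gprob (V := bvertex d N) (fun _ : bedge d N => p) h.
Let gi := ginc (@binc d N).

(** The first [S] layers of the magnetization, each tail being taken in a box large enough to decide
    it. [M1] bounds the magnetization from below away from the boundary of the box, [M] bounds it
    from above everywhere, and they differ by [(1 - h)^S <= h / 10]. *)
Let M1 : R := \sum_(i < S) h * (1 - h) ^+ i *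
  Pr (fun=> p) (fun w => i < #|cl (@binc d i.+1) w (origin i.+1)|)%N.
Let M := M1 + (1 - h) ^+ S.

Let gp01 i : 0 <= gp i <= 1.
Proof. by case: i => [e|v] /=. Qed.

Let layers x : Ex (fun=> p) (fun w : {set bedge d N} =>
    \sum_(i < S) h * (1 - h) ^+ i * (i < #|cl (@binc d N) w x|)%N%:R) =
  \sum_(i < S) h * (1 - h) ^+ i * Pr (fun=> p) (fun w => i < #|cl (@binc d N) w x|)%N.
Proof. by rewrite Ex_sum; apply: eq_bigr => i _; rewrite ExZ. Qed.

Let hi0 i : 0 <= h * (1 - h) ^+ i.
Proof. by rewrite mulr_ge0 ?exprn_ge0 // ltW. Qed.

Let Mag_le x : Mag gi gp inr x <= M.
Proof.
rewrite Mag_ghost; apply: le_trans (_ : Ex (fun=> p) (fun w : {set bedge d N} =>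
    (\sum_(i < S) h * (1 - h) ^+ i * (i < #|cl (@binc d N) w x|)%N%:R) +
    (1 - h) ^+ S) <= _).
  apply: le_Ex => [|w]; first exact: pp.
  rewrite one_sub_expn_layers //; set s := #|_|.
  have [sS|Ss] := orP (leq_total s S).
    by rewrite (minn_idPr sS) lerDl exprn_ge0.
  by rewrite (minn_idPl Ss) subrK gerBl exprn_ge0.
rewrite ExD Ex_cst lerD2r layers; apply: ler_sum => i _; rewrite ler_wpM2l //.
by apply: vol_embed; rewrite origin0 normoo0.
Qed.

Let Mag_ge (x : bvertex d N) : (normoo (pos x) <= m + L)%N -> M1 <= Mag gi gp inr x.
Proof.
move=> xm; rewrite Mag_ghost.
apply: le_trans (_ : \sum_(i < S) h * (1 - h) ^+ i *
    Pr (fun=> p) (fun w => i < #|cl (@binc d N) w x|)%N <= _).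
  apply: ler_sum => i _; rewrite ler_wpM2l //; apply: vol_embed.
  exact: leq_trans (leq_add xm (ltn_ord i)) (leqW mN).
rewrite -layers; apply: le_Ex => [|w]; first exact: pp.
rewrite one_sub_expn_layers // lerD2l lerN2.
by apply: ler_wiXn2l; rewrite ?gerBl ?geq_minr // ltW.
Qed.

Let M1_ge : h <= M1.
Proof.
rewrite /M1; case: S S0 => // S' _; rewrite big_ord_recl /= expr0 mulr1.
have -> : Pr (fun=> p) (fun w => 0 < #|cl (@binc d 1) w (origin 1)|)%N = 1.
  rewrite -[RHS](Ex_cst (fun _ : bedge d 1 => p)); apply: eq_Ex => w.
  by rewrite card_gt0; case: set0Pn => // -[]; exists (origin 1); rewrite inE conn0.
rewrite mulr1 lerDl; apply: sumr_ge0 => i _; rewrite mulr_ge0 //.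
by apply: Pr_ge0; exact: pp.
Qed.

Let J := (N.*2).+1.
Let ker2 := @ker R J d (d - 2) 0.

Let gtau_le x y : tau gi gp x y <= Ct * ker2 (pos x - pos y).
Proof. by rewrite tau_ghost tau_ker // ltnW // ltn_expl. Qed.

Let gtau3 x y x' y' x'' y'' : tau gi gp x y * tau gi gp x' y' * tau gi gp x'' y'' <=
  Ct ^+ 3 * (ker2 (pos x - pos y) * ker2 (pos x' - pos y') * ker2 (pos x'' - pos y'')).
Proof.
have t0 a b : 0 <= tau gi gp a b by apply: tau_ge0.
apply: le_trans (_ : (Ct * ker2 (pos x - pos y)) * (Ct * ker2 (pos x' - pos y')) *
    (Ct * ker2 (pos x'' - pos y'')) <= _).
  by do 2?[apply: ler_pM; rewrite ?mulr_ge0 //].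
by rewrite le_eqVlt; apply/orP; left; apply/eqP; ring.
Qed.

Let WN u : u \in W -> (normoo (pos u) + L <= N)%N.
Proof.
rewrite inE => um; apply: leq_trans mN; apply: leq_trans (leq_addr _ _).
by rewrite leq_add2r.
Qed.

Let pos_beta u : u \in W -> pos (beta u) = pos u + L%:Z *: delta_mx ord0 i0.
Proof. by move=> /WN uN; rewrite (@pos_line d N L). Qed.

Let pos_gamma u : u \in W -> pos (gamma u) = pos u + (- L%:Z) *: delta_mx ord0 i0.
Proof. by move=> /WN uN; rewrite (@pos_line d N L) // abszN. Qed.

Let triangle1 u : u \in W ->
  \sum_k \sum_v tau gi gp (beta u) v * tau gi gp v k * tau gi gp (gamma u) k <= eps.
Proof.
move=> uW.
apply: le_trans (_ : Ct ^+ 3 * (\sum_(k : bvertex d N) \sum_(v : bvertex d N)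
    ker2 (pos (beta u) - pos v) * ker2 (pos v - pos k) * ker2 (pos (gamma u) - pos k)) <= _).
  rewrite big_distrr; apply: ler_sum => k _; rewrite big_distrr; apply: ler_sum => v _.
  exact: gtau3.
apply: le_trans (ler_wpM2l _ (triangle_ker R J d6 N _ _)) _; first exact: exprn_ge0.
apply: ker_eps => //; rewrite pos_beta // pos_gamma // opprD addrACA subrr add0r.
by rewrite -scalerBl normoo_scale_delta opprK -PoszD leq_addr.
Qed.

Let triangle2 v : \sum_(u in W) \sum_k tau gi gp v u * tau gi gp v k *
  (tau gi gp (beta u) k + tau gi gp (gamma u) k) <= 2 * eps.
Proof.
have side (b : vertex d) (g : bvertex d N -> bvertex d N) : (L <= normoo b)%N ->
    (forall u, u \in W -> pos (g u) = pos u + b) ->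
    \sum_(u in W) \sum_k tau gi gp v u * tau gi gp v k * tau gi gp (g u) k <= eps.
  move=> bL gE.
  apply: le_trans (_ : Ct ^+ 3 * (\sum_(u : bvertex d N) \sum_(k : bvertex d N)
    ker2 (pos v - pos u) * ker2 (pos v - pos k) * ker2 (pos u + b - pos k)) <= _).
    rewrite big_distrr big_mkcond; apply: ler_sum => u _; rewrite big_distrr /=.
    case: ifP => [uW|_].
      by apply: ler_sum => k _; rewrite -gE //; exact: gtau3.
    apply: sumr_ge0 => k _; rewrite !mulr_ge0 ?exprn_ge0 //; exact: ker_ge0.
  apply: le_trans (ler_wpM2l _ (triangle_ker_shift R J d6 N _ _)) _; first exact: exprn_ge0.
  exact: ker_eps.
have hb := side _ beta _ pos_beta; have hc := side _ gamma _ pos_gamma.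
rewrite !normoo_scale_delta abszN /= leqnn in hb hc.
have := lerD (hb isT) (hc isT); rewrite -big_split /= mulr_natl mulr2n.
apply: le_trans; apply: ler_sum => u _; rewrite -big_split; apply: ler_sum => k _ /=.
by rewrite mulrDr.
Qed.

Let chi_sum : \sum_v unmarked_conn gi gp inr (origin N) v = chi N h.
Proof.
rewrite (eq_bigr (fun v => Ex (fun=> p) (fun w : {set bedge d N} =>
  (conn (@binc d N) w (origin N) v)%:R * (1 - h) ^+ #|cl (@binc d N) w (origin N)|)));
  last by move=> v _; rewrite unmarked_ghost.
rewrite -Ex_sum; apply: eq_Ex => w.
by rewrite -big_distrl /= -natr_sum sum_bool.
Qed.

(** A cluster of the origin with at most [m] vertices stays in [W]; a larger one contributes at most
    1 by [hm]. *)
Let chi_W : chi N h <= \sum_(v in W) unmarked_conn gi gp inr (origin N) v + 1.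
Proof.
rewrite (eq_bigr (fun v => Ex (fun=> p) (fun w : {set bedge d N} =>
  (conn (@binc d N) w (origin N) v)%:R * (1 - h) ^+ #|cl (@binc d N) w (origin N)|)));
  last by move=> v _; rewrite unmarked_ghost.
rewrite -Ex_sum -[X in _ + X](Ex_cst (fun _ : bedge d N => p)) -ExD.
apply: le_Ex => [|w]; first exact: pp.
rewrite -big_distrl /=.
have s0 : 0 <= (1 - h) ^+ #|cl (@binc d N) w (origin N)| by exact: exprn_ge0.
have [clm|clm] := leqP #|cl (@binc d N) w (origin N)| m; last first.
  by apply: le_trans (hm clm) _; rewrite lerDr mulr_ge0 // sumr_ge0.
rewrite -[leLHS]addr0 lerD // ler_wpM2r // -natr_sum ler_nat -sum1_card big_mkcond [leqRHS]big_mkcond.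
apply: leq_sum => v _; rewrite inE /=; case c: (conn _ _ _ v) => //.
rewrite inE ifT //; apply: leq_trans clm.
have := @cl_norm d N w (origin N) v; rewrite origin0 normoo0 add0n; apply.
by rewrite inE.
Qed.

Let mag_chi_bound : mag N h * chi N h <= 5 * mag_cst.
Proof.
have q0 : 0 < p0 ^+ L.*2 by rewrite exprn_gt0.
have D1 : 1 <= (L.*2.*2.+1 ^ d)%N%:R :> R by rewrite ler1n expn_gt0.
have p0_le1 : p0 <= 1 by exact: le_trans p1.
have K1 : 1 <= mag_cst.
  rewrite ler_pdivlMr // mul1r; apply: le_trans D1; rewrite exprn_ile1 //.
  exact: ltW.
have M1_ge0 : 0 <= M1 by rewrite (le_trans (ltW h0)).
have key : p0 ^+ L.*2 * ((M1 ^+ 2 - M ^+ 2 * eps) *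
    (\sum_(u in W) unmarked_conn gi gp inr (origin N) u) -
    M ^+ 2 * (2 * eps) * \sum_v unmarked_conn gi gp inr (origin N) v) <=
    (L.*2.*2.+1 ^ d)%N%:R * Mag gi gp inr (origin N).
  have isym := ginc_sym (@binc_sym d N).
  have iuniq := ginc_uniq (@binc_uniq d N).
  apply: (@magnetization_inequality R _ _ gi isym iuniq gp gp01 inr _ M M1 eps
    Mag_le M1_ge0 W beta gamma (2 * eps) _ _ triangle1 triangle2 (bridge L i0)) => //.
  - by move=> u uW; apply: Mag_ge; apply: leq_trans (@normoo_line d N L _ _ _ _ _) _;
      rewrite ?WN // leq_add2r; move: uW; rewrite inE.
  - by move=> u uW; apply: Mag_ge; apply: leq_trans (@normoo_line d N L _ _ _ _ _) _;
      rewrite ?WN ?abszN // leq_add2r; move: uW; rewrite inE.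
  - exact: ltW.
  - by move=> u i uW /imsetP[k _ ->].
  - by move=> u uW; apply: bridge_conn_line => //; exact: WN.
  - by move=> u uW; apply: bridge_conn_line; rewrite ?abszN //; exact: WN.
  - by move=> u i y z uW; apply: bridge_conn_end => //; exact: WN.
  - by move=> u v _; exact: bridge_no_mark.
  - by move=> u _; exact: bridge_card_le.
  - by move=> u uW; apply: bridge_meet_card => //; exact: WN.
rewrite chi_sum in key.
have magE : Mag gi gp inr (origin N) = mag N h by rewrite Mag_ghost.
rewrite magE in key.
have magM : mag N h <= M by rewrite -magE.
have mag0 : 0 <= mag N h by rewrite -magE; apply: Mag_ge0.
have mag1 : mag N h <= 1 by rewrite -magE; apply: Pr_le1.
have chi0 : 0 <= chi N h.
  by apply: Ex_ge0 => [|w]; [exact: pp|rewrite mulr_ge0 ?exprn_ge0 ?ler0n].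
(* If [chi <= 2], the bounds [mag <= 1] and [mag_cst >= 1] suffice; otherwise the additive 1 of
   [chi_W] is at most half of [chi]. *)
have [chi2|chi2] := lerP (chi N h) 2.
  apply: le_trans (_ : 1 * 2 <= _); last by lra.
  by apply: ler_pM.
have cW := chi_W.
move: key cW; set X := \sum_(u in W) _ => key cW.
have X2 : chi N h <= 2 * X by lra.
(* The truncation error is at most [h / 10], and [h <= M1] by the zeroth layer. *)
have hM : 10 * M <= 11 * M1 by move: hS M1_ge; rewrite /M; lra.
have M_gt0 : 0 < M by apply: lt_le_trans h0 _; rewrite (le_trans M1_ge) // /M lerDl exprn_ge0.
have MM : 4 / 5 * M ^+ 2 <= M1 ^+ 2.
  have : (10 * M) ^+ 2 <= (11 * M1) ^+ 2.
    by apply: lerXn2r => //; rewrite nnegrE mulr_ge0 // ltW.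
  have : 0 <= M ^+ 2 by exact: sqr_ge0.
  by rewrite !exprMn; lra.
have X0 : 0 <= X by lra.
have M20 : 0 <= M ^+ 2 by exact: sqr_ge0.
have e1 : M ^+ 2 * eps <= M ^+ 2 / 16.
  by apply: ler_wpM2l => //; move: eps_small; move: eps => e; lra.
(* Here [59/80 = 4/5 - 1/16]. Halving it to pass from [X] to [chi] and subtracting [1/8] for the
   second error leaves more than [1/5]. *)
have low : M ^+ 2 * chi N h / 5 <= (M1 ^+ 2 - M ^+ 2 * eps) * X -
    M ^+ 2 * (2 * eps) * chi N h.
  have a1 : 59 / 80 * M ^+ 2 * X <= (M1 ^+ 2 - M ^+ 2 * eps) * X.
    by apply: ler_wpM2r => //; move: e1 MM; move: (M ^+ 2 * eps) => e; lra.
  have a2 : M ^+ 2 * (2 * eps) * chi N h <= M ^+ 2 / 8 * chi N h.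
    apply: ler_wpM2r => //; rewrite mulrCA; move: e1.
    by move: (M ^+ 2 * eps) (M ^+ 2) => e x; lra.
  have a3 : M ^+ 2 * chi N h <= 2 * (M ^+ 2 * X).
    by have := ler_wpM2l M20 X2; lra.
  by have := mulr_ge0 M20 X0; have := mulr_ge0 M20 chi0; lra.
have : p0 ^+ L.*2 * (M ^+ 2 * chi N h / 5) <= (L.*2.*2.+1 ^ d)%N%:R * M.
  apply: le_trans (ler_wpM2l (ltW q0) low) _; apply: le_trans key _.
  by apply: ler_wpM2l; rewrite ?ler0n.
have -> : p0 ^+ L.*2 * (M ^+ 2 * chi N h / 5) = M * (p0 ^+ L.*2 * (M * chi N h) / 5).
  by rewrite expr2; ring.
rewrite [leRHS]mulrC ler_pM2l // => main.
apply: le_trans (ler_wpM2r chi0 magM) _.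
rewrite /mag_cst mulrA ler_pdivlMr //; lra.
Qed.

Definition mag_chi_aux := mag_chi_bound.

End Field.

Lemma mag_chi h : 0 < h <= 1 -> exists N0, forall N, (N0 <= N)%N ->
  mag N h * chi N h <= 5 * mag_cst.
Proof.
move=> /andP[h0 h1].
have h2 : 0 < h ^+ 2 by rewrite exprn_gt0.
pose S := Num.Def.archi_bound (10 / h ^+ 2).
have hS : 10 <= S%:R * h ^+ 2.
  by rewrite -ler_pdivrMr // ltW // archi_boundP // divr_ge0 // ltW.
pose k := Num.Def.archi_bound (2 / h ^+ 2).
have hk : 2 <= k%:R * h ^+ 2.
  by rewrite -ler_pdivrMr // ltW // archi_boundP // divr_ge0 // ltW.
have S0 : (0 < S)%N by case: (S) hS => //; rewrite mul0r; lra.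
have b0 : 0 <= (1 - h) ^+ S by rewrite exprn_ge0 // subr_ge0.
have hSb : 10 * (1 - h) ^+ S <= h.
  have h01 : 0 <= h <= 1 by rewrite ltW.
  have := expr_one_sub_le S h01.
  have := ler_wpM2r b0 hS; move: ((1 - h) ^+ S) b0 => b b0 a1 a2.
  have := ler_wpM2l (ltW h0) a2; have := mulr_ge0 b0 (ltW h0).
  by move: a1; rewrite expr2; lra.
exists (k.*2 + L + S)%N => N NN; apply: (@mag_chi_aux h h0 h1 S k.*2) => //.
by move=> s ks; apply: natr_expr_bounded ks; rewrite ?h0.
Qed.

Let mag_ge0 N h : 0 <= h <= 1 -> 0 <= mag N h.
Proof.
move=> /andP[h0 h1]; apply: Ex_ge0 => [|w]; first exact: pp.
by rewrite subr_ge0 exprn_ile1 // ?subr_ge0 // gerBl.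
Qed.

Let mag_half N h : 0 <= h <= 1 -> mag N h <= 2 * mag N (h / 2).
Proof.
move=> h01; rewrite -ExZ; apply: le_Ex => [|w]; first exact: pp.
exact: half_convex.
Qed.

Let mag_increment N h : 0 <= h <= 1 -> mag N h - mag N (h / 2) <= h * chi N (h / 2).
Proof.
move=> h01; rewrite lerBlDr -ExZ -ExD; apply: le_Ex => [|w]; first exact: pp.
by move: #|_| => s; have := half_increment s h01; lra.
Qed.

Let mag_cst_ge0 : 0 <= mag_cst.
Proof. by rewrite divr_ge0 ?ler0n // exprn_ge0 // ltW. Qed.

(* Discrete form of the differential inequality (M^2)' = 2 M M' <= C. *)
Let mag_halving h : 0 < h <= 1 -> exists N0, forall N, (N0 <= N)%N ->
  mag N h ^+ 2 <= mag N (h / 2) ^+ 2 + 15 * mag_cst * h.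
Proof.
move=> /andP[h0 h1]; have h01 : 0 <= h <= 1 by rewrite ltW.
have h2 : 0 < h / 2 <= 1 by apply/andP; split; lra.
have h2' : 0 <= h / 2 <= 1 by apply/andP; split; lra.
have [N0 H] := mag_chi h2; exists N0 => N /H.
have := mag_increment N h01; have := mag_half N h01.
have := mag_ge0 N h01; have := mag_ge0 N h2'.
move: (mag N h) (mag N (h / 2)) (chi N (h / 2)) => a b c b0 a0 ab inc bc.
have ab0 : 0 <= a + b by lra.
(* Difference of squares: [a - b <= h c] and [a + b <= 3 b], so that [3 h b c] is at most
   [15 mag_cst h]. *)
have s1 := ler_wpM2r ab0 inc.
have [c0|/ltW c0] := lerP 0 c; last first.
  have : h * c <= 0 by rewrite mulr_ge0_le0 // ltW.
  by have := mulr_ge0 mag_cst_ge0 (ltW h0); rewrite !expr2; nra.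
have s2 := ler_wpM2l (mulr_ge0 (ltW h0) c0) (_ : a + b <= 3 * b).
have s3 := ler_wpM2l (ltW h0) bc.
have {}s2 := s2 (_ : a + b <= 3 * b).
by rewrite !expr2; have := s2; lra.
Qed.

(** The errors [15 mag_cst h / 2^i] sum to at most [30 mag_cst h]. *)
Let mag_halvings h j : 0 < h <= 1 -> exists N0, forall N, (N0 <= N)%N ->
  mag N h ^+ 2 <= mag N (h / 2 ^+ j) ^+ 2 + 30 * mag_cst * h.
Proof.
elim: j h => [|j IH] h h01; have /andP[h0 h1] := h01.
  by exists 0%N => N _; rewrite expr0 divr1 lerDl; do 2?[apply: mulr_ge0 => //]; exact: ltW.
have h2 : 0 < h / 2 <= 1 by apply/andP; split; lra.
have [N0 H0] := mag_halving h01; have [N1 H1] := IH _ h2.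
exists (maxn N0 N1) => N; rewrite geq_max => /andP[/H0 {}H0 /H1 {}H1].
have -> : h / 2 ^+ j.+1 = h / 2 / 2 ^+ j by rewrite exprS invfM mulrA.
by lra.
Qed.

(** A cluster with fewer than [m] vertices carries a mark with probability at most [m h]. This
    supplies the initial value of the integration near [h = 0]. *)
Let mag_small N h m : 0 <= h <= 1 -> mag N h <=
  Pr (fun=> p) (fun w => m <= #|cl (@binc d m) w (origin m)|)%N + m%:R * h.
Proof.
move=> /andP[h0 h1].
apply: le_trans (_ : Pr (fun=> p) (fun w => m <= #|cl (@binc d N) w (origin N)|)%N +
    m%:R * h <= _); last first.
  by rewrite lerD2r; apply: vol_embed; rewrite origin0 normoo0.
rewrite -[X in _ + X](Ex_cst (fun _ : bedge d N => p)) -ExD.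
apply: le_Ex => [|w]; first exact: pp.
have b0 : 0 <= 1 - h by rewrite subr_ge0.
move: #|_| => s; have bs : 0 <= (1 - h) ^+ s by exact: exprn_ge0.
have mh : 0 <= m%:R * h by rewrite mulr_ge0.
have [ms|/ltnW sm] /= := leqP m s; first by lra.
rewrite add0r; apply: le_trans (_ : s%:R * h <= _); last by rewrite ler_wpM2r // ler_nat.
elim: (s) => [|k IHk]; first by rewrite expr0 subrr mul0r.
rewrite exprS -[k.+1%:R]natr1 mulrDl mul1r.
have : (1 - h) ^+ k <= 1 by rewrite exprn_ile1 // gerBl.
by move=> /(ler_wpM2l h0); lra.
Qed.

Hypothesis no_percolation : forall t : R, 0 < t -> exists m,
  Pr (fun=> p) (fun w => m <= #|cl (@binc d m) w (origin m)|)%N < t.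

Let mag_sqrt h : 0 < h <= 1 -> exists N0, forall N, (N0 <= N)%N ->
  mag N h ^+ 2 <= (1 + 30 * mag_cst) * h.
Proof.
move=> h01; have /andP[h0 h1] := h01.
have h02 : 0 < h / 2 by lra.
have [m Hm] := no_percolation h02.
(* Enough halvings for [m h / 2^j <= h / 2]; the magnetization at the last field is then at most
   [h], and its square at most [h]. *)
pose j := Num.Def.archi_bound (2 * m%:R : R).
have mj : m%:R * (h / 2 ^+ j) <= h / 2.
  have : 2 * m%:R <= 2 ^+ j :> R.
    apply: le_trans (_ : j%:R <= _); first by rewrite ltW // archi_boundP // mulr_ge0.
    by rewrite -natrX ler_nat ltnW // ltn_expl.
  have e0 : 0 < 2 ^+ j :> R by rewrite exprn_gt0.
  move=> /(ler_wpM2l (ltW h0)) H; rewrite mulrA ler_pdivrMr //; lra.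
have [N0 H0] := mag_halvings j h01; exists N0 => N /H0 {}H0.
have hj : 0 <= h / 2 ^+ j <= 1.
  have e1 : 1 <= 2 ^+ j :> R by rewrite exprn_ege1 // ler1n.
  rewrite divr_ge0 ?exprn_ge0 ?(ltW h0) //= ler_pdivrMr ?mul1r; first exact: le_trans e1.
  by rewrite exprn_gt0.
have := mag_small N m hj; have := mag_ge0 N hj; move: H0.
move: (mag N (h / 2 ^+ j)) => b H0 b0 bm.
have bh : b <= h by lra.
have : b ^+ 2 <= h.
  apply: le_trans (_ : h * h <= _); first by rewrite expr2 ler_pM.
  by rewrite -[leRHS]mulr1 ler_wpM2l // ltW.
by lra.
Qed.

(** Take [h = 1/m]: a cluster with at least [m] vertices is marked with probability at least [1/2],
    since [(1 - h)^m (1 + m h) <= 1]. *)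
Lemma volume_tail_subcritical m :
  m%:R * Pr (fun=> p) (fun w => m <= #|cl (@binc d m) w (pt m 0%R)|)%N ^+ 2 <=
  4 * (1 + 30 * mag_cst).
Proof.
case: m => [|m]; first by rewrite mul0r; have := mag_cst_ge0; lra.
set v := Pr _ _; pose h : R := m.+1%:R^-1.
have m0 : 0 < m.+1%:R :> R by rewrite ltr0n.
have h0 : 0 < h by rewrite invr_gt0.
have h01 : 0 < h <= 1 by rewrite h0 invf_le1 // ler1n.
have h01' : 0 <= h <= 1 by case/andP: h01 => /ltW -> ->.
have [N0 H] := mag_sqrt h01; have := H (maxn N0 m.+1); rewrite leq_maxl => /(_ isT).
set N := maxn _ _ => magh.
have v0 : 0 <= v by apply: Pr_ge0; exact: pp.
have vm : v <= 2 * mag N h.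
  apply: le_trans (_ : Pr (fun=> p) (fun w => m.+1 <= #|cl (@binc d N) w (pt N 0%R)|)%N <= _).
    by apply: vol_embed; rewrite origin0 normoo0 add0n leqW // leq_maxr.
  rewrite -ExZ; apply: le_Ex => [|w]; first exact: pp.
  move: #|_| => s; have b0 : 0 <= 1 - h by rewrite subr_ge0; case/andP: h01.
  have b1 : 1 - h <= 1 by rewrite gerBl ltW.
  have [ms|_] /= := boolP (m < s)%N; last first.
    by apply: mulr_ge0 => //; rewrite subr_ge0 exprn_ile1.
  have : (1 - h) ^+ s <= (1 - h) ^+ m.+1 by exact: ler_wiXn2l.
  have := expr_one_sub_le m.+1 h01'; rewrite /h mulfV ?gt_eqF //; lra.
have vv : v ^+ 2 <= 4 * ((1 + 30 * mag_cst) * h).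
  apply: le_trans (_ : (2 * mag N h) ^+ 2 <= _).
    by rewrite !expr2 ler_pM.
  by rewrite exprMn; lra.
apply: le_trans (ler_wpM2l (ltW m0) vv) _.
rewrite le_eqVlt; apply/orP; left; apply/eqP; rewrite /h; field.
by rewrite nat1r gt_eqF.
Qed.

End Magnetization.

(** * Events of the lattice depending on a finite box *)

Section LatticeEdges.
Variable d : nat.
Implicit Types (x y a : vertex d) (k l : 'I_d).

Let e k : vertex d := delta_mx ord0 k.

Let e_neq0 k : e k != 0.
Proof. by rewrite -normoo_eq0 normoo_delta. Qed.

Let e_inj : injective e.
Proof.
move=> k l /rowP/(_ k); rewrite !mxE !eqxx /=.
by have [->|] := eqVneq k l.
Qed.

Let eD_neq0 k l : e k + e l != 0.
Proof.
apply/eqP => /rowP/(_ k); rewrite !mxE !eqxx /=.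
by case: (_ == _).
Qed.

Lemma is_edge_delta x k : is_edge [fset x; (x + delta_mx ord0 k)%R]%fset.
Proof.
apply/boolp.asboolP; exists x, (x + delta_mx ord0 k); split=> //.
by apply/norm1_adj; exists k; right.
Qed.

Definition ledge x k : edge d := Sub _ (is_edge_delta x k).

Lemma ledge_inj x y k l : ledge x k = ledge y l -> x = y /\ k = l.
Proof.
move=> /(congr1 val) /= E.
have hx : (x == y) || (x == y + e l) by rewrite -in_fset2 -E in_fset2 eqxx.
have hy : (y == x) || (y == x + e k) by rewrite -in_fset2 E in_fset2 eqxx.
have {hx hy} xy : x = y.
  case/orP: hx => /eqP // xE; case/orP: hy => /eqP // yE.
  by move/eqP: yE; rewrite xE -addrA eq_sym -subr_eq0 addrAC subrr add0r addrC (negbTE (eD_neq0 _ _)).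
split=> //; subst y; apply: e_inj.
have : (x + e k == x) || (x + e k == x + e l) by rewrite -in_fset2 -E in_fset2 eqxx orbT.
by case/orP => /eqP; [rewrite -[RHS]addr0|] => /addrI // /eqP; rewrite (negbTE (e_neq0 k)).
Qed.

Definition shift_edge N a (i : bedge d N) : edge d := ledge (pos i.1 + a) i.2.

Lemma shift_edge_inj N a : injective (@shift_edge N a).
Proof. by move=> [x k] [y l] /ledge_inj /= [/addIr/pos_inj -> ->]. Qed.

End LatticeEdges.

Definition view d (I : finType) (t : I -> edge d) (w : config d) : {set I} :=
  [set i | w (t i)].

From mathcomp Require Import all_classical all_reals all_analysis.

Local Open Scope classical_set_scope.

(** * Finite-dimensional events under the lattice law *)

Section Transfer.
Variables (R : realType) (d : nat) (p : R) (P : probability (config d) R).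
Hypothesis P_law : bernoulli_law p P.
Variables (I : finType) (t : I -> edge d).
Hypothesis t_inj : injective t.
Implicit Types (A : pred {set I}).

Let measurable_open (e : edge d) b : measurable [set w : config d | w e = b].
Proof.
have mt : measurable [set w : config d | w e = true].
  by apply: sub_sigma_algebra; exists e.
case: b => //; rewrite (_ : [set w : config d | w e = false] =
  ~` [set w : config d | w e = true]); first exact: measurableC.
by apply/seteqP; split=> w /=; case: (w e).
Qed.

Let point w0 := [set w : config d | view t w = w0].

Let pointE w0 : point w0 = [set w : config d |
  forall e, e \in [fset t i | i : I]%fset -> w e = [exists i in w0, t i == e]].
Proof.
apply/seteqP; split=> w /=.
  move=> <- e /imfsetP[i /= _ ->]; apply/idP/existsP => [wi|[j /andP[jw /eqP <-]]].
    by exists i; rewrite inE wi eqxx.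
  by move: jw; rewrite inE.
move=> H; apply/setP => i; rewrite inE H ?in_imfset //=.
apply/existsP/idP => [[j /andP[jw /eqP/t_inj <-]] //|iw].
by exists i; rewrite iw eqxx.
Qed.

Let measurable_point w0 : measurable (point w0).
Proof.
rewrite (_ : point w0 = \bigcap_(i in [set: I]) [set w : config d | w (t i) = (i \in w0)]).
  by apply: fin_bigcap_measurable => // i _; exact: measurable_open.
apply/seteqP; split=> w /= H; first by move=> i _; rewrite -H inE.
by apply/setP => i; rewrite inE H.
Qed.

Let P_point w0 : P (point w0) = (wt (fun=> p) w0)%:E.
Proof.
rewrite pointE P_law; congr (_%:E).
rewrite big_imfset /=; last by move=> i j _ _; exact: t_inj.
rewrite /wt enumT; apply: eq_bigr => i _; congr (if _ then _ else _).
apply/existsP/idP => [[j /andP[jw /eqP/t_inj <-]] //|iw].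
by exists i; rewrite iw eqxx.
Qed.

Let seq_event (s : seq {set I}) : uniq s ->
  measurable [set w : config d | view t w \in s] /\
  P [set w : config d | view t w \in s] = (\sum_(w0 <- s) wt (fun=> p) w0)%:E.
Proof.
elim: s => [|w0 s IH].
  move=> _; have -> : [set w : config d | view t w \in [::]] = set0.
    by apply/seteqP; split.
  by rewrite big_nil measure0.
move=> /andP[w0s /IH[ms Ps]].
have -> : [set w : config d | view t w \in w0 :: s] =
    point w0 `|` [set w : config d | view t w \in s]; last first.
  split; first exact: measurableU.
  rewrite measureU //; last by apply/seteqP; split=> // w [/= ->]; rewrite (negbTE w0s).
  by rewrite big_cons EFinD -P_point -Ps.
apply/seteqP; split=> w /=; rewrite inE.
  by case/orP => [/eqP|]; [left|right].
by case=> [->|->]; rewrite ?eqxx ?orbT.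
Qed.

Lemma view_event A : measurable [set w : config d | A (view t w)] /\
  P [set w : config d | A (view t w)] = (Pr (fun=> p) A)%:E.
Proof.
have [] := seq_event (filter_uniq A (index_enum_uniq {set I})).
have -> : [set w : config d | view t w \in [seq w <- index_enum _ | A w]] =
    [set w : config d | A (view t w)]; last first.
  move=> mA ->; split=> //; congr (_%:E); rewrite big_filter big_mkcond.
  by apply: eq_bigr => w _ /=; case: (A w); rewrite /= ?mulr1 ?mulr0.
by apply/seteqP; split=> w /=; rewrite mem_filter mem_index_enum andbT.
Qed.

Lemma measurable_view A : measurable [set w : config d | A (view t w)].
Proof. by case: (view_event A). Qed.

Lemma P_view A : P [set w : config d | A (view t w)] = (Pr (fun=> p) A)%:E.
Proof. by case: (view_event A). Qed.

End Transfer.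

(** * Lattice clusters seen from boxes *)

Section BoxConfiguration.
Variable d : nat.
Implicit Types (w : config d) (a x y z : vertex d) (N : nat).

Definition bview N a w := view (shift_edge (N := N) a) w.

Lemma mem_bview N a w i : (i \in bview N a w) = w (ledge (pos i.1 + a) i.2).
Proof. by rewrite inE. Qed.

Lemma open_adjP w x y : reflect
  (exists k, (y = x + delta_mx ord0 k /\ w (ledge x k)) \/
             (x = y + delta_mx ord0 k /\ w (ledge y k)))
  (open_adj w x y).
Proof.
apply: (iffP (asboolP _)) => [[e [exy we]]|[k [[-> wk]|[-> wk]]]]; last 2 first.
- by exists (ledge x k).
- by exists (ledge y k); split=> //=; rewrite fsetUC.
have /asboolP[x0 [y0 [xy0 E]]] := valP e.
have xy0' : x0 != y0.
  by apply/eqP => xy; move: xy0; rewrite xy subrr /norm1 big1 // => i _; rewrite mxE.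
have [[xE yE]|[xE yE]] : (x = x0 /\ y = y0) \/ (x = y0 /\ y = x0).
  have hx : (x == x0) || (x == y0) by rewrite -in_fset2 -E exy in_fset2 eqxx.
  have hy : (y == x0) || (y == y0) by rewrite -in_fset2 -E exy in_fset2 eqxx orbT.
  have hx0 : (x0 == x) || (x0 == y) by rewrite -in_fset2 -exy E in_fset2 eqxx.
  have hy0 : (y0 == x) || (y0 == y) by rewrite -in_fset2 -exy E in_fset2 eqxx orbT.
  case/orP: hx => /eqP xE; case/orP: hy => /eqP yE; [|by left|by right|].
    by move: hy0; rewrite xE yE orbb eq_sym (negbTE xy0').
  by move: hx0; rewrite xE yE orbb (negbTE xy0').
- move/norm1_adj: xy0 => [k [xk|yk]]; exists k; [right|left]; subst x y.
    by split=> //; rewrite (_ : ledge _ _ = e) //; apply: val_inj => /=; rewrite exy xk fsetUC.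
  by split=> //; rewrite (_ : ledge _ _ = e) //; apply: val_inj => /=; rewrite exy yk.
- move/norm1_adj: xy0 => [k [xk|yk]]; exists k; [left|right]; subst x y.
    by split=> //; rewrite (_ : ledge _ _ = e) //; apply: val_inj => /=; rewrite exy xk.
  by split=> //; rewrite (_ : ledge _ _ = e) //; apply: val_inj => /=; rewrite exy yk fsetUC.
Qed.

Lemma adj_bview N a w (y z : bvertex d N) :
  adj (@binc d N) (bview N a w) y z = open_adj w (pos y + a) (pos z + a).
Proof.
apply/adjP/open_adjP => [[[u k]]|].
  rewrite mem_bview /= /binc /= => wk /orP[]/andP[/eqP -> /eqP E]; exists k.
    by left; rewrite E addrAC.
  by right; rewrite E addrAC.
move=> [k [[E wk]|[E wk]]].
  exists (y, k); rewrite ?mem_bview // /binc /= eqxx /=; apply/orP; left.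
  by rewrite -(inj_eq (addIr a)) E addrAC.
exists (z, k); rewrite ?mem_bview // /binc /= eqxx /=; apply/orP; right.
by rewrite -(inj_eq (addIr a)) E addrAC.
Qed.

Lemma open_adj_norm w x y : open_adj w x y -> norm1 (x - y) = 1%N.
Proof.
by move=> /open_adjP[k [[-> _]|[-> _]]]; apply/norm1_adj; exists k; [right|left].
Qed.

(** [a] and [a'] are the lattice positions of the two box centres. As [sball] of radius [r] stops at
    distance [r - 1], it fits in the second box already when [normoo (pos x') + r <= N' + 1]. *)
Lemma sball_embed N N' a a' w (x y : bvertex d N) (x' : bvertex d N') r :
  pos x + a = pos x' + a' -> (normoo (pos x') + r <= N'.+1)%N ->
  y \in sball (@binc d N) (bview N a w) x r ->
  (normoo (pos y + a - a')%R < normoo (pos x') + r)%N /\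
  pt N' (pos y + a - a') \in sball (@binc d N') (bview N' a' w) x' r.
Proof.
move=> xx'; elim: r y => [|r IH] y rN; first by rewrite inE.
have rN' : (normoo (pos x') + r <= N'.+1)%N by lia.
move=> /sballSP[->|[z /(IH z rN')[zn zr] [zy|->]]].
- by rewrite xx' addrK posK; split; [lia|exact: sball_mem].
- have yn : (normoo (pos y + a - a')%R <= normoo (pos x') + r)%N.
    apply: leq_trans _ zn; apply: norm1_normoo.
    have -> : pos z + a - a' - (pos y + a - a') = pos z + a - (pos y + a).
      by rewrite opprB addrA subrK.
    by apply: (@open_adj_norm w); rewrite -adj_bview.
  split; first by lia.
  by apply: sball_adj zr _; rewrite adj_bview !ptK ?subrK -?adj_bview //; lia.
- split; first by lia.
  exact: (fintype.subsetP (sball_sub _ _ _ (leqnSn r)) _ zr).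
Qed.

Lemma card_sball_embed N N' a a' w (x : bvertex d N) (x' : bvertex d N') r :
  pos x + a = pos x' + a' -> (normoo (pos x') + r <= N'.+1)%N ->
  (#|sball (@binc d N) (bview N a w) x r| <=
   #|sball (@binc d N') (bview N' a' w) x' r|)%N.
Proof.
move=> xx' rN; rewrite -(card_in_imset (f := fun y : bvertex d N => pt N' (pos y + a - a'))).
  apply: subset_leq_card; apply/fintype.subsetP => _ /imsetP[y yr ->].
  by case: (sball_embed xx' rN yr).
move=> y z /(sball_embed xx' rN)[yn _] /(sball_embed xx' rN)[zn _].
move=> /(congr1 (@pos _ _)); rewrite !ptK; try lia.
by move=> /addIr/addIr/pos_inj.
Qed.

Lemma conn_embed N N' w (x y : bvertex d N) : (N <= N')%N ->
  conn (@binc d N) (bview N 0 w) x y ->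
  conn (@binc d N') (bview N' 0 w) (pt N' (pos x)) (pt N' (pos y)).
Proof.
move=> NN'; move: y; apply: conn_ind => [|y z _ xy yz]; first exact: conn0.
apply: conn_adj xy _; rewrite adj_bview !ptK; first by rewrite -adj_bview.
  exact: leq_trans (normoo_pos _) NN'.
exact: leq_trans (normoo_pos _) NN'.
Qed.

Lemma cluster_refl w x : Defs.cluster w x x. Proof. by exists [::]. Qed.

Lemma cluster_adj w x y z : Defs.cluster w x y -> open_adj w y z -> Defs.cluster w x z.
Proof.
move=> [s [xs sy]] yz; exists (rcons s z); split; last by rewrite last_rcons.
by rewrite rcons_path xs sy.
Qed.

Lemma cluster_ind w x (Q : vertex d -> Prop) : Q x ->
  (forall y z, Defs.cluster w x y -> Q y -> open_adj w y z -> Q z) ->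
  forall y, Defs.cluster w x y -> Q y.
Proof.
move=> Qx Qs y [s []]; elim/last_ind: s y => [|s t IH] y; first by move=> _ <-.
rewrite rcons_path last_rcons => /andP[xs st] <-.
by apply: (Qs (last x s)) => //; [exists s|exact: IH].
Qed.

Lemma conn_cluster N w (x y : bvertex d N) :
  conn (@binc d N) (bview N 0 w) x y -> Defs.cluster w (pos x) (pos y).
Proof.
move: y; apply: conn_ind => [|y z _ xy]; first exact: cluster_refl.
by rewrite adj_bview !addr0; exact: cluster_adj.
Qed.

Lemma cluster_conn w x y : Defs.cluster w x y -> exists N0, forall N, (N0 <= N)%N ->
  conn (@binc d N) (bview N 0 w) (pt N x) (pt N y).
Proof.
move: y; apply: cluster_ind => [|y z _ [N0 H] yz]; first by exists 0%N => N _; exact: conn0.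
exists (maxn N0 (maxn (normoo y) (normoo z))) => N; rewrite !geq_max => /and3P[NN yN zN].
by apply: conn_adj (H N NN) _; rewrite adj_bview !ptK // !addr0.
Qed.

(** If the cluster inside the box of radius [m] has fewer than [m] vertices, it stays at norm less
    than [m], so it is the whole lattice cluster and is finite. *)
Lemma infinite_cluster w : infinite_set (Defs.cluster w 0) <->
  forall m, (m <= #|cl (@binc d m) (bview m 0%R w) (pt m 0%R)|)%N.
Proof.
split=> [inf m|H].
  rewrite leqNgt; apply/negP => clm; apply: inf.
  have sb := sball_full clm.
  apply: (@sub_finite_set _ _ ((@pos d m) @` [set` cl (@binc d m) (bview m 0 w) (pt m 0)])).
    have p0 : pos (pt m 0) = 0 :> vertex d by rewrite ptK ?normoo0.
    apply: cluster_ind => [|y z _ [u /= ucl uy] yz].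
      by exists (pt m 0) => //=; rewrite inE conn0.
    move: (ucl); rewrite -sb => /(sball_embed (N' := m) (a' := 0) (x' := pt m 0) erefl).
    rewrite p0 normoo0 add0n => /(_ (leqnSn m)) [un _].
    rewrite addr0 subr0 uy in un.
    have zm : (normoo z <= m)%N.
      by apply: leq_trans (norm1_normoo (open_adj_norm yz)) _.
    exists (pt m z); last by rewrite ptK.
    rewrite /= sb inE; apply: (@conn_adj _ _ _ _ _ u); first by rewrite inE in ucl.
    by rewrite adj_bview ptK // uy !addr0.
  by apply: finite_image; exact: finite_finset.
move=> /finite_fsetP[F FE]; have := H #|` F|.+1; rewrite ltnNge => /negP; apply.
set m := #|` F|.+1; have p0 : pos (pt m 0) = 0 :> vertex d by rewrite ptK ?normoo0.
rewrite cardE -(size_map (@pos d m)); apply: uniq_leq_size.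
  by rewrite map_inj_uniq ?enum_uniq //; exact: pos_inj.
move=> _ /mapP[y + ->]; rewrite mem_enum inE => /conn_cluster; rewrite p0 => yc.
by have : [set` F] (pos y) by rewrite -FE.
Qed.

End BoxConfiguration.

(** * Two-point function and volume tail across boxes *)

Section BoxProbability.
Variables (R : realType) (d : nat).
Implicit Types (p : R) (N m : nat) (x y : vertex d).

Definition btau N p (x y : bvertex d N) : R := tau (@binc d N) (fun=> p) x y.

Definition vtail N p m (x : bvertex d N) : R :=
  Pr (fun=> p) (fun w => m <= #|cl (@binc d N) w x|)%N.

Local Notation law p := (percolation d p).

Lemma btauE N p a (x y : bvertex d N) : 0 <= p <= 1 ->
  law p [set w | conn (@binc d N) (bview N a w) x y] = (btau p x y)%:E.
Proof.
move=> /percolationP Pp.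
exact: (P_view (Pp d) (@shift_edge_inj d N a) (fun w => conn (@binc d N) w x y)).
Qed.

(** Translation invariance without moving the measure: the second box is placed so that [x] and [x']
    are the same lattice site, and both events are read in one configuration. *)
Lemma vtail_le N N' p m (x : bvertex d N) (x' : bvertex d N') : 0 <= p <= 1 ->
  (normoo (pos x') + m <= N'.+1)%N -> vtail p m x <= vtail p m x'.
Proof.
move=> /percolationP Pp xm.
have H M a (y : bvertex d M) := view_event (Pp d) (@shift_edge_inj d M a)
  (fun w => m <= #|cl (@binc d M) w y|)%N.
rewrite -lee_fin /vtail -(H _ 0 x).2 -(H _ (pos x - pos x') x').2.
apply: le_measure; rewrite ?inE; [exact: (H _ 0 x).1|exact: (H _ _ x').1|].
move=> w /=; rewrite -!/(bview _ _ _) => /card_sball mx.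
apply: leq_trans (sball_card_cl _ _ _ m); apply: leq_trans mx _.
by apply: card_sball_embed; rewrite // addr0 addrC subrK.
Qed.

Let measurable_conn N a (x y : bvertex d N) :
  measurable [set w | conn (@binc d N) (bview N a w) x y].
Proof.
have P0 : bernoulli_law (0 : R) (law 0) by apply: percolationP; rewrite lexx ler01.
exact: (measurable_view P0 (@shift_edge_inj d N a) (fun w => conn (@binc d N) w x y)).
Qed.

Let clusterE x y : [set w | Defs.cluster w x y] =
  \bigcup_k [set w | conn (@binc d (k + maxn (normoo x) (normoo y)))
    (bview (k + maxn (normoo x) (normoo y)) 0 w) (pt _ x) (pt _ y)].
Proof.
apply/seteqP; split=> w /=.
  by move=> /cluster_conn[N0 H]; exists N0 => //=; apply: H; exact: leq_addr.
by move=> [k _] /= /conn_cluster; rewrite !ptK //; lia.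
Qed.

Lemma measurable_cluster x y : measurable [set w | Defs.cluster w x y].
Proof.
rewrite clusterE; apply: bigcup_measurable => k _.
exact: measurable_conn.
Qed.

Lemma btau_le_law N p (x y : bvertex d N) : 0 <= p <= 1 ->
  ((btau p x y)%:E <= law p [set w | Defs.cluster w (pos x) (pos y)])%E.
Proof.
move=> p01; rewrite -(btauE 0 x y p01); apply: le_measure; rewrite ?inE.
- exact: measurable_conn.
- exact: measurable_cluster.
- by move=> w /= /conn_cluster.
Qed.

Lemma law_lt_btau p x y (t : R) : 0 <= p <= 1 ->
  (t%:E < law p [set w | Defs.cluster w x y])%E ->
  exists N0, forall N, (N0 <= N)%N -> t < btau p (pt N x) (pt N y).
Proof.
move=> p01; rewrite clusterE.
pose F k := [set w | conn (@binc d (k + maxn (normoo x) (normoo y)))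
    (bview (k + maxn (normoo x) (normoo y)) 0 w) (pt _ x) (pt _ y)].
rewrite -[X in law p X]/(\bigcup_k F k).
have mF k : measurable (F k).
  exact: measurable_conn.
have ndF : nondecreasing_seq F.
  move=> k l kl; apply/subsetPset => w; rewrite /F /=.
  have kl' : (k + maxn (normoo x) (normoo y) <= l + maxn (normoo x) (normoo y))%N by lia.
  by move=> /(conn_embed kl'); rewrite !ptK //; lia.
have cv := nondecreasing_cvg_mu (mu := law p) mF (bigcup_measurable (fun k _ => mF k)) ndF.
move=> tP; have [k _ H] := cv _ (open_ereal_gt' tP).
exists (k + maxn (normoo x) (normoo y))%N => N kN; rewrite -lte_fin -(btauE 0) //.
have -> : N = (N - maxn (normoo x) (normoo y) + maxn (normoo x) (normoo y))%N by lia.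
by apply: H => /=; lia.
Qed.

Local Notation pc := (critical_prob R d).

Let pc_set := [set p : R | 0 <= p <= 1 /\
  (0 < law p [set w | infinite_set (Defs.cluster w 0%R)])%E].

Let pc_lb : has_lbound pc_set.
Proof. by exists 0 => p [/andP[]]. Qed.

Lemma critical_prob01 : 0 <= pc <= 1.
Proof.
have [[p pS]|/set0P/negP/negPn/eqP S0] := pselect (pc_set !=set0); last first.
  (* The infimum of the empty set is 0 by convention. *)
  by rewrite /critical_prob -/pc_set S0 inf0 lexx ler01.
apply/andP; split.
  by apply: lb_le_inf; [exists p|move=> q [/andP[]]].
by apply: le_trans (ge_inf pc_lb pS) _; case: pS => /andP[].
Qed.

(** Below the infimum the cluster is almost surely finite, and the tails decrease to the event that
    it is infinite. *)
Lemma vtail_cvg0 p (t : R) : 0 <= p < pc -> 0 < t ->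
  exists m, vtail p m (pt m (0 : vertex d)) < t.
Proof.
move=> /andP[p0 ppc] t0.
have p01 : 0 <= p <= 1.
  by rewrite p0 (le_trans (ltW ppc)) //; case/andP: critical_prob01.
pose F m := [set w : config d | (m <= #|cl (@binc d m) (bview m 0%R w) (pt m 0%R)|)%N].
have FE (m : nat) : measurable (F m) /\ law p (F m) = (vtail p m (pt m (0 : vertex d)))%:E.
  exact: (view_event (percolationP (d := d) p01) (@shift_edge_inj d m 0)
    (fun w => m <= #|cl (@binc d m) w (pt m 0%R)|)%N).
have infE : [set w | infinite_set (Defs.cluster w 0)] = \bigcap_m F m.
  apply/seteqP; split=> w /=.
    by move=> /infinite_cluster H m _; exact: H.
  by move=> H; apply/infinite_cluster => m; exact: H.
have mI : measurable (\bigcap_m F m) by apply: bigcapT_measurable => m; case: (FE m).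
have I0 : law p (\bigcap_m F m) = 0%E.
  apply/eqP; rewrite eq_le measure_ge0 andbT leNgt; apply/negP => I0.
  have pS : pc_set p by split; rewrite ?infE.
  have : pc <= p by exact: (ge_inf pc_lb pS).
  by rewrite leNgt ppc.
have ni : nonincreasing_seq F.
  move=> m m' mm'; apply/subsetPset => w; rewrite /F /= => clm'.
  have := card_sball (leq_trans mm' clm').
  move=> H; apply: leq_trans (sball_card_cl _ _ _ m); apply: leq_trans H _.
  by apply: card_sball_embed; rewrite !ptK ?normoo0 // leqnSn.
have F0 : (law p (F 0%N) < +oo)%E.
  by apply: le_lt_trans (probability_le1 _ (FE 0%N).1) _; rewrite ltry.
have cv := nonincreasing_cvg_mu (mu := law p) F0 (fun m => (FE m).1) mI ni.
have t0' : (law p (\bigcap_m F m) < t%:E)%E by rewrite I0 lte_fin.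
have [m _ /(_ m (leqnn m))] := cv _ (open_ereal_lt' t0').
by rewrite /= (FE m).2 lte_fin; exists m.
Qed.

Lemma btau0 N (x y : bvertex d N) : x != y -> btau (0 : R) x y = 0.
Proof.
move=> xy; apply: big1 => w _; have [->|[i iw]] := finset.set_0Vmem w.
  case c: (conn _ _ _ _); last by rewrite mulr0.
  move/negP: xy; case; apply/eqP.
  by move: y c; apply: conn_ind => // y z _ _ /adjP[i]; rewrite finset.inE.
by rewrite /wt (bigD1 i) //= iw !mul0r.
Qed.

Hypothesis hd : high_dimensional R d.

(** Nothing is connected at [p = 0], whereas at [p_c] the two-point function of neighbours is
    bounded below. Positivity makes the bridges affordable. *)
Lemma critical_prob_gt0 : 0 < pc.
Proof.
have /andP[p0 p1] := critical_prob01.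
rewrite lt_def p0 andbT; apply/eqP => pc0.
have [d6 [c [C [c0 C0 H]]]] := hd.
have i : 'I_d by exact: (Ordinal (ltn_trans (isT : 0 < 6)%N d6)).
pose e : vertex d := delta_mx ord0 i.
have e0 : e != 0 by rewrite -normoo_eq0 normoo_delta.
have ne : 0 <> e by apply/eqP; rewrite eq_sym.
have /andP[+ _] := H 0 e ne; rewrite sub0r normooN normoo_delta exp1rz mulr1 pc0.
move=> Hc; have [] := @law_lt_btau 0 0 e 0; rewrite ?lexx ?ler01 //.
  by apply: lt_le_trans Hc; rewrite lte_fin.
move=> N0 /(_ (maxn N0 1)); rewrite leq_maxl => /(_ isT).
rewrite btau0 ?ltxx //; apply: contra e0 => /eqP/(congr1 (@pos _ _)).
by rewrite !ptK ?normoo0 ?normoo_delta ?leq_maxr // => <-.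
Qed.

Lemma expz_dim (r : R) : r ^ (2%:Z - d%:Z) = (r ^+ (d - 2))^-1.
Proof.
have [d6 _] := hd.
have -> : 2%:Z - d%:Z = - (d - 2)%N%:Z by lia.
by rewrite exprnN.
Qed.

(** The upper two-point bound at [p_c] extends to all smaller [p] and all boxes by monotonicity. The
    summand 1 in the constant handles equal endpoints. *)
Lemma btau_ker : exists2 C : R, 1 <= C & forall p N J (x y : bvertex d N),
  0 <= p <= pc -> (0 < J)%N -> (N.*2 <= 2 ^ J.-1)%N ->
  btau p x y <= C * ker R J (d - 2) 0 (pos x - pos y).
Proof.
have [d6 [c [C [c0 C0 H]]]] := hd.
have /andP[pc0 pc1] := critical_prob01.
exists (1 + C * 2 ^+ (d - 2)); first by rewrite lerDl mulr_ge0 ?exprn_ge0 // ltW.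
move=> p N J x y /andP[p0 ppc] J0 NJ.
have C2 : 0 <= C * 2 ^+ (d - 2) by rewrite mulr_ge0 ?exprn_ge0 // ltW.
have [->|xy] := eqVneq x y.
  rewrite subrr; apply: le_trans (Pr_le1 _ _) _; first by move=> _; rewrite p0 (le_trans ppc).
  have := @ker_center R J d (d - 2) 0 J0; set k := ker _ _ _ _ _ => k1.
  by apply: mulr_ege1; rewrite // lerDl.
have xy' : pos x <> pos y by move=> /pos_inj/eqP; rewrite (negbTE xy).
have n0 : (0 < normoo (pos x - pos y)%R)%N by rewrite lt0n normoo_eq0 subr_eq0; apply/eqP.
have nJ : (normoo (pos x - pos y)%R <= 2 ^ J.-1)%N.
  apply: leq_trans NJ; apply: leq_trans (normooD _ _) _; rewrite normooN -addnn.
  by apply: leq_add; exact: normoo_pos.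
have k0 := ker_ge0 R J (d - 2) 0 (pos x - pos y).
have klb := @ker_lb R J d (d - 2) (pos x - pos y) n0 nJ J0.
apply: le_trans (_ : C * (2 ^+ (d - 2) * ker R J (d - 2) 0 (pos x - pos y)) <= _); last first.
  by rewrite mulrDl mul1r mulrA lerDr.
apply: le_trans (ler_wpM2l (ltW C0) klb); rewrite -expz_dim.
apply: le_trans (_ : btau pc x y <= _).
  by apply: Pr_le_param => //; exact: conn_incr.
rewrite -lee_fin; have /andP[_ H2] := H _ _ xy'.
exact: le_trans (btau_le_law x y critical_prob01) H2.
Qed.

End BoxProbability.

(** * Volume tail at the critical point *)

Section CriticalVolumeTail.
Variables (R : realType) (d : nat).
Hypothesis hd : high_dimensional R d.
Local Notation pc := (critical_prob R d).

Let subcritical_tail : exists C : R, forall p m, pc / 2 <= p -> p < pc ->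
  m%:R * vtail p m (pt m (0 : vertex d)) ^+ 2 <= C.
Proof.
have [d6 _] := hd; have [Ct Ct1 tk] := btau_ker hd.
have pc0 := critical_prob_gt0 hd; have /andP[_ pc1] := critical_prob01 R d.
have Ct0 : 0 <= Ct by rewrite (le_trans ler01).
pose B := Ct ^+ 3 * (triangle_cst R d * 8).
(* [2^n >= 16 B] makes the open triangle of width [2^n] satisfy [16 eps <= 1], uniformly in [p]
   between [pc / 2] and [pc]. *)
pose n := Num.Def.archi_bound (16 * B).
have B0 : 0 <= B by rewrite !mulr_ge0 ?exprn_ge0 ?triangle_cst_ge0.
have nB : 16 * (Ct ^+ 3 * (triangle_cst R d * (8 * 2^-1 ^+ n))) <= 1.
  have e0 : 0 < 2 ^+ n :> R by rewrite exprn_gt0.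
  have -> : 16 * (Ct ^+ 3 * (triangle_cst R d * (8 * 2^-1 ^+ n))) = 16 * B / 2 ^+ n.
    by rewrite /B exprVn; ring.
  rewrite ler_pdivrMr // mul1r; apply: le_trans (_ : n%:R <= _).
    by rewrite ltW // archi_boundP // mulr_ge0.
  by rewrite -natrX ler_nat ltnW // ltn_expl.
exists (4 * (1 + 30 * mag_cst d (pc / 2) n)) => p m pp ppc.
have p2 : 0 < pc / 2 by rewrite divr_gt0.
have p0 : 0 <= p by rewrite (le_trans (ltW p2)).
have p1 : p <= 1 by rewrite (le_trans (ltW ppc)).
apply: (@volume_tail_subcritical R d d6 Ct (pc / 2) n Ct0 p2 nB p pp p1).
- by move=> N J x y J0 NJ; apply: tk => //; rewrite p0 ltW.
- by move=> N N' k x x' H; apply: vtail_le H; rewrite p0.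
- by move=> t t0; apply: vtail_cvg0 => //; rewrite p0.
Qed.

Let expr_one_sub_ge (x : R) n : 0 <= x <= 1 -> 1 - n%:R * x <= (1 - x) ^+ n.
Proof.
move=> /andP[x0 x1]; elim: n => [|n IH]; first by rewrite mul0r subr0 expr0.
rewrite exprS -[n.+1%:R]natr1.
have b0 : 0 <= 1 - x by rewrite subr_ge0.
have := ler_wpM2l b0 IH; have := mulr_ge0 (ler0n R n) (mulr_ge0 x0 x0); lra.
Qed.

Lemma volume_tail_critical : exists C : nat, forall N m (x : bvertex d N),
  m%:R * vtail pc m x ^+ 2 <= C%:R.
Proof.
have [C HC] := subcritical_tail.
have pc0 := critical_prob_gt0 hd; have /andP[_ pc1] := critical_prob01 R d.
exists (Num.Def.archi_bound (4 * C)) => N m x.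
have C0 : 0 <= C.
  have := HC (pc / 2) 0%N (lexx _); rewrite mul0r; apply.
  by rewrite ltr_pdivrMr // mulr_natr mulr2n ltrDl.
apply: le_trans (_ : 4 * C <= _); last by rewrite ltW // archi_boundP // mulr_ge0.
have v0 (q : R) M (y : bvertex d M) : 0 <= q <= 1 -> 0 <= vtail q m y.
  by move=> q01; apply: Pr_ge0.
have pc01 : 0 <= pc <= 1 by rewrite (ltW pc0).
apply: le_trans (_ : m%:R * vtail pc m (pt m (0 : vertex d)) ^+ 2 <= _).
  apply: ler_wpM2l; first exact: ler0n.
  apply: lerXn2r; rewrite ?nnegrE ?v0 //.
  by apply: vtail_le; rewrite // ptK ?normoo0.
have [K KE] : exists K, K = #|{: bedge d m}| by exists #|{: bedge d m}|.
(* [p = pc (1 - h)] is so close to [pc] that the factor [(1 - h)^-K] for the [K] edges of the box is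
   at most 2; squaring it gives the 4 in [4 C]. *)
pose h : R := (2 * K.+1%:R)^-1.
have K0 : 0 < K.+1%:R :> R by rewrite ltr0n.
have h0 : 0 < h by rewrite invr_gt0 mulr_gt0.
have Kh : K.+1%:R * h = 2^-1 by rewrite /h; field; rewrite gt_eqF // nat1r.
have h2 : h <= 2^-1 by rewrite -Kh; apply: ler_peMl; [exact: ltW|rewrite ler1n].
have h01 : 0 <= h <= 1 by rewrite ltW //=; lra.
have b0 : 0 < 1 - h by lra.
pose p := pc * (1 - h).
have pp : pc / 2 <= p by rewrite ler_pM2l //; lra.
have ppc : p < pc by rewrite gtr_pMr //; lra.
have tb : (1 - h)^-1 ^+ K <= 2.
  rewrite exprVn invf_ple ?posrE ?exprn_gt0 //.
  apply: le_trans (expr_one_sub_ge K h01).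
  have : K%:R * h <= K.+1%:R * h by rewrite ler_wpM2r ?ler_nat ?ltW.
  by rewrite Kh; lra.
have p0 : 0 <= p by rewrite mulr_ge0 // ltW.
have p01 : 0 <= p <= 1 by rewrite p0 (le_trans (ltW ppc)).
have vv : vtail pc m (pt m (0 : vertex d)) <= 2 * vtail p m (pt m (0 : vertex d)).
  apply: le_trans (_ : (1 - h)^-1 ^+ K * vtail p m (pt m (0 : vertex d)) <= _).
    rewrite KE; apply: Pr_ge_param => // [_||_]; first exact: ltW.
      by rewrite invf_ge1 //; lra.
    by rewrite /p mulrCA mulVf ?mulr1 // gt_eqF.
  by apply: ler_wpM2r => //; exact: v0.
have := HC p m pp ppc; move: vv (v0 _ _ (pt m 0) pc01) (v0 _ _ (pt m 0) p01).
move: (vtail _ m _) (vtail _ m _) => b a ab a0 b0' Hb.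
apply: le_trans (_ : m%:R * (2 * b) ^+ 2 <= _).
  by apply: ler_wpM2l; rewrite ?ler0n // !expr2 ler_pM.
by rewrite exprMn; lra.
Qed.

End CriticalVolumeTail.

(** * One-arm and chemical distance *)

Lemma dyadic_scale n : (0 < n)%N -> exists a, (n <= 2 ^ a <= n.*2)%N.
Proof.
move=> n0; exists (up_log 2 n); rewrite up_logP //=.
have [n1|n1] := leqP n 1.
  by have -> : n = 1%N by apply/eqP; rewrite eqn_leq n1.
have j0 : (0 < up_log 2 n)%N by rewrite up_log_gt0.
by rewrite -(prednK j0) expnS mul2n leq_double ltnW // up_log_gtn.
Qed.

Lemma expn_superadd (a b k : nat) : (0 < k)%N -> (a ^ k + b ^ k <= (a + b) ^ k)%N.
Proof.
case: k => // k _; elim: k => [|k IH]; first by rewrite !expn1.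
rewrite expnS [X in (_ + X <= _)%N]expnS [leqRHS]expnS.
apply: leq_trans (leq_mul (leqnn (a + b)%N) IH).
rewrite mulnDl; apply: leq_add; rewrite leq_mul2l.
  by rewrite leq_addr orbT.
by rewrite leq_addl orbT.
Qed.

Section BoundaryEvents.
Variables (d n : nat).
Implicit Types (w : config d).

Definition on_boundary (v : bvertex d n) : bool := `[< boundary (@box d n) (pos v) >].

Definition reaches (w : {set bedge d n}) : bool :=
  [exists v, on_boundary v && conn (@binc d n) w (pt n 0) v].

Let p0 : pos (pt n 0) = 0 :> vertex d. Proof. by rewrite ptK ?normoo0. Qed.

Lemma exits_boundary w (x y : vertex d) : (normoo x <= n)%N -> open_adj w x y ->
  ~ (normoo y <= n)%N -> on_boundary (pt n x).
Proof.
move=> xn xy yn; apply/asboolP; rewrite ptK //; split=> //; exists y; split=> //.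
exact: open_adj_norm xy.
Qed.

Lemma connected_toE : connected_to 0 (boundary (@box d n)) =
  [set w : config d | reaches (bview n 0 w)].
Proof.
apply/seteqP; split=> w /=.
  move=> [y by_ yc]; have [yn _] := by_.
  have [[_ c]|//] : ((normoo y <= n)%N /\ conn (@binc d n) (bview n 0 w) (pt n 0) (pt n y)) \/
      reaches (bview n 0 w).
    move: y yc {by_ yn}; apply: cluster_ind => [|y z _ [[yn c]|?] yz]; last by right.
      by left; rewrite normoo0; split=> //; exact: conn0.
    have [zn|zn] := boolP (normoo z <= n)%N.
      left; split=> //; apply: conn_adj c _.
      by rewrite adj_bview !ptK // !addr0.
    right; apply/existsP; exists (pt n y); rewrite c andbT.
    by apply: (exits_boundary yn yz); apply/negP.
  apply/existsP; exists (pt n y); rewrite c andbT; apply/asboolP; by rewrite ptK.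
move=> /existsP[v /andP[/asboolP bv c]]; exists (pos v) => //.
by move: (conn_cluster c); rewrite p0.
Qed.

Lemma cluster_exits w (y : vertex d) : Defs.cluster w 0 y -> (n < normoo y)%N ->
  connected_to 0 (boundary (@box d n)) w.
Proof.
move=> yc yn.
have [|//] : (normoo y <= n)%N \/ connected_to 0 (boundary (@box d n)) w.
  move: y yc {yn}; apply: cluster_ind => [|y z yc [yn|?] yz]; last by right.
    by left; rewrite normoo0.
  have [zn|/negP zn] := boolP (normoo z <= n)%N; first by left.
  right; exists y => //; have /asboolP := exits_boundary yn yz zn.
  by rewrite ptK.
by rewrite leqNgt yn.
Qed.

End BoundaryEvents.

(** * Lower bound on the one-arm probability *)

Section OneArm.
Variables (R : realType) (d : nat).
Hypothesis hd : high_dimensional R d.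
Local Notation pc := (critical_prob R d).

Let d6 : (6 < d)%N. Proof. by case: hd. Qed.

Let pc01 : 0 <= pc <= 1. Proof. exact: critical_prob01. Qed.

Let o N : bvertex d N := pt N 0.

(** One box serves all endpoints because there are finitely many of them; half of the constant is
    given up in passing from the lattice to the box. *)
Let btau_ge : exists2 c : R, 0 < c & forall n, (0 < n)%N -> exists2 N, (n <= N)%N &
  forall u : bvertex d n, (0 < normoo (pos u))%N ->
    c / n%:R ^+ (d - 2) <= btau pc (o N) (pt N (pos u)).
Proof.
have [_ [c [C [c0 C0 H]]]] := hd; exists (c / 2); first by rewrite divr_gt0.
move=> n n0.
have n0' : 0 < n%:R ^+ (d - 2) :> R by rewrite exprn_gt0 // ltr0n.
have ex (u : bvertex d n) : exists N0, (0 < normoo (pos u))%N -> forall N, (N0 <= N)%N ->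
    c / 2 / n%:R ^+ (d - 2) < btau pc (o N) (pt N (pos u)).
  have [u0|u0] := boolP (0 < normoo (pos u))%N; last by exists 0%N.
  have u0' : 0 <> pos u by move=> E; move: u0; rewrite -E normoo0.
  have /andP[Hu _] := H _ _ u0'; rewrite sub0r normooN expz_dim // in Hu.
  have [|N0 HN] := @law_lt_btau R d pc 0 (pos u) (c / 2 / n%:R ^+ (d - 2)) pc01.
    apply: lt_le_trans Hu; rewrite lte_fin.
    have ug : 0 < (normoo (pos u))%:R ^+ (d - 2) :> R by rewrite exprn_gt0 // ltr0n.
    apply: lt_le_trans (_ : c / n%:R ^+ (d - 2) <= _).
      by rewrite ltr_pM2r ?invr_gt0 //; lra.
    rewrite ler_pM2l // lef_pV2 ?posrE // lerXn2r ?nnegrE ?ler0n //.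
    by rewrite ler_nat normoo_pos.
  by exists N0.
have [f Hf] := fin_all_exists ex.
exists (maxn n (\sum_u f u)%N); first exact: leq_maxl.
move=> u u0; apply/ltW/Hf => //.
by apply: leq_trans (leq_maxr _ _); rewrite (bigD1 u) //= leq_addr.
Qed.

(** The tree-graph bound leaves a vertex [x] joined to 0, [u] and [v]. Summing over [v] gives order
    [n^2], and the remaining bubble summed over [u] gives order [n^4]. *)
Let second_moment : exists2 C : R, 0 < C & forall n N, (0 < n)%N -> (n <= N)%N ->
  \sum_(u : bvertex d n) \sum_(v : bvertex d n)
    Pr (fun=> pc) (fun w => conn (@binc d N) w (o N) (pt N (pos u)) &&
                            conn (@binc d N) w (o N) (pt N (pos v)))
  <= C * n%:R ^+ 6.
Proof.
have [Ct Ct1 tk] := btau_ker hd.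
have Ct0 : 0 <= Ct by rewrite (le_trans ler01).
pose c0 : R := cball R d 0; pose c1 : R := cball R d 1.
have c00 : 0 <= c0 by exact: ler0n. have c10 : 0 <= c1 by exact: ler0n.
exists (Ct ^+ 3 * (3 * c0) * (6 * c0 * (3 * c1)) * 2 ^+ 6 + 1).
  by rewrite ltr_wpDl // !mulr_ge0 ?exprn_ge0.
move=> n N n0 nN; have [a /andP[na an]] := dyadic_scale n0.
pose J := (N.*2).+1; pose ker2 := @ker R J d (d - 2) 0.
have k0 s m z : 0 <= ker R J s m z := ker_ge0 R J s m z.
have tk' (x y : bvertex d N) : btau pc x y <= Ct * ker2 (pos x - pos y).
  by apply: tk; rewrite ?lexx ?andbT //; [case/andP: pc01|rewrite ltnW // ltn_expl].
have posN (u : bvertex d n) : pos (pt N (pos u)) = pos u.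
  by rewrite ptK // (leq_trans (normoo_pos u)).
pose G : R := 3 * c0 * 2 ^+ (2 * a).
have ball_all (u : bvertex d n) : (normoo (0 - pos u)%R <= 2 ^ a)%N.
  by rewrite sub0r normooN (leq_trans (normoo_pos u)).
have gG (x : vertex d) : \sum_(u : bvertex d n) ker2 (x - pos u) <= G.
  apply: le_trans (_ : \sum_(u : bvertex d n | (normoo (0 - pos u)%R <= 2 ^ a)%N)
    ker2 (x - pos u) <= _).
    by rewrite big_mkcond [leRHS]big_mkcond; apply: ler_sum => u _; rewrite ball_all.
  by apply: ker_ball; lia.
have tree (u v : bvertex d n) :
    Pr (fun=> pc) (fun w => conn (@binc d N) w (o N) (pt N (pos u)) &&
                            conn (@binc d N) w (o N) (pt N (pos v))) <=
    \sum_(x : bvertex d N) Ct ^+ 3 *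
      (ker2 (pos x) * (ker2 (pos x - pos u) * ker2 (pos x - pos v))).
  have := @tree_graph R _ _ _ (@binc_sym d N) (@binc_uniq d N) (fun=> pc) (fun=> pc01)
    (o N) (pt N (pos u)) (pt N (pos v)) xpredT (fun _ _ _ _ => isT).
  rewrite (_ : Pr (fun=> pc) (fun w => [&& conn (@binc d N) w (o N) (pt N (pos u)),
      conn (@binc d N) w (o N) (pt N (pos v)) & true]) =
    Pr (fun=> pc) (fun w => conn (@binc d N) w (o N) (pt N (pos u)) &&
      conn (@binc d N) w (o N) (pt N (pos v)))); last by apply: eq_Ex => w; rewrite andbT.
  move=> /le_trans; apply; apply: ler_sum => x _.
  have -> : Pr (fun=> pc) (fun w => conn (@binc d N) w (o N) x && true) = btau pc (o N) x.
    by apply: eq_Ex => w; rewrite andbT.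
  have t1 := tk' (o N) x; rewrite ptK ?normoo0 // sub0r /ker2 kerN in t1.
  have t2 := tk' x (pt N (pos u)); have t3 := tk' x (pt N (pos v)).
  rewrite !posN in t2 t3.
  have b0 (y z : bvertex d N) : 0 <= btau pc y z by apply: tau_ge0.
  apply: le_trans (ler_pM (b0 _ _) (mulr_ge0 (b0 _ _) (b0 _ _)) t1
    (ler_pM (b0 _ _) (b0 _ _) t2 t3)) _.
  by rewrite le_eqVlt; apply/orP; left; apply/eqP; rewrite /ker2; ring.
apply: le_trans (_ : Ct ^+ 3 * (G * \sum_(u : bvertex d n) \sum_(x : bvertex d N)
    ker2 (pos x) * ker2 (pos x - pos u)) <= _).
  apply: le_trans (_ : \sum_(u : bvertex d n) \sum_(v : bvertex d n) \sum_(x : bvertex d N)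
    Ct ^+ 3 * (ker2 (pos x) * (ker2 (pos x - pos u) * ker2 (pos x - pos v))) <= _).
    by apply: ler_sum => u _; apply: ler_sum => v _; exact: tree.
  rewrite big_distrr big_distrr; apply: ler_sum => u _ /=.
  rewrite exchange_big big_distrr big_distrr; apply: ler_sum => x _ /=.
  rewrite -big_distrr /= ler_wpM2l ?exprn_ge0 //.
  rewrite (eq_bigr (fun v : bvertex d n => ker2 (pos x) * ker2 (pos x - pos u) *
    ker2 (pos x - pos v))); last by move=> v _; rewrite mulrA.
  rewrite -big_distrr /= [leRHS]mulrC; apply: ler_wpM2l; last exact: gG.
  by apply: mulr_ge0; exact: k0.
have bub : \sum_(u : bvertex d n) \sum_(x : bvertex d N)
    ker2 (pos x) * ker2 (pos x - pos u) <= 6 * c0 * (3 * c1 * 2 ^+ (4 * a)).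
  apply: le_trans (_ : \sum_(u : bvertex d n) 6 * c0 * ker R J (d - 4) 1 (0 - pos u) <= _).
    apply: ler_sum => u _; apply: le_trans (bubble_ker R J d6 N 0 (pos u)).
    apply: ler_sum => x _; rewrite sub0r kerN -[pos u - _]opprB kerN //.
  rewrite -big_distrr /=; apply: ler_wpM2l; first by rewrite mulr_ge0.
  apply: le_trans (_ : \sum_(u : bvertex d n | (normoo (0 - pos u)%R <= 2 ^ a)%N)
    ker R J (d - 4) 1 (0 - pos u) <= _).
    by rewrite big_mkcond [leRHS]big_mkcond; apply: ler_sum => u _; rewrite ball_all.
  by apply: ker_ball; lia.
have G0 : 0 <= G by rewrite !mulr_ge0 ?exprn_ge0.
apply: le_trans (ler_wpM2l (exprn_ge0 3 Ct0) (ler_wpM2l G0 bub)) _.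
have n60 : 0 <= n%:R ^+ 6 :> R by rewrite exprn_ge0.
have aE : 2 ^+ (2 * a) * 2 ^+ (4 * a) <= 2 ^+ 6 * n%:R ^+ 6 :> R.
  rewrite -exprD -mulnDl mulnC exprM -exprMn.
  apply: lerXn2r; rewrite ?nnegrE ?exprn_ge0 ?mulr_ge0 //.
  by rewrite -natrX -natrM ler_nat mul2n.
have K0 : 0 <= Ct ^+ 3 * (3 * c0) * (6 * c0 * (3 * c1)) by rewrite !mulr_ge0 ?exprn_ge0.
apply: le_trans (_ : Ct ^+ 3 * (3 * c0) * (6 * c0 * (3 * c1)) * (2 ^+ (2 * a) * 2 ^+ (4 * a)) <= _).
  by rewrite le_eqVlt; apply/orP; left; apply/eqP; rewrite /G; ring.
apply: le_trans (ler_wpM2l K0 aE) _.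
move: K0 => _; move: (_ * _ * _) (2 ^+ 6) (n%:R ^+ 6) n60 => K t q q0.
by rewrite mulrA mulrDl mul1r lerDl.
Qed.

Lemma one_arm_lower : exists2 c : R, 0 < c & forall n, (0 < n)%N ->
  ((c / n%:R ^+ 2)%:E <=
   percolation d pc (connected_to 0%R (boundary (@box d n))))%E.
Proof.
have [c c0 Hc] := btau_ge; have [C C0 HC] := second_moment.
exists (c ^+ 2 / (4 * C)); first by rewrite divr_gt0 ?exprn_gt0 ?mulr_gt0.
move=> n n0; have n20 : (0 < n.*2)%N by rewrite double_gt0.
have [N nN HN] := Hc _ n20; have HCn := HC _ _ n20 nN.
pose T := [set u : bvertex d n.*2 | (n < normoo (pos u))%N]%SET.
pose X (w : {set bedge d N}) : R :=
  \sum_(u in T) (conn (@binc d N) w (o N) (pt N (pos u)))%:R.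
pose hit (w : {set bedge d N}) := [exists u in T, conn (@binc d N) w (o N) (pt N (pos u))].
have r0 : 0 < n%:R :> R by rewrite ltr0n.
(* The annulus has at least [(4n+1)^d - (2n+1)^d >= (2n)^d] vertices, by superadditivity of the
   power. *)
have cardT : (n.*2 ^ d <= #|T|)%N.
  have TC : (#|~: T| <= n.*2.+1 ^ d)%N.
    apply: leq_trans (card_ball n.*2 (0 : vertex d) n); apply: subset_leq_card.
    by apply/fintype.subsetP => u; rewrite !finset.inE -leqNgt sub0r normooN.
  have := cardsC T; rewrite card_bvertex => TT.
  have : (n.*2.+1 ^ d + n.*2 ^ d <= (n.*2.+1 + n.*2) ^ d)%N.
    by apply: expn_superadd; lia.
  have -> : (n.*2.+1 + n.*2 = n.*2.*2.+1)%N by lia.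
  by rewrite -TT; lia.
have EX : c * (2 * n%:R) ^+ 2 <= Ex (fun=> pc) X.
  rewrite /X Ex_sum.
  apply: le_trans (_ : \sum_(u in T) c / n.*2%:R ^+ (d - 2) <= _); last first.
    by apply: ler_sum => u; rewrite finset.inE => uT; apply: HN; lia.
  rewrite sumr_const -[leRHS]mulr_natl.
  have e0 : 0 < n.*2%:R ^+ (d - 2) :> R by rewrite exprn_gt0 // ltr0n.
  rewrite mulrA ler_pdivlMr //.
  apply: le_trans (_ : (n.*2 ^ d)%:R * c <= _); last by rewrite ler_wpM2r ?ler_nat // ltW.
  rewrite -natrM mul2n -mulrA -exprD natrX mulrC.
  by have -> : (2 + (d - 2) = d)%N by lia.
have EX2 : Ex (fun=> pc) (fun w => X w ^+ 2) <= C * n.*2%:R ^+ 6.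
  apply: le_trans HCn.
  apply: le_trans (_ : Ex (fun=> pc) (fun w => \sum_(u : bvertex d n.*2)
    \sum_(v : bvertex d n.*2) (conn (@binc d N) w (o N) (pt N (pos u)) &&
      conn (@binc d N) w (o N) (pt N (pos v)))%:R) <= _); last first.
    by rewrite Ex_sum; apply: ler_sum => u _; rewrite Ex_sum.
  apply: le_Ex => // w; rewrite expr2 /X big_distrl big_mkcond /=.
  apply: ler_sum => u _; case: ifP => _; last by apply: sumr_ge0.
  rewrite big_distrr big_mkcond /=; apply: ler_sum => v _; case: ifP => _ //.
  by rewrite -natrM mulnb.
have CS : Ex (fun=> pc) X ^+ 2 <= Ex (fun=> pc) (fun w => X w ^+ 2) * Pr (fun=> pc) hit.
  have -> : Ex (fun=> pc) X = Ex (fun=> pc) (fun w => X w * (hit w)%:R).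
    apply: eq_Ex => w; case: (boolP (hit w)) => [_|]; first by rewrite mulr1.
    rewrite negb_exists mulr0 => /forallP H; apply: big1 => u uT.
    by have := H u; rewrite uT /= => /negbTE ->.
  apply: le_trans (Ex_CauchySchwarz _ _ _) _ => //.
  apply: ler_wpM2l; first by apply: Ex_ge0 => // w; exact: sqr_ge0.
  by apply: le_Ex => // w; case: (hit w); rewrite ?expr1n ?expr0n.
have hit_lb : c ^+ 2 / (4 * C) / n%:R ^+ 2 <= Pr (fun=> pc) hit.
  have P0 : 0 <= Pr (fun=> pc) hit by apply: Pr_ge0.
  have := le_trans CS (ler_wpM2r P0 EX2).
  have : (c * (2 * n%:R) ^+ 2) ^+ 2 <= Ex (fun=> pc) X ^+ 2.
    apply: lerXn2r => //; rewrite nnegrE.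
      by rewrite mulr_ge0 ?exprn_ge0 ?mulr_ge0 ?ler0n // ltW.
    apply: le_trans EX; rewrite mulr_ge0 ?exprn_ge0 ?mulr_ge0 ?ler0n // ltW //.
  move=> /le_trans h /h; rewrite -muln2 natrM.
  move: (Pr _ hit) => q {}h.
  have n6 : 0 < n%:R ^+ 4 :> R by rewrite exprn_gt0.
  rewrite -mulrA -invfM ler_pdivrMr; last by rewrite !mulr_gt0 ?exprn_gt0.
  rewrite -(ler_pM2l n6); move: h.
  have -> : (c * (2 * n%:R) ^+ 2) ^+ 2 = 16 * (n%:R ^+ 4 * c ^+ 2) :> R by ring.
  (* First moment squared is at least [16 c^2 n^4] and second moment at most [64 C n^6]; the ratio
     is [c^2 / (4 C n^2)]. *)
  have -> : C * (n%:R * 2) ^+ 6 * q = 16 * (n%:R ^+ 4 * (q * (4 * C * n%:R ^+ 2))) :> R by ring.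
  by move: (_ ^+ 4 * _) (_ ^+ 4 * _) => u v; lra.
apply: le_trans (_ : (Pr (fun=> pc) hit)%:E <= _)%E; first by rewrite lee_fin.
have P_law := percolationP (d := d) pc01.
have [mh Ph] := view_event P_law (@shift_edge_inj d N 0) hit.
have [mr _] := view_event P_law (@shift_edge_inj d n 0) (@reaches d n).
rewrite -Ph; apply: le_measure; rewrite ?inE //; first by rewrite connected_toE.
move=> w /= /existsP[u /andP[+ uc]]; rewrite finset.inE => un.
have uN : (normoo (pos u) <= N)%N by exact: leq_trans (normoo_pos u) nN.
move: (conn_cluster uc); rewrite !ptK ?normoo0 // => /cluster_exits.
exact.
Qed.

End OneArm.

(** * The chemical distance as an event of the box *)

Section ChemicalDistance.
Variables (R : realType) (d n : nat).
Implicit Types (w : config d) (t : R).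

Let o : bvertex d n := pt n 0.
Let po : pos o = 0. Proof. by rewrite ptK ?normoo0. Qed.

(** Distance at least [t] inside the box: lying in [sball] of radius [r + 1] means being at distance
    at most [r]. *)
Definition far t (w : {set bedge d n}) : bool := `[< forall (v : bvertex d n) r,
  on_boundary v -> v \in sball (@binc d n) w o r.+1 -> t <= r%:R >].

(** A lattice path leaving the box has passed a boundary vertex before, within at most as many
    steps. Shortest paths to the boundary can therefore be sought inside the box. *)
Let open_path_box w (s : seq (vertex d)) : path (open_adj w) 0 s ->
  ((normoo (last 0%R s) <= n)%N /\
     pt n (last 0%R s) \in sball (@binc d n) (bview n 0 w) o (size s).+1) \/
  exists2 v, on_boundary v & v \in sball (@binc d n) (bview n 0 w) o (size s).+1.
Proof.
elim/last_ind: s => [|s y IH].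
  by move=> _; left; split; [rewrite normoo0|exact: sball_mem].
rewrite rcons_path last_rcons size_rcons => /andP[/IH{IH} IH sy].
case: IH => [[xn xs]|[v bv vs]]; last first.
  by right; exists v => //; apply: fintype.subsetP (sball_sub _ _ _ (leqnSn _)) _ vs.
have [yn|/negP yn] := boolP (normoo y <= n)%N.
  left; split=> //; apply: sball_adj xs _.
  by rewrite adj_bview !ptK // !addr0.
right; exists (pt n (last 0 s)); first exact: exits_boundary xn sy yn.
exact: fintype.subsetP (sball_sub _ _ _ (leqnSn _)) _ xs.
Qed.

Let box_path w (s : seq (bvertex d n)) (x : bvertex d n) :
  path (adj (@binc d n) (bview n 0 w)) x s -> path (open_adj w) (pos x) (map (@pos d n) s).
Proof.
elim: s x => //= y s IH x /andP[xy /IH ->]; rewrite andbT.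
by move: xy; rewrite adj_bview !addr0.
Qed.

Lemma chemical_distanceE t :
  [set w : config d | (t%:E <= chemical_distance R n w)%E] =
  [set w | far t (bview n 0 w)].
Proof.
apply/seteqP; split=> w /= H.
  apply/asboolP => v r bv /sball_path[s [ps sv sr]].
  apply: le_trans (_ : (size s)%:R <= _); last by rewrite ler_nat -ltnS.
  rewrite -lee_fin; apply: le_trans H _; apply: ereal_inf_lbound.
  exists (map (@pos d n) s); last by rewrite size_map.
  exists (pos v); first exact/asboolP.
  split; first by have := box_path ps; rewrite po.
  by rewrite -po last_map sv.
move/asboolP: H => H; apply: le_ereal_inf_tmp => _ [s [y by_ [ps sy]] <-]; rewrite lee_fin.
have [[_ ys]|[v bv vs]] := open_path_box ps; last exact: H bv vs.
apply: H ys; apply/asboolP; rewrite sy ptK //; by case: by_.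
Qed.

(** The boundary vertex nearest to the origin lies on the sphere at its own distance, which is at
    least [t >= K]. *)
Lemma far_alive t (w : {set bedge d n}) (K : nat) : far t w -> reaches w ->
  K%:R <= t -> alive (@binc d n) w o K.
Proof.
move=> /asboolP F /existsP[v /andP[bv /conn_sball ex]] Kt.
case: (ex_minnP ex) => r vr rmin.
apply: (@alive_leq _ _ (@binc d n) w o K r).
  by rewrite -(ler_nat R) (le_trans Kt) //; exact: F vr.
apply/set0Pn; exists v; rewrite finset.inE vr andbT.
case: r vr rmin {F} => [|r] vr rmin; first by rewrite finset.inE.
by apply/negP => /rmin; rewrite ltnn.
Qed.

End ChemicalDistance.

(** * Exponential decay at the critical point *)

Section Conclusion.
Variables (R : realType) (d : nat).
Hypothesis hd : high_dimensional R d.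
Local Notation pc := (critical_prob R d).

Let d6 : (6 < d)%N. Proof. by case: hd. Qed.

Let pc01 : 0 <= pc <= 1. Proof. exact: critical_prob01. Qed.

Lemma box_susceptibility : exists2 C : nat, (0 < C)%N & forall n (x : bvertex d n),
  (0 < n)%N -> \sum_y btau pc x y <= (C * n ^ 2)%:R.
Proof.
have [Ct Ct1 tk] := btau_ker hd.
have Ct0 : 0 <= Ct by rewrite (le_trans ler01).
pose B := Ct * (3 * cball R d 0) * 4.
have B0 : 0 <= B by rewrite !mulr_ge0 ?ler0n.
exists (Num.Def.archi_bound B).+1 => // n x n0.
have [a /andP[na an]] := dyadic_scale n0.
apply: le_trans (_ : \sum_(y : bvertex d n | (normoo (0 - pos y)%R <= 2 ^ a)%N)
   Ct * ker R (n.*2).+1 (d - 2) 0 (pos x - pos y) <= _).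
  rewrite [leRHS]big_mkcond; apply: ler_sum => y _.
  rewrite sub0r normooN (leq_trans (normoo_pos y)) //.
  by apply: tk; rewrite ?lexx ?andbT //; [case/andP: pc01|rewrite ltnW // ltn_expl].
rewrite -big_distrr /=.
apply: le_trans (_ : Ct * (3 * cball R d 0 * 2 ^+ (2 * a)) <= _).
  by apply: ler_wpM2l => //; apply: ker_ball; lia.
have an' : 2 ^+ (2 * a) <= 4 * n%:R ^+ 2 :> R.
  rewrite mulnC exprM (_ : 4 = 2 ^+ 2 :> R); last by ring.
  rewrite -exprMn; apply: lerXn2r; rewrite ?nnegrE ?exprn_ge0 ?mulr_ge0 //.
  by rewrite -natrX -natrM ler_nat mul2n.
apply: le_trans (_ : B * n%:R ^+ 2 <= _).
  rewrite /B -!mulrA; apply: ler_wpM2l => //; rewrite mulrA; rewrite [leRHS]mulrA.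
  by apply: ler_wpM2l => //; rewrite mulr_ge0.
rewrite natrM natrX; apply: ler_wpM2r; first by rewrite exprn_ge0.
by apply: ltW; apply: lt_le_trans (archi_boundP B0) _; rewrite ler_nat.
Qed.

Let half_expR : 2^-1 <= expR (- 2^-1) :> R.
Proof. by apply: le_trans (expR_ge1Dx _); lra. Qed.

Lemma survival_critical : exists c C : R, [/\ 0 < c, 0 < C &
  forall n (t : R), (0 < n)%N -> 1 <= t ->
    Pr (fun=> pc) (fun w => reaches w && @far R d n (t * n%:R ^+ 2) w) <=
    C * expR (- (c * t)) / n%:R ^+ 2].
Proof.
have [X X0 HX] := box_susceptibility.
have [C HC] := volume_tail_critical hd.
pose A : R := 3 * (864 * C).+1%:R.
have A0 : 0 < A by rewrite mulr_gt0 ?ltr0n.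
have X0' : 0 < X%:R :> R by rewrite ltr0n.
(* Each block of [2 X n^2] spheres gains a factor [1/2 <= exp(-1/2)], hence the rate [1 / (4 X)];
   the rounding of [k] and the shift [t - 1] cost at most [exp 2]. *)
exists (4 * X%:R)^-1, (A * expR (1 + 1)); split.
- by rewrite invr_gt0 mulr_gt0.
- by rewrite mulr_gt0 ?expR_gt0.
move=> n t n0 t1.
have n20 : (0 < n ^ 2)%N by rewrite expn_gt0 n0.
have n20' : 0 < n%:R ^+ 2 :> R by rewrite exprn_gt0 ?ltr0n.
(* The largest number of blocks that leaves a final stretch of [n^2] steps within [t n^2];
   [survival_exp] with [s = n^2] turns this stretch into the factor [n^-2] needed against the
   one-arm probability. *)
pose k := Num.truncn ((t - 1) / (2 * X%:R)).
have z0 : 0 <= (t - 1) / (2 * X%:R) by rewrite divr_ge0 ?mulr_ge0 ?subr_ge0 // ltW.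
have /andP[kz zk] := truncn_itv z0; rewrite -/k in kz zk.
have s := @survival_exp R _ _ _ (@binc_uniq d n) (fun=> pc) (fun=> pc01) C
  (fun x m => HC n m x) (X * n ^ 2)%N (fun x => HX n x n0) k (n ^ 2)%N.
have {s} := s _ n20 finset.setT (pt n 0).
rewrite muln_gt0 X0 n20 => /(_ isT).
set K := (k * _ + _)%N => s.
have Kt : K%:R <= t * n%:R ^+ 2.
  have -> : K%:R = (k%:R * (2 * X%:R) + 1) * n%:R ^+ 2 :> R.
    by rewrite -natrX /K; move: (n ^ 2)%N => q; rewrite natrD !natrM; ring.
  rewrite ler_pM2r //; move: kz; rewrite ler_pdivlMr ?mulr_gt0 //.
  by move: (_ * (2 * _)) => u; lra.
apply: le_trans (_ : Pr (fun=> pc) (fun w => alive (@binc d n) (w :&: finset.setT)%SET (pt n 0) K) <= _).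
  by apply: le_Pr => // w /andP[rw fw]; rewrite finset.setIT; exact: far_alive fw rw Kt.
apply: le_trans s _; rewrite natrX -/A mulrA; apply: ler_wpM2r; first by rewrite invr_ge0 ltW.
rewrite mulrC -mulrA; apply: ler_wpM2l; first exact: ltW.
apply: le_trans (_ : expR (- 2^-1) ^+ k <= _).
  by apply: lerXn2r; rewrite ?nnegrE ?expR_ge0 // invr_ge0.
rewrite -expRM_natr -expRD ler_expR.
have : t - 1 < (k%:R + 1) * (2 * X%:R).
  by move: zk; rewrite ltr_pdivrMr ?mulr_gt0 // -natr1.
have X1 : 1 <= X%:R :> R by rewrite ler1n.
rewrite -[in t - 1](mulVKf (_ : (4 * X%:R != 0 :> R)) t).
  move: (_^-1 * t) => u; nra.
by rewrite mulf_neq0 ?gt_eqF // mulr_gt0.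
Qed.

End Conclusion.

Local Open Scope ring_scope.

Theorem theorem3 (R : realType) (d : nat) (hd : high_dimensional R d) :
  exists c C : R, [/\ 0 < c, 0 < C &
    forall (n : nat) (lambda : R), (1 <= n)%N -> 0 < lambda ->
      cond_prob (percolation d (critical_prob R d))
        [set w | ((lambda * n%:R ^+ 2)%:E <= chemical_distance R n w)%E]
        (connected_to 0 (boundary (@box d n)))
      <= C * expR (- (c * lambda))].
Proof.
have [c [C [c0 C0 HC]]] := survival_critical hd; have [c1 c10 lower] := one_arm_lower hd.
have C10 : 0 < C / c1 by rewrite divr_gt0.
(* The summand [C / c1] serves for [lambda >= 1]. For smaller [lambda] the bound is trivial, since
   [expR c * expR (- (c * lambda)) >= 1]. *)
exists c, (C / c1 + expR c); split=> //; first by rewrite addr_gt0 ?expR_gt0.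
move=> n lambda n0 l0.
have n20 : 0 < n%:R ^+ 2 :> R by rewrite exprn_gt0 ?ltr0n.
have law := percolationP (d := d) (critical_prob01 R d).
have PE A := P_view law (@shift_edge_inj d n 0) A.
have := lower n n0; rewrite /cond_prob chemical_distanceE connected_toE.
rewrite (_ : _ `&` _ = [set w : config d | reaches (view (@shift_edge d n 0) w) &&
    far (lambda * n%:R ^+ 2) (view (@shift_edge d n 0) w)]); last first.
  by apply/seteqP; split=> w /= => [[? ->]|/andP[? ->]].
rewrite (PE (@reaches d n)) (PE (fun w => reaches w && far (lambda * n%:R ^+ 2) w)) /= lee_fin.
set p := Pr _ _; set q := Pr _ _ => lo.
have p0 : 0 < p by apply: lt_le_trans lo; rewrite divr_gt0.
rewrite ler_pdivrMr // mulrDl mulrDl.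
have e0 := expR_ge0 (- (c * lambda)).
have [l1|l1] := lerP 1 lambda.
  apply: le_trans (HC _ _ n0 l1) _; apply: le_trans (_ : C / c1 * expR (- (c * lambda)) * p <= _).
    apply: le_trans (ler_wpM2l _ lo); last by rewrite mulr_ge0 // ltW.
    rewrite le_eqVlt; apply/orP; left; apply/eqP; field.
    by rewrite !gt_eqF // ltr0n.
  by rewrite lerDl !mulr_ge0 ?expR_ge0 // ltW.
apply: le_trans (_ : expR c * expR (- (c * lambda)) * p <= _); last first.
  by rewrite lerDr; exact: mulr_ge0 (mulr_ge0 (ltW C10) e0) (ltW p0).
apply: le_trans (_ : p <= _).
  by apply: le_Pr => [_|w /andP[]//]; exact: critical_prob01.
rewrite ler_peMl ?(ltW p0) // -expRD -expR0 ler_expR.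
by have := ler_wpM2l (ltW c0) (ltW l1); lra.
Qed.
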